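(* Let $(Q,\mathcal P)$ be a thread quiver with path category $\mathcal C$, let $\mathcal I$ be an ideal of $\mathcal C$, let $\mathcal A=\mathcal C/\mathcal I$, and let $M$ be a pointwise finite-dimensional representation of $\mathcal A$. Then: (1) $M$ decomposes uniquely (up to isomorphism and permutation of summands) into a direct sum of indecomposable representations. (2) Each indecomposable summand of $M$ is either noise, or it is noise free and induced from an indecomposable representation of a finite subthreading of $\mathcal A$; the latter means that it is isomorphic to $\mathrm{Ind}_{\mathfrak P}(N)$ for some valid partition $\mathfrak P$, some sample $\mathcal M$ of $\mathfrak P$, and some indecomposable $N\in\mathrm{rep}^{\mathrm{pwf}}(\overline{\mathcal A}^{\mathfrak P}(\mathcal M))$. (3) If $Q$ is finite, then only finitely many indecomposable summands of $M$ are noise free.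
   Context: $k$ is an algebraically closed field. A thread quiver $(Q,\mathcal P)$ consists of a (possibly infinite) quiver $Q=(Q_0,Q_1,s,t)$ and, for every arrow $\alpha$, a (possibly empty) linearly ordered set $\mathcal P_\alpha$; $\overline{\mathcal P}_\alpha=\mathcal P_\alpha\sqcup\{\min(\alpha),\max(\alpha)\}$ is obtained by adding a new least element $\min(\alpha)$ and a new greatest element $\max(\alpha)$. Its path category $\mathcal C$ is the $k$-linear category with object set $Q_0\sqcup\bigsqcup_\alpha\mathcal P_\alpha$, where $\min(\alpha),\max(\alpha)$ are viewed as the objects $s(\alpha),t(\alpha)$ (they remain distinct elements of $\overline{\mathcal P}_\alpha$ even if $\alpha$ is a loop). For $x\le y$ in $\overline{\mathcal P}_\alpha$ there is a morphism $\eta_{y,x}=\eta_{yx}:x\to y$, with $\eta_{xx}=e_x$ the identity, $\eta_{zy}\eta_{yx}=\eta_{zx}$ for $x\le y\le z$, and $\eta_{\max(\alpha),\min(\alpha)}=\alpha$; write $\eta_{t(\alpha),x}:=\eta_{\max(\alpha),x}$ and $\eta_{x,s(\alpha)}:=\eta_{x,\min(\alpha)}$. The space $\mathrm{Hom}_{\mathcal C}(x,y)$ has as $k$-basis the distinct path-like elements from $x$ to $y$: the identities $e_x$, the $\eta_{yx}$, and the elements $\eta_{y,s(\beta)}\,p\,\eta_{t(\alpha),x}$ with $x\in\overline{\mathcal P}_\alpha$, $y\in\overline{\mathcal P}_\beta$ and $p$ a (possibly trivial) path of $Q$ from $t(\alpha)$ to $s(\beta)$. Composition is induced by concatenation of paths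 in $Q$ together with the relations $\eta_{zy}\eta_{yx}=\eta_{zx}$ for $x\le y\le z$ in $\overline{\mathcal P}_\alpha$ and $\eta_{\max(\alpha),\min(\alpha)}=\alpha$, for every arrow $\alpha$. For a $k$-linear category $\mathcal D$, $\mathrm{rep}^{\mathrm{pwf}}(\mathcal D)$ is the category of pointwise finite-dimensional representations, i.e. covariant $k$-linear functors from $\mathcal D$ to finite-dimensional $k$-vector spaces. For a (two-sided) ideal $\mathcal I$ of $\mathcal C$ and $\mathcal A=\mathcal C/\mathcal I$, $\mathrm{rep}^{\mathrm{pwf}}(\mathcal A)$ is identified with the full subcategory of $\mathrm{rep}^{\mathrm{pwf}}(\mathcal C)$ of those $M$ with $M(f)=0$ for all $f\in\mathcal I$. $M$ is noise if its support $\mathrm{supp}(M)=\{x: M(x)\ne0\}$ satisfies $\mathrm{supp}(M)\cap Q_0=\emptyset$; $M$ is noise free if no nonzero direct summand of $M$ is noise. An interval of a linearly ordered set is a nonempty subset $I$ such that $x<z<y$ with $x,y\in I$ implies $z\in I$. A valid partition $\mathfrak P$ is a partition of the objects of $\mathcal C$ such that $\{x\}$ is a cell for each $x\in Q_0$, and each $\mathcal P_\alpha$ is a union of finitely many cells that are intervals. A sample $\mathcal M$ of $\mathfrak P$ is a set of objects containing exactly one element of each cell. $\Sigma_{\mathfrak P}$ is the set of nonzero scalar multiples of the morphisms $\eta_{yx}$ with $x\le y$ in the same cell. Morphisms $f_1:x_1\to y_1$, $f_2:x_2\to y_2$ of $\mathcal C$ with $x_1,x_2$ in one cell $X$ and $y_1,y_2$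 in one cell $Y$ are $\mathfrak P$-equivalent if there are $z\in X$, $w\in Y$ with $\eta_{wy_1}f_1\eta_{x_1z}=\eta_{wy_2}f_2\eta_{x_2z}$. The $\mathfrak P$-completion $\overline{\mathcal I}^{\mathfrak P}$ is the ideal of $\mathcal C$ generated by all $f$ that are $\mathfrak P$-equivalent to some $g\in\mathcal I$, and $\overline{\mathcal A}^{\mathfrak P}=\mathcal C/\overline{\mathcal I}^{\mathfrak P}$; $\overline{\mathcal A}^{\mathfrak P}(\mathcal M)$ is its full subcategory on $\mathcal M$. Let $\mathbf r:\overline{\mathcal A}^{\mathfrak P}\to\overline{\mathcal A}^{\mathfrak P}(\mathcal M)$ be the functor sending $x$ to the unique $s_x\in\mathcal M$ in the cell of $x$, and sending $p:x\to y$ to the unique (in $\overline{\mathcal A}^{\mathfrak P}$) morphism $p':s_x\to s_y$ that is $\mathfrak P$-equivalent to $p$. The induction functor is $\mathrm{Ind}_{\mathfrak P}=\mathbf r^*:\mathrm{rep}^{\mathrm{pwf}}(\overline{\mathcal A}^{\mathfrak P}(\mathcal M))\to\mathrm{rep}^{\mathrm{pwf}}(\overline{\mathcal A}^{\mathfrak P})\subseteq\mathrm{rep}^{\mathrm{pwf}}(\mathcal A)$, $N\mapsto N\circ\mathbf r$. *)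

(* Defs.v *)
From HB Require Import structures.
From mathcomp Require Import all_boot all_order all_algebra.
From mathcomp Require Import boolp classical_sets cardinality fsbigop.
From mathcomp Require Import finmap monalg.

Set Implicit Arguments.
Unset Strict Implicit.
Unset Printing Implicit Defensive.

Import Order.TTheory GRing.Theory.
Local Open Scope classical_set_scope.
Local Open Scope ring_scope.

Record lincat (k : fieldType) := LinCat {
  obj :> Type;
  hom : obj -> obj -> lmodType k;
  idm : forall x, hom x x;
  comp : forall x y z, hom y z -> hom x y -> hom x z;
  compA : forall w x y z (h : hom y z) (g : hom x y) (f : hom w x),
    comp h (comp g f) = comp (comp h g) f;
  comp1m : forall x y (f : hom x y), comp (idm y) f = f;
  compm1 : forall x y (f : hom x y), comp f (idm x) = f;
  comp_linl : forall x y z (f : hom x y),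
    linear (fun g : hom y z => comp g f);
  comp_linr : forall x y z (g : hom y z),
    linear (fun f : hom x y => comp g f)
}.

Arguments hom {k C} x y : rename.
Arguments idm {k C} x : rename.
Arguments comp {k C x y z} g f : rename.

Record lfunctor (k : fieldType) (C D : lincat k) := LFunctor {
  fobj :> C -> D;
  fmap : forall x y, hom x y -> hom (fobj x) (fobj y);
  fmap_lin : forall x y, linear (@fmap x y);
  fmap1 : forall x, fmap (idm x) = idm (fobj x);
  fmapM : forall x y z (g : hom y z) (f : hom x y),
    fmap (comp g f) = comp (fmap g) (fmap f)
}.

Arguments fmap {k C D} F {x y} f : rename.

Section FunctorComp.
Variables (k : fieldType) (C D E : lincat k).
Variables (G : lfunctor D E) (F : lfunctor C D).

Definition fcomp : lfunctor C E.
Proof.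
refine (@LFunctor k C E (fun x => G (F x))
  (fun x y f => fmap G (fmap F f)) _ _ _).
- by move=> x y a f g; rewrite !fmap_lin.
- by move=> x; rewrite !fmap1.
- by move=> x y z g f; rewrite !fmapM.
Defined.

End FunctorComp.

Record ideal (k : fieldType) (C : lincat k) := Ideal {
  id_mem :> forall x y : C, submodClosed (hom x y);
  id_compl : forall x y z (g : hom y z) (f : hom x y),
    f \in id_mem x y -> comp g f \in id_mem x z;
  id_compr : forall x y z (g : hom y z) (f : hom x y),
    g \in id_mem y z -> comp g f \in id_mem x z
}.

Section GeneratedIdeal.
Variables (k : fieldType) (C : lincat k).
Variable S : forall x y : C, set (hom x y).

Definition gen_pred (x y : C) : pred (hom x y) := fun f =>
  `[< forall J : ideal C,
        (forall x' y' (g : hom x' y'), S g -> g \in J x' y') -> f \in J x y >].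

Lemma gen_pred_closed x y : submod_closed (@gen_pred x y).
Proof.
split.
  by apply/asboolP => J _; apply: rpred0.
move=> a f g /asboolP fS /asboolP gS; apply/asboolP => J SJ.
by apply: rpredD; [apply/rpredZ/fS | apply: gS].
Qed.

Definition gen_submod x y : submodClosed (hom x y) :=
  HB.pack (@gen_pred x y)
    (GRing.isSubmodClosed.Build k (hom x y) (@gen_pred x y)
      (@gen_pred_closed x y)).

Definition gen_ideal : ideal C.
Proof.
refine (@Ideal k C gen_submod _ _).
- move=> x y z g f /asboolP fS; apply/asboolP => J SJ.
  exact/id_compl/fS.
- move=> x y z g f /asboolP gS; apply/asboolP => J SJ.
  exact/id_compr/gS.
Defined.

Lemma gen_ideal_sub x y (f : hom x y) : S f -> f \in gen_ideal x y.
Proof. by move=> Sf; apply/asboolP => J; apply. Qed.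

End GeneratedIdeal.

Section QuotientModule.
Variables (k : fieldType) (V : lmodType k) (S : submodClosed V).

Fact submod_oppr_closed : oppr_closed S.
Proof. by move=> v vS; rewrite -scaleN1r rpredZ. Qed.

Definition submod_zmod : zmodClosed V :=
  HB.pack (GRing.SubmodClosed.sort S)
    (GRing.isOppClosed.Build V (GRing.SubmodClosed.sort S) submod_oppr_closed).

Definition quotmod := Quotient.quot submod_zmod.
HB.instance Definition _ := GRing.Zmodule.on quotmod.

Definition qpi (v : V) : quotmod := (\pi_(Quotient.quot submod_zmod) v)%qT.
Definition qrepr (q : quotmod) : V := repr (q : Quotient.quot submod_zmod).

Lemma qreprK q : qpi (qrepr q) = q.
Proof. exact: reprK. Qed.

Lemma qpi_eq u v : (qpi u = qpi v) <-> (u - v \in S).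
Proof.
have := Quotient.idealrBE submod_zmod u v => E.
by split=> [/eqP|uv]; [rewrite -E | apply/eqP; rewrite -E].
Qed.

Lemma qpiD u v : qpi (u + v) = qpi u + qpi v.
Proof. exact: Quotient.pi_add. Qed.

Definition qscale a q := qpi (a *: qrepr q).

Lemma qpiZ a v : qscale a (qpi v) = qpi (a *: v).
Proof. by apply/qpi_eq; rewrite -scalerBr rpredZ //; apply/qpi_eq/qreprK. Qed.

Fact qscalerA a b q : qscale a (qscale b q) = qscale (a * b) q.
Proof. by rewrite -[q]qreprK !qpiZ scalerA. Qed.
Fact qscale1r : left_id 1 qscale.
Proof. by move=> q; rewrite -[q]qreprK qpiZ scale1r. Qed.
Fact qscalerDr : right_distributive qscale +%R.
Proof.
by move=> a p q; rewrite -[p]qreprK -[q]qreprK -qpiD !qpiZ scalerDr qpiD.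
Qed.
Fact qscalerDl q : {morph qscale^~ q : a b / a + b}.
Proof. by move=> a b; rewrite -[q]qreprK !qpiZ scalerDl qpiD. Qed.

HB.instance Definition _ :=
  GRing.Zmodule_isLmodule.Build k quotmod
    qscalerA qscale1r qscalerDr qscalerDl.

Lemma qpi_lin : linear qpi.
Proof. by move=> a u v; rewrite qpiD -qpiZ. Qed.

End QuotientModule.

Section QuotientCategory.
Variables (k : fieldType) (C : lincat k) (I : ideal C).

Definition qhom (x y : C) : lmodType k := quotmod (I x y).

Definition qcomp x y z (g : qhom y z) (f : qhom x y) : qhom x z :=
  qpi (I x z) (comp (qrepr g) (qrepr f)).

Lemma comp_subl x y z (g g' : hom y z) (f : hom x y) :
  comp g f - comp g' f = comp (g - g') f :> @hom k C x z.
Proof.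
have := comp_linl f (-1) g' g; rewrite /= !scaleN1r => E.
by rewrite addrC -E addrC.
Qed.

Lemma comp_subr x y z (g : hom y z) (f f' : hom x y) :
  comp g f - comp g f' = comp g (f - f') :> @hom k C x z.
Proof.
have := comp_linr g (-1) f' f; rewrite /= !scaleN1r => E.
by rewrite addrC -E addrC.
Qed.

Lemma qcompE x y z (g : hom y z) (f : hom x y) :
  qcomp (qpi (I y z) g) (qpi (I x y) f) = qpi (I x z) (comp g f).
Proof.
apply/qpi_eq; rewrite -[X in X - _](subrK (comp g (qrepr (qpi (I x y) f)))).
rewrite -addrA comp_subl comp_subr; apply: rpredD.
  by apply: id_compr; apply/qpi_eq; rewrite qreprK.
by apply: id_compl; apply/qpi_eq; rewrite qreprK.
Qed.

Definition quot_cat : lincat k.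
Proof.
refine (@LinCat k C qhom (fun x => qpi (I x x) (idm x)) qcomp _ _ _ _ _).
- move=> w x y z h g f; rewrite -[h]qreprK -[g]qreprK -[f]qreprK.
  by rewrite !qcompE compA.
- by move=> x y f; rewrite -[f]qreprK qcompE comp1m.
- by move=> x y f; rewrite -[f]qreprK qcompE compm1.
- move=> x y z f a g g'; rewrite -[g]qreprK -[g']qreprK -[f]qreprK.
  by rewrite -qpi_lin !qcompE -qpi_lin comp_linl.
- move=> x y z g a f f'; rewrite -[g]qreprK -[f]qreprK -[f']qreprK.
  by rewrite -qpi_lin !qcompE -qpi_lin comp_linr.
Defined.

Definition quot_fun : lfunctor C quot_cat.
Proof.
refine (@LFunctor k C quot_cat (fun x => x) (fun x y => qpi (I x y)) _ _ _).
- by move=> x y; apply: qpi_lin.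
- by [].
- by move=> x y z g f; rewrite -qcompE.
Defined.

End QuotientCategory.

Section QuotientQuotient.
Variables (k : fieldType) (C : lincat k) (I J : ideal C).
Hypothesis IJ : forall x y (f : hom x y), f \in I x y -> f \in J x y.

Lemma quot_quotE x y (f : hom x y) :
  qpi (J x y) (qrepr (qpi (I x y) f)) = qpi (J x y) f.
Proof. by apply/qpi_eq/IJ; apply/qpi_eq/qreprK. Qed.

Definition quot_quot : lfunctor (quot_cat I) (quot_cat J).
Proof.
refine (@LFunctor k (quot_cat I) (quot_cat J) (fun x => x)
  (fun x y (f : qhom I x y) => qpi (J x y) (qrepr f) : qhom J x y) _ _ _).
- move=> x y a f g; rewrite /= -[f]qreprK -[g]qreprK -qpi_lin !quot_quotE.
  exact: qpi_lin.
- by move=> x; rewrite /= quot_quotE.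
- move=> x y z g f; rewrite /= -[f]qreprK -[g]qreprK qcompE !quot_quotE.
  by rewrite qcompE.
Defined.

End QuotientQuotient.

(* A dedicated record and a bare predicate: sig and set would force the objects
   of every lincat, hence all of vectType k, into too small a universe. *)
Record sub_obj (k : fieldType) (C : lincat k) (s : C -> Prop) := SubObj {
  so_val :> C;
  so_valP : s so_val
}.

Definition full_subcat (k : fieldType) (C : lincat k) (s : C -> Prop) :
  lincat k.
Proof.
refine (@LinCat k (sub_obj s) (fun x y => hom (so_val x) (so_val y))
  (fun x => idm (so_val x)) (fun x y z g f => comp g f) _ _ _ _ _).
- by move=> *; apply: compA.
- by move=> *; apply: comp1m.
- by move=> *; apply: compm1.
- by move=> x y z f; apply: comp_linl.
- by move=> x y z g; apply: comp_linr.
Defined.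

Definition vect_cat (k : fieldType) : lincat k.
Proof.
refine (@LinCat k (vectType k) (fun V W => 'Hom(V, W)) (fun V => \1%VF)
  (fun U V W g f => (g \o f)%VF) _ _ _ _ _).
- by move=> *; rewrite comp_lfunA.
- by move=> *; rewrite comp_lfun1l.
- by move=> *; rewrite comp_lfun1r.
- by move=> x y z f a g g' /=; rewrite comp_lfunDl comp_lfunZl.
- by move=> x y z g a f f' /=; rewrite comp_lfunDr comp_lfunZr.
Defined.

Definition rep (k : fieldType) (C : lincat k) := lfunctor C (vect_cat k).

Section Representations.
Variables (k : fieldType) (C : lincat k).
Implicit Types M N : rep C.

Definition rep_at M (x : C) : vectType k := fobj M x.
Coercion rep_at : rep >-> Funclass.

Definition rep_map M (x y : C) (f : hom x y) : 'Hom(M x, M y) := fmap M f.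

Record rep_hom M N := RepHom {
  rh_at :> forall x, 'Hom(M x, N x);
  rh_nat : forall x y (f : hom x y),
    (rh_at y \o rep_map M f)%VF = (rep_map N f \o rh_at x)%VF
}.

Definition rep_iso M N := exists (f : rep_hom M N) (g : rep_hom N M),
  forall x, (g x \o f x = \1)%VF /\ (f x \o g x = \1)%VF.

Definition zero_rep M := forall x, {: M x}%VS = 0%VS.

Definition pair_lfun (V V' W W' : vectType k) (f : 'Hom(V, W))
    (g : 'Hom(V', W')) : 'Hom((V * V')%type, (W * W')%type) :=
  linfun (fun v => (f v.1, g v.2)).

Lemma pair_lfunE (V V' W W' : vectType k) (f : 'Hom(V, W))
    (g : 'Hom(V', W')) v :
  pair_lfun f g v = (f v.1, g v.2).
Proof.
have lin : linear (fun v : (V * V')%type => (f v.1, g v.2)).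
  by move=> a u w; rewrite /= !linearP.
exact: (lfunE (HB.pack (fun v : (V * V')%type => (f v.1, g v.2))
  (GRing.isLinear.Build _ _ _ _ _ lin) : {linear _ -> _})).
Qed.

Definition rep_sum M N : rep C.
Proof.
refine (@LFunctor k C (vect_cat k) (fun x => (M x * N x)%type : vectType k)
  (fun x y f => pair_lfun (rep_map M f) (rep_map N f)) _ _ _).
- move=> x y a f g; apply/lfunP => v.
  rewrite add_lfunE scale_lfunE !pair_lfunE.
  by rewrite /rep_map !fmap_lin !add_lfunE !scale_lfunE.
- move=> x; apply/lfunP => -[u v]; rewrite pair_lfunE /rep_map !fmap1.
  by rewrite !id_lfunE.
- move=> x y z g f; apply/lfunP => v.
  by rewrite comp_lfunE !pair_lfunE /rep_map !fmapM !comp_lfunE.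
Defined.

Definition direct_summand N M := exists N', rep_iso M (rep_sum N N').

Definition indecomposable M :=
  ~ zero_rep M /\
  forall N N', rep_iso M (rep_sum N N') -> zero_rep N \/ zero_rep N'.

(* The support condition is needed: \sum_(j \in _) is 0 on infinite supports. *)
Definition is_direct_sum M (J : choiceType) (N : J -> rep C)
    (i : forall j, rep_hom (N j) M) :=
  forall (x : C) (v : M x), exists! w : (forall j, N j x),
    finite_set [set j | w j != 0] /\ v = \sum_(j \in [set: J]) i j x (w j).

Definition decomposition M (J : choiceType) (N : J -> rep C) :=
  (forall j, indecomposable (N j)) /\
  exists i : forall j, rep_hom (N j) M, is_direct_sum i.

End Representations.

Record thread_quiver := ThreadQuiver {
  vertex : Type;
  arrow : Type;
  src : arrow -> vertex;
  tgt : arrow -> vertex;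
  thread_disp : Order.disp_t;
  thread : arrow -> orderType thread_disp
}.

Section PathCategory.
Variable Q : thread_quiver.

Inductive qpath : vertex Q -> vertex Q -> Type :=
| PNil v : qpath v v
| PCons (a : arrow Q) v (p : qpath (tgt a) v) : qpath (src a) v.

(* pcat p q runs through p first *)
Fixpoint pcat u v w (p : qpath u v) : qpath v w -> qpath u w :=
  match p with
  | PNil _ => id
  | PCons a _ p' => fun q => PCons (pcat p' q)
  end.

Lemma pcatA u v w z (p : qpath u v) (q : qpath v w) (r : qpath w z) :
  pcat p (pcat q r) = pcat (pcat p q) r.
Proof. by elim: p q r => //= a v' p IH q r; rewrite IH. Qed.

Lemma pcatp0 u v (p : qpath u v) : pcat p (PNil v) = p.
Proof. by elim: p => //= a w p ->. Qed.

Inductive tobj := Vtx of vertex Q | Thr (a : arrow Q) of thread a.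

Definition exit_vtx (x : tobj) : vertex Q :=
  match x with Vtx v => v | Thr a _ => tgt a end.
Definition entry_vtx (x : tobj) : vertex Q :=
  match x with Vtx v => v | Thr a _ => src a end.

Definition crossing (x : tobj) : qpath (entry_vtx x) (exit_vtx x) :=
  match x with
  | Vtx v => PNil v
  | Thr a _ => PCons (PNil (tgt a))
  end.

(* The distinct path-like elements from x to y: PShort is eta_{qp} for p <= q
   in the same thread, and PLong p is eta_{y,s(b)} p eta_{t(a),x} for a path p,
   where the outer factors are present only if y (resp. x) lies in the thread
   of an arrow b (resp. a).  Identities are PLong (PNil _) at a vertex and
   PShort at a point of a thread; the element eta_{t(a),s(a)} is the arrow a. *)
Inductive plike : tobj -> tobj -> Type :=
| PShort (a : arrow Q) (p q : thread a) of (p <= q)%O :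
    plike (Thr p) (Thr q)
| PLong x y of qpath (exit_vtx x) (entry_vtx y) : plike x y.

Definition plike_id (x : tobj) : plike x x :=
  match x with
  | Vtx v => @PLong (Vtx v) (Vtx v) (PNil v)
  | Thr a p => PShort (lexx p)
  end.

(* Composition in diagrammatic order.  The relations eta_{zy} eta_{yx} =
   eta_{zx} make it absorb PShort into PLong, and turn a composite through a
   point of a thread a into a path through a. *)
Definition plike_mulS (a : arrow Q) (p q : thread a) (pq : (p <= q)%O)
    z (g : plike (Thr q) z) : plike (Thr p) z :=
  match g in plike y z
    return match y return Type with
           | Vtx _ => unit
           | Thr a q => forall p, (p <= q)%O -> plike (Thr p) z
           end
  with
  | PShort a q r qr => fun p pq => PShort (le_trans pq qr)
  | PLong y z w =>
      match y return qpath (exit_vtx y) (entry_vtx z) ->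
                     match y return Type with
                     | Vtx _ => unit
                     | Thr a q => forall p, (p <= q)%O -> plike (Thr p) z
                     end
      with
      | Vtx _ => fun _ => tt
      | Thr a q => fun w p _ => @PLong (Thr p) z w
      end w
  end p pq.

Definition plike_mul x y z (f : plike x y) : plike y z -> plike x z :=
  match f in plike x y return plike y z -> plike x z with
  | PShort a p q pq => @plike_mulS a p q pq z
  | PLong x y w => fun g =>
      match g in plike y z
        return qpath (exit_vtx x) (entry_vtx y) -> plike x z
      with
      | PShort a p q _ => fun w => @PLong x (Thr q) w
      | PLong y z w' => fun w =>
          PLong (pcat w (pcat (crossing y) w'))
      end w
  end.

Lemma plike_ThrP (a : arrow Q) (q : thread a)
    (P : forall z, plike (Thr q) z -> Prop) :
  (forall (r : thread a) (qr : (q <= r)%O), P (Thr r) (PShort qr)) ->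
  (forall z (w : qpath (tgt a) (entry_vtx z)), P z (@PLong (Thr q) z w)) ->
  forall z (g : plike (Thr q) z), P z g.
Proof.
move=> PS PL z g.
refine (match g as g0 in plike y0 z0
  return match y0 return (plike y0 z0 -> Prop) with
         | Vtx _ => fun _ => True
         | Thr b r => fun g0 => forall (P : forall z, plike (Thr r) z -> Prop),
             (forall (s : thread b) (rs : (r <= s)%O), P (Thr s) (PShort rs)) ->
             (forall z (w : qpath (tgt b) (entry_vtx z)),
                P z (@PLong (Thr r) z w)) -> P z0 g0
         end g0
  with PShort _ _ _ _ => _ | PLong _ _ _ => _ end P PS PL).
- by move=> P' PS' _; apply: PS'.
- by case: t q0 => // b r w P' _; apply.
Qed.

Lemma plike_mulA w x y z (f : plike w x) (g : plike x y) (h : plike y z) :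
  plike_mul f (plike_mul g h) = plike_mul (plike_mul f g) h.
Proof.
case: f g => [a p q pq|{}w {}x u] g.
- move: y g h; apply: plike_ThrP => [r qr|y v] h.
  + move: z h; apply: plike_ThrP => [s rs|z t] //=.
    by congr PShort; apply: bool_irrelevance.
  + by case: h v.
- case: g u h => [a p q pq|{}x {}y v] u h.
  + by move: z h; apply: plike_ThrP.
  + case: h v => [a p q pq|{}y {}z t] v //=.
    by rewrite !pcatA.
Qed.

Lemma plike_mul1m x y (f : plike x y) : plike_mul (plike_id x) f = f.
Proof.
case: f => [a p q pq|{}x {}y w] /=.
  by congr PShort; apply: bool_irrelevance.
by case: x w.
Qed.

Lemma plike_mulm1 x y (f : plike x y) : plike_mul f (plike_id y) = f.
Proof.
case: f => [a p q pq|{}x {}y w] /=.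
  by congr PShort; apply: bool_irrelevance.
by case: y w => //= v w; rewrite !pcatp0.
Qed.

(* TMin and TMax stay distinct here even when tbar_obj identifies them, i.e.
   when a is a loop. *)
Inductive tbar (a : arrow Q) := TMin | TPt of thread a | TMax.
Arguments TMin {a}.
Arguments TMax {a}.

Definition tbar_le (a : arrow Q) (x y : tbar a) : bool :=
  match x, y with
  | TMin, _ | _, TMax => true
  | TPt p, TPt q => (p <= q)%O
  | _, _ => false
  end.

Definition tbar_obj (a : arrow Q) (x : tbar a) : tobj :=
  match x with TMin => Vtx (src a) | TPt p => Thr p | TMax => Vtx (tgt a) end.

Definition eta (a : arrow Q) (x y : tbar a) :
    tbar_le x y -> plike (tbar_obj x) (tbar_obj y) :=
  match x, y return tbar_le x y -> plike (tbar_obj x) (tbar_obj y) with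
  | TMin, TMin => fun _ => plike_id (Vtx (src a))
  | TMin, TPt q => fun _ => @PLong (Vtx (src a)) (Thr q) (PNil (src a))
  | TMin, TMax =>
      fun _ => @PLong (Vtx (src a)) (Vtx (tgt a)) (PCons (PNil (tgt a)))
  | TPt p, TPt q => fun pq => PShort pq
  | TPt p, TMax => fun _ => @PLong (Thr p) (Vtx (tgt a)) (PNil (tgt a))
  | TMax, TMax => fun _ => plike_id (Vtx (tgt a))
  | TPt _, TMin | TMax, TMin | TMax, TPt _ =>
      fun F => False_rect _ (notF F)
  end.

Lemma eta_refl (a : arrow Q) (x : tbar a) (xx : tbar_le x x) :
  eta xx = plike_id (tbar_obj x).
Proof. by case: x xx => //= p pp; congr PShort; apply: bool_irrelevance. Qed.

Lemma eta_mul (a : arrow Q) (x y z : tbar a)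
    (xy : tbar_le x y) (yz : tbar_le y z) (xz : tbar_le x z) :
  plike_mul (eta xy) (eta yz) = eta xz.
Proof.
case: x y z xy yz xz => [|p|] [|q|] [|r|] //= *.
by congr PShort; apply: bool_irrelevance.
Qed.

End PathCategory.

Arguments Vtx {Q}.
Arguments Thr {Q} a.

Section FreeModule.
Variables (k : fieldType) (T : choiceType) (V : lmodType k).

Definition mlift (h : T -> V) (f : {malg k[T]}) : V :=
  \sum_(t <- msupp f) f@_t *: h t.

Lemma mliftEw (d : {fset T}) h f :
  (msupp f `<=` d)%fset -> mlift h f = \sum_(t <- d) f@_t *: h t.
Proof.
move=> fd; rewrite /mlift; apply: big_fset_incl => //= t _ tf.
by rewrite mcoeff_outdom // scale0r.
Qed.

Lemma mlift_lin h : linear (mlift h).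
Proof.
move=> a f g; have le1 : (msupp (a *: f) `<=` msupp f)%fset := msuppZ_le a f.
have le2 := fsubset_trans (msuppD_le (a *: f) g) (fsetSU _ le1).
rewrite (mliftEw _ le2) (mliftEw h (fsubsetUl (msupp f) (msupp g))).
rewrite (mliftEw h (fsubsetUr (msupp f) (msupp g))).
rewrite scaler_sumr -big_split /=; apply: eq_bigr => t _.
by rewrite mcoeffD mcoeffZ scalerDl scalerA.
Qed.

Lemma mliftU h t : mlift h << t >> = h t.
Proof.
rewrite (mliftEw h (msuppU_le (x := 1))) big_seq_fset1 mcoeffUU.
by rewrite scale1r.
Qed.

Lemma malg_lin_ext (F G : {malg k[T]} -> V) :
  linear F -> linear G -> (forall t, F << t >> = G << t >>) -> F =1 G.
Proof.
have E (H : {malg k[T]} -> V) (linH : linear H) f :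
    H f = mlift (fun t => H << t >>) f.
  have H0 : H 0 = 0.
    by have := linH (-1) 0 0; rewrite scaler0 addr0 scaleN1r addNr.
  have HD (g h : {malg k[T]}) : H (g + h) = H g + H h.
    by have := linH 1 g h; rewrite !scale1r.
  rewrite {1}(monalgE f) (big_morph H HD H0); apply: eq_bigr => t _.
  have -> : << f@_t *g t >> = f@_t *: << t >> :> {malg k[T]}.
    by apply/malgP => s; rewrite mcoeffZ !mcoeffU mulr_natr.
  by have := linH f@_t << t >> 0; rewrite H0 !addr0.
move=> linF linG FG f; rewrite (E _ linF) (E _ linG).
by apply: eq_bigr => t _; rewrite FG.
Qed.

End FreeModule.

Section PathCat.
Variables (k : fieldType) (Q : thread_quiver).

Definition path_hom (x y : tobj Q) : lmodType k :=
  {malg k[{classic plike x y}]}.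

Definition pl x y (f : plike x y) : path_hom x y :=
  << (f : {classic plike x y}) >>.

Definition path_comp x y z (g : path_hom y z) (f : path_hom x y) :
    path_hom x z :=
  mlift (fun b : {classic plike y z} =>
    mlift (fun a : {classic plike x y} => pl (plike_mul a b)) f) g.

Lemma path_comp_linl x y z (f : path_hom x y) :
  linear (fun g : path_hom y z => path_comp g f).
Proof. exact: mlift_lin. Qed.

Lemma path_comp_linr x y z (g : path_hom y z) :
  linear (fun f : path_hom x y => path_comp g f).
Proof.
move=> a f f'; rewrite /path_comp /mlift scaler_sumr -big_split /=.
apply: eq_bigr => t _; rewrite -/(mlift _ _) mlift_lin scalerDr !scalerA.
by rewrite mulrC.
Qed.

Lemma path_compU x y z (b : plike y z) (a : plike x y) :
  path_comp (pl b) (pl a) = pl (plike_mul a b).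
Proof. by rewrite /path_comp !mliftU. Qed.

Definition path_cat : lincat k.
Proof.
refine (@LinCat k (tobj Q) path_hom (fun x => pl (plike_id x)) path_comp
  _ _ _ path_comp_linl path_comp_linr).
- move=> w x y z h g f; move: h; apply: malg_lin_ext => [||c].
  + exact: path_comp_linl.
  + by move=> a h h'; rewrite !path_comp_linl.
  move: g; apply: malg_lin_ext => [||b].
  + by move=> a g g'; rewrite path_comp_linl path_comp_linr.
  + by move=> a g g'; rewrite path_comp_linr path_comp_linl.
  move: f; apply: malg_lin_ext => [||a].
  + by move=> a f f'; rewrite !path_comp_linr.
  + exact: path_comp_linr.
  by rewrite !path_compU plike_mulA.
- move=> x y; apply: malg_lin_ext => [||a].
  + exact: path_comp_linr.
  + by [].
  by rewrite path_compU plike_mulm1.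
- move=> x y; apply: malg_lin_ext => [||a].
  + exact: path_comp_linl.
  + by [].
  by rewrite path_compU plike_mul1m.
Defined.

End PathCat.

Definition thr_interval (Q : thread_quiver) (a : arrow Q)
    (J : set (thread a)) :=
  J !=set0 /\ forall x y z, J x -> J y -> (x < z)%O -> (z < y)%O -> J z.

Record valid_partition (Q : thread_quiver) := ValidPartition {
  cells : set (set (tobj Q));
  cells_partition : partition cells (fun X => X) [set: tobj Q];
  cells_vtx : forall v, cells [set Vtx v];
  cells_thr : forall a, exists F : set (set (thread a)),
    [/\ finite_set F, \bigcup_(J in F) J = [set: thread a] &
        forall J, F J -> thr_interval J /\ cells [set Thr a p | p in J]]
}.

Section Completion.
Variables (k : fieldType) (Q : thread_quiver).
Local Notation C := (path_cat k Q).
Variable P : valid_partition Q.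

Definition same_cell (x y : tobj Q) := exists X, [/\ cells P X, X x & X y].

Definition is_sample (s : set (tobj Q)) :=
  forall X, cells P X -> exists! x, X x /\ s x.

(* The morphisms eta_{yx} with x and y comparable inside one cell: at a vertex
   only the identity, because a singleton cell {v} does not see the arrows
   eta_{max,min} of the loops at v. *)
Inductive is_eta : forall x y : C, hom x y -> Prop :=
| EtaVtx v : @is_eta (Vtx v) (Vtx v) (@idm k C (Vtx v))
| EtaThr a (p q : thread a) (pq : (p <= q)%O) :
    same_cell (Thr a p) (Thr a q) ->
    @is_eta (Thr a p) (Thr a q) (pl k (PShort pq)).

Definition pequiv (x1 y1 : C) (f1 : hom x1 y1) (x2 y2 : C) (f2 : hom x2 y2) :=
  [/\ same_cell x1 x2, same_cell y1 y2 &
   exists (z w : C) (u1 : hom z x1) (u2 : hom z x2)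
     (v1 : hom y1 w) (v2 : hom y2 w),
     [/\ is_eta u1, is_eta u2, is_eta v1, is_eta v2 &
         comp v1 (comp f1 u1) = comp v2 (comp f2 u2)]].

Variable I : ideal C.

Definition completion : ideal C :=
  gen_ideal (fun x y => [set f | exists x' y' (g : hom x' y'),
    g \in I x' y' /\ pequiv f g]).

Lemma same_cell_refl x : same_cell x x.
Proof.
have [+ _ _] := cells_partition P => /seteqP[_ /(_ x Logic.I)] [X PX Xx].
by exists X.
Qed.

Lemma is_eta_id (x : C) : is_eta (idm x).
Proof.
by case: x => [v|a p]; [apply: EtaVtx | apply/EtaThr/same_cell_refl].
Qed.

Lemma sub_completion x y (f : hom x y) :
  f \in I x y -> f \in completion x y.
Proof.
move=> fI; apply: gen_ideal_sub; exists x, y, f; split=> //.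
split; try exact: same_cell_refl.
by exists x, y, (idm x), (idm x), (idm y), (idm y); split=> //; apply: is_eta_id.
Qed.

(* The functor r: x is sent to the element of the sample in the cell of x, and
   the class of f to the unique class of a morphism equivalent to f. *)
Definition is_reduction (s : set (tobj Q))
    (r : lfunctor (quot_cat completion) (full_subcat (C := quot_cat completion) s)) :=
  (forall x, same_cell x (so_val (r x))) /\
  forall x y (f : @hom k C x y)
    (h : @hom k (quot_cat completion) (so_val (r x)) (so_val (r y))),
    fmap r (fmap (quot_fun completion) f) = h <->
    exists f' : @hom k C (so_val (r x)) (so_val (r y)),
      fmap (quot_fun completion) f' = h /\ pequiv f f'.

Definition Ind (s : set (tobj Q))
    (r : lfunctor (quot_cat completion) (full_subcat (C := quot_cat completion) s))
    (N : rep (full_subcat (C := quot_cat completion) s)) : rep (quot_cat I) :=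
  fcomp (fcomp N r) (quot_quot sub_completion).

End Completion.

Section NoiseAndInduced.
Variables (k : fieldType) (Q : thread_quiver) (I : ideal (path_cat k Q)).
Implicit Type M : rep (quot_cat I).

Definition supp M : set (tobj Q) := [set x : tobj Q | {: M x}%VS != 0%VS].

Definition noise M := supp M `&` range Vtx = set0.

Definition noise_free M :=
  forall N, direct_summand N M -> noise N -> zero_rep N.

Definition induced_from_subthreading M :=
  exists (P : valid_partition Q) (s : set (tobj Q)),
    is_sample P s /\
    exists (r : lfunctor (quot_cat (completion P I))
                  (full_subcat (C := quot_cat (completion P I)) s))
      (N : rep (full_subcat (C := quot_cat (completion P I)) s)),
      [/\ is_reduction r, indecomposable N & rep_iso M (Ind r N)].

End NoiseAndInduced.

(* Main.v *)
(* Existence: take a maximal set of commuting idempotent endomorphisms of M; since M is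
   pointwise finite-dimensional its Boolean algebra is atomic at every object, and the
   atoms cut out the indecomposable summands.  Uniqueness: by Fitting's lemma End N0 is
   local with residue field k for indecomposable N0, and the multiplicity of N0 in M is
   the rank of the pairing Hom(N0, M) x Hom(M, N0) -> End N0 -> k.

   Let S be indecomposable and not noise.  On a thread, compare the image I of the value
   at the source with the kernel K of the map to the target.  If K is not contained in I,
   the elder rule produces an interval summand of S supported inside the thread, which is
   impossible.  So K is contained in I, and then the rank from the source and the rank to
   the target determine where the maps eta are isomorphisms; these ranks are monotone and
   bounded, so the thread splits into finitely many intervals on which S is constant, and
   S is induced from a choice of one point in each. *)

From HB Require Import structures.
From mathcomp Require Import all_boot all_order all_algebra.
From mathcomp Require Import boolp classical_sets cardinality fsbigop.
Require Import Defs.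

Set Implicit Arguments.
Unset Strict Implicit.
Unset Printing Implicit Defensive.

Import Order.TTheory GRing.Theory.
Local Open Scope classical_set_scope.
Local Open Scope ring_scope.

(** * Representations and idempotents *)


(** Neither the objects nor the summands of a representation are finite in number, so no argument
    can rest on a finite-dimensional space of endomorphisms or on a global length: Fitting indices
    and sums of projections are controlled at one object at a time. Global conclusions are then
    drawn from a single object at which the representation is nonzero. What allows this is that an
    endomorphism of an indecomposable which fails to be injective at one object is nilpotent at
    every object, with an exponent that may vary.

    On a thread the obstacle is that a linear order may have neither successors nor countable
    cofinality. An interval summand needs compatible vectors below a given point and compatible
    functionals above it, along arbitrary chains; both come from the descending chain condition for
    finite-dimensional subspaces. Once the maps inside the cells are isomorphisms, passing to the
    subthreading is a functor of the path category itself, given by a monotone retraction of each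
    thread onto finitely many points. *)

Section Families.
Variables (k : fieldType) (C : lincat k).
Implicit Types L M N : rep C.

(** Naturality is a predicate on bare families, so that sums, inverses and composites can be taken
    object by object without rebuilding a [rep_hom]. *)
Definition natural M N (f : forall x, 'Hom(M x, N x)) :=
  forall x y (h : hom x y) v, f y (rep_map M h v) = rep_map N h (f x v).

Definition natural_hom M N (f : forall x, 'Hom(M x, N x)) (nf : natural f) :
  rep_hom M N.
Proof.
refine (@RepHom _ _ M N f _) => x y h.
by apply/lfunP => v; rewrite !comp_lfunE nf.
Defined.

Lemma rep_hom_natural M N (f : rep_hom M N) : natural f.
Proof.
move=> x y h v; have /lfunP/(_ v) := rh_nat f h.
by rewrite !comp_lfunE.
Qed.

Lemma natural_comp L M N (g : forall x, 'Hom(M x, N x))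
    (f : forall x, 'Hom(L x, M x)) :
  natural g -> natural f -> natural (fun x => (g x \o f x)%VF).
Proof. by move=> ng nf x y h v; rewrite !comp_lfunE nf ng. Qed.

Lemma natural1 M : natural (fun x => \1%VF : 'Hom(M x, M x)).
Proof. by move=> x y h v; rewrite !id_lfunE. Qed.

Lemma natural0 M N : natural (fun x => 0 : 'Hom(M x, N x)).
Proof. by move=> x y h v; rewrite !zero_lfunE linear0. Qed.

Lemma naturalZ M N a (f : forall x, 'Hom(M x, N x)) :
  natural f -> natural (fun x => a *: f x).
Proof. by move=> nf x y h v; rewrite !scale_lfunE nf linearZ. Qed.

Lemma naturalD M N (f g : forall x, 'Hom(M x, N x)) :
  natural f -> natural g -> natural (fun x => f x + g x).
Proof. by move=> nf ng x y h v; rewrite !add_lfunE nf ng linearD. Qed.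

Lemma naturalN M N (f : forall x, 'Hom(M x, N x)) :
  natural f -> natural (fun x => - f x).
Proof. by move=> nf x y h v; rewrite !opp_lfunE nf linearN. Qed.

Lemma naturalB M N (f g : forall x, 'Hom(M x, N x)) :
  natural f -> natural g -> natural (fun x => f x - g x).
Proof. by move=> nf ng; apply: naturalD => //; apply: naturalN. Qed.

Lemma natural_sum M N (I : Type) (s : seq I)
    (f : I -> forall x, 'Hom(M x, N x)) :
  (forall i, natural (f i)) -> natural (fun x => \sum_(i <- s) f i x).
Proof.
move=> nf x y h v; rewrite !sum_lfunE linear_sum.
by apply: eq_bigr => i _; rewrite nf.
Qed.

Lemma rep_mapM M x y z (g : hom y z) (f : hom x y) v :
  rep_map M (comp g f) v = rep_map M g (rep_map M f v).
Proof. by rewrite /rep_map fmapM /= comp_lfunE. Qed.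

Lemma rep_map1 M x v : rep_map M (idm x) v = v.
Proof. by rewrite /rep_map fmap1 /= id_lfunE. Qed.

Lemma rep_map_lin M x y a (f g : hom x y) :
  rep_map M (a *: f + g) = a *: rep_map M f + rep_map M g.
Proof. by rewrite /rep_map fmap_lin. Qed.

Lemma zero_repP M : zero_rep M <-> forall x (v : M x), v = 0.
Proof.
split=> [M0 x v|M0 x].
  by apply/eqP; rewrite -memv0 -M0 memvf.
by apply/vspaceP => v; rewrite (M0 x v) !mem0v.
Qed.

Section Sub.
Variables (M : rep C) (U : forall x : C, {vspace (M x)}).
Hypothesis stable : forall x y (h : hom x y) v,
  v \in U x -> rep_map M h v \in U y.

(** By [stable], [vsproj] is applied only to vectors that already lie in [U y]; it merely retypes
    them. *)
Definition sub_map x y (h : hom x y) : 'Hom(subvs_of (U x), subvs_of (U y)) :=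
  (linfun (vsproj (U y)) \o (rep_map M h \o linfun vsval))%VF.

Lemma sub_mapE x y (h : hom x y) u : vsval (sub_map h u) = rep_map M h (vsval u).
Proof. by rewrite !comp_lfunE !lfunE vsprojK //; apply/stable/subvsP. Qed.

Definition sub_rep : rep C.
Proof.
refine (@LFunctor k C (vect_cat k) (fun x => subvs_of (U x) : vectType k) sub_map _ _ _).
- move=> x y a f g; apply/lfunP => u; apply: subvs_inj.
  rewrite add_lfunE scale_lfunE linearD linearZ /= !sub_mapE rep_map_lin.
  by rewrite add_lfunE scale_lfunE.
- move=> x; apply/lfunP => u; apply: subvs_inj.
  by rewrite sub_mapE rep_map1 id_lfunE.
- move=> x y z g f; apply/lfunP => u; apply: subvs_inj.
  by rewrite [vsval (_ u)]sub_mapE rep_mapM comp_lfunE !sub_mapE.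
Defined.

Definition sub_incl (x : C) : 'Hom(sub_rep x, M x) := linfun vsval.

Lemma sub_inclE x u : sub_incl x u = vsval u.
Proof. by rewrite lfunE. Qed.

Lemma sub_incl_nat : natural sub_incl.
Proof. by move=> x y h u; rewrite !sub_inclE -sub_mapE. Qed.

Variable e : forall x : C, 'End(M x).
Hypotheses (ne : natural e) (eU : forall x v, e x v \in U x).

Definition sub_proj (x : C) : 'Hom(M x, sub_rep x) :=
  (linfun (vsproj (U x)) \o e x)%VF.

Lemma sub_projE x v : vsval (sub_proj x v) = e x v.
Proof. by rewrite comp_lfunE lfunE vsprojK ?eU. Qed.

Lemma sub_proj_nat : natural sub_proj.
Proof.
move=> x y h v; apply: subvs_inj; rewrite sub_projE ne.
by rewrite [RHS]sub_mapE sub_projE.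
Qed.

End Sub.

Lemma limg_stable M (e : forall x : C, 'End(M x)) : natural e ->
  forall x y (h : hom x y) v, v \in limg (e x) -> rep_map M h v \in limg (e y).
Proof.
by move=> ne x y h _ /memv_imgP[v _ ->]; rewrite -ne memv_img ?memvf.
Qed.

Lemma lker_stable M (e : forall x : C, 'End(M x)) : natural e ->
  forall x y (h : hom x y) v, v \in lker (e x) -> rep_map M h v \in lker (e y).
Proof.
by move=> ne x y h v; rewrite !memv_ker ne => /eqP ->; rewrite linear0.
Qed.

Lemma mem_limg M (e : forall x : C, 'End(M x)) x v : e x v \in limg (e x).
Proof. by rewrite memv_img ?memvf. Qed.

Definition idempotent_family M (e : forall x : C, 'End(M x)) :=
  forall x v, e x (e x v) = e x v.

Lemma idem_split M (e : forall x : C, 'End(M x)) (ne : natural e) :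
  idempotent_family e ->
  rep_iso M (rep_sum (sub_rep (limg_stable ne)) (sub_rep (lker_stable ne))).
Proof.
move=> ee; have ce x v : v - e x v \in lker (e x).
  by rewrite memv_ker linearB /= ee subrr.
have pE := sub_projE (e := e) (limg_stable ne) (@mem_limg M e).
have nc : natural (fun x => \1 - e x)%VF.
  exact: (naturalB (@natural1 M) ne).
have cU x v : (\1 - e x)%VF v \in lker (e x).
  by rewrite add_lfunE opp_lfunE id_lfunE ce.
have qE := sub_projE (e := fun x => (\1 - e x)%VF) (lker_stable ne) cU.
pose A := sub_rep (limg_stable ne); pose B := sub_rep (lker_stable ne).
pose fl (x : C) : 'Hom(M x, rep_sum A B x) :=
  linfun (fun v => (sub_proj (limg_stable ne) e x v,
                    sub_proj (lker_stable ne) (fun x => \1 - e x)%VF x v)).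
pose gl (x : C) : 'Hom(rep_sum A B x, M x) :=
  linfun (fun u : (A x * B x)%type => vsval u.1 + vsval u.2).
have flE x v : fl x v = (sub_proj (limg_stable ne) e x v,
                    sub_proj (lker_stable ne) (fun x => \1 - e x)%VF x v).
  have lin : linear (fun v => (sub_proj (limg_stable ne) e x v,
                    sub_proj (lker_stable ne) (fun x => \1 - e x)%VF x v)).
    by move=> a u w; rewrite /= !linearP.
  exact: (lfunE (HB.pack (fun v : M x => _)
     (GRing.isLinear.Build _ _ _ _ _ lin) : {linear _ -> _})).
have glE x u : gl x u = vsval u.1 + vsval u.2.
  have lin : linear (fun u : (A x * B x)%type => vsval u.1 + vsval u.2).
    by move=> a u' w; rewrite /= scalerDr addrACA.
  exact: (lfunE (HB.pack (fun v : (A x * B x)%type => _)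
     (GRing.isLinear.Build _ _ _ _ _ lin) : {linear _ -> _})).
have nfl : natural fl.
  move=> x y h v; rewrite !flE [RHS]pair_lfunE /=.
  by rewrite !(sub_proj_nat _ ne (@mem_limg M e)) !(sub_proj_nat _ nc cU).
have ngl : natural gl.
  move=> x y h u; rewrite !glE linearD /= [rep_map _ _ u]pair_lfunE /=.
  by congr (_ + _); [exact: (sub_mapE (limg_stable ne))
                    |exact: (sub_mapE (lker_stable ne))].
exists (natural_hom nfl), (natural_hom ngl) => x /=; split.
  apply/lfunP => v; rewrite comp_lfunE flE glE /= pE qE id_lfunE.
  by rewrite add_lfunE opp_lfunE id_lfunE addrC subrK.
apply/lfunP => -[u w]; rewrite comp_lfunE flE glE id_lfunE /=.
have eu : e x (vsval u) = vsval u.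
  by have /memv_imgP[v _ ->] := subvsP u; rewrite ee.
have ew : e x (vsval w) = 0 by apply/eqP; rewrite -memv_ker; apply: subvsP.
congr (_, _); apply: subvs_inj.
  by rewrite pE linearD /= eu ew addr0.
by rewrite qE add_lfunE opp_lfunE id_lfunE linearD /= eu ew addr0 addrC addKr.
Qed.

Lemma indecomposable_idem M (e : forall x : C, 'End(M x)) :
  indecomposable M -> natural e -> idempotent_family e ->
  (forall x v, e x v = 0) \/ (forall x v, e x v = v).
Proof.
move=> [_ iM] ne ee; have [/zero_repP z|/zero_repP z] := iM _ _ (idem_split ne ee).
  left=> x v; have := z x (Subvs (mem_limg e v)).
  by move=> /(congr1 vsval).
right=> x v; have vK : v - e x v \in lker (e x).
  by rewrite memv_ker linearB /= ee subrr.
have /(congr1 vsval) /= /eqP := z x (Subvs vK).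
by rewrite subr_eq0 => /eqP.
Qed.

(** Conjugating the projection to [N] by the isomorphism gives an idempotent of [M]; if it is zero
    then [N] vanishes, if it is the identity then [N'] does. With [indecomposable_idem],
    indecomposability becomes a statement about idempotents only. *)
Lemma idem_indecomposable M :
  ~ zero_rep M ->
  (forall e : forall x : C, 'End(M x), natural e -> idempotent_family e ->
    (forall x v, e x v = 0) \/ (forall x v, e x v = v)) ->
  indecomposable M.
Proof.
move=> M0 idM; split=> // N N' [f [g fg]].
have fgK x (u : rep_sum N N' x) : f x (g x u) = u.
  by have [_ /lfunP/(_ u)] := fg x; rewrite comp_lfunE id_lfunE.
have linp (x : C) : linear (fun u : (N x * N' x)%type => (u.1, 0) : (N x * N' x)%type).
  by move=> a u w; rewrite /= -[RHS]/(_, _) /= scaler0 addr0.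
pose p (x : C) : 'End(rep_sum N N' x) :=
  linfun (fun u : (N x * N' x)%type => (u.1, 0) : (N x * N' x)%type).
have pE x u : p x u = (u.1, 0).
  exact: (lfunE (HB.pack (fun v : (N x * N' x)%type => _)
     (GRing.isLinear.Build _ _ _ _ _ (linp x)) : {linear _ -> _})).
have np : natural p.
  by move=> x y h u; rewrite !pE !pair_lfunE /= linear0.
pose e x := (g x \o (p x \o f x))%VF.
have ne : natural e.
  apply: natural_comp; first exact: rep_hom_natural.
  by apply: natural_comp => //; apply: rep_hom_natural.
have ee : idempotent_family e.
  by move=> x v; rewrite !comp_lfunE fgK !pE.
have gp x (u : rep_sum N N' x) : f x (e x (g x u)) = (u.1, 0).
  by rewrite !comp_lfunE !fgK pE.
have [e0|e1] := idM e ne ee; [left|right]; apply/zero_repP => x v.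
  by have := gp x (v, 0); rewrite e0 linear0 => -[].
by have := gp x (0, v); rewrite e1 fgK => -[].
Qed.

End Families.

(** * Endomorphisms of indecomposables *)


Section FittingSpace.
Variables (k : fieldType) (V : vectType k) (f : 'End(V)).

Definition lfun_pow n : 'End(V) := iter n (fun g => (f \o g)%VF) \1%VF.

Lemma lfun_powE n v : lfun_pow n v = iter n f v.
Proof. by elim: n => [|n IH]; rewrite ?id_lfunE //= comp_lfunE IH. Qed.

Lemma lfun_powD m n v : lfun_pow (m + n) v = lfun_pow m (lfun_pow n v).
Proof. by rewrite !lfun_powE iterD. Qed.

Lemma fitting_index_ex : exists n,
  `[< forall m, (\dim (limg (lfun_pow n)) <= \dim (limg (lfun_pow m)))%N >].
Proof.
have ex : exists d, `[< exists n, \dim (limg (lfun_pow n)) = d >].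
  by exists (\dim (limg (lfun_pow 0))); apply/asboolP; exists 0%N.
case: (ex_minnP ex) => d /asboolP[n <-] dmin; exists n; apply/asboolP => m.
by apply: dmin; apply/asboolP; exists m.
Qed.

(** From this index on the images and kernels of the powers are stationary, by minimality of the
    image dimension. *)
Definition fitting_index := ex_minn fitting_index_ex.
Local Notation n := fitting_index.

Lemma fitting_index_min m :
  (\dim (limg (lfun_pow n)) <= \dim (limg (lfun_pow m)))%N.
Proof. by rewrite /fitting_index; case: ex_minnP => i /asboolP. Qed.

Lemma fitting_limg m : (n <= m)%N -> limg (lfun_pow m) = limg (lfun_pow n).
Proof.
move=> nm; apply/eqP; rewrite eqEdim fitting_index_min andbT.
apply/subvP => _ /memv_imgP[v _ ->].
by rewrite -(subnKC nm) lfun_powD memv_img ?memvf.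
Qed.

Lemma fitting_lker m : (n <= m)%N -> lker (lfun_pow m) = lker (lfun_pow n).
Proof.
move=> nm; apply/esym/eqP; rewrite eqEdim; apply/andP; split.
  apply/subvP => v; rewrite !memv_ker -(subnK nm) lfun_powD => /eqP ->.
  by rewrite linear0.
have := limg_ker_dim (lfun_pow m) fullv.
rewrite -(limg_ker_dim (lfun_pow n) fullv) !capfv (fitting_limg nm).
by move/addIn ->.
Qed.

Lemma fitting_cap : (limg (lfun_pow n) :&: lker (lfun_pow n) = 0)%VS.
Proof.
apply/eqP; rewrite -subv0; apply/subvP => v.
rewrite memv_cap => /andP[/memv_imgP[u _ ->]].
rewrite memv_ker -lfun_powD -memv_ker fitting_lker ?leq_addr //.
by rewrite memv_ker memv0.
Qed.

Lemma fitting_add : (limg (lfun_pow n) + lker (lfun_pow n) = fullv)%VS.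
Proof.
apply/eqP; rewrite eqEdim subvf /=.
have := dimv_sum_cap (limg (lfun_pow n)) (lker (lfun_pow n)).
rewrite fitting_cap dimv0 addn0 => ->.
by rewrite -(limg_ker_dim (lfun_pow n) fullv) capfv addnC.
Qed.

End FittingSpace.

Lemma iter_natural (k : fieldType) (C : lincat k) (M : rep C)
    (f : forall x : C, 'End(M x)) (nf : natural f) x y (h : hom x y) n v :
  rep_map M h (lfun_pow (f x) n v) = lfun_pow (f y) n (rep_map M h v).
Proof.
by rewrite !lfun_powE; elim: n => //= n <-; rewrite nf.
Qed.

(** The projection [e] onto the stable image along the stable kernel is an idempotent of [M], hence
    0 or 1. The exponent in the nilpotent case depends on [x]: infinitely many objects need not
    share one. *)
Lemma fitting (k : fieldType) (C : lincat k) (M : rep C)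
    (f : forall x : C, 'End(M x)) : indecomposable M -> natural f ->
  (forall x, lker (f x) = 0%VS) \/ (forall x, exists n, forall v, iter n (f x) v = 0).
Proof.
move=> iM nf; pose P x := lfun_pow (f x) (fitting_index (f x)).
pose e x := daddv_pi (limg (P x)) (lker (P x)).
have capP x : (limg (P x) :&: lker (P x) = 0)%VS := fitting_cap (f x).
have capP' x : (lker (P x) :&: limg (P x) = 0)%VS by rewrite capvC.
have eI x v : v \in limg (P x) -> e x v = v by apply: daddv_pi_id.
have eK x v : v \in lker (P x) -> e x v = 0.
  move=> vK; have := daddv_pi_add (capP x) (w := v).
  rewrite fitting_add memvf => /(_ isT).
  by rewrite [X in _ + X]daddv_pi_id // -[RHS]add0r => /addIr.
have split x v : exists a b, [/\ v = a + b, a \in limg (P x) & b \in lker (P x)].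
  have : v \in (limg (P x) + lker (P x))%VS by rewrite fitting_add memvf.
  by move=> /memv_addP[a aI [b bK ->]]; exists a, b.
(* The Fitting indices at [x] and [y] may differ; raising both to their maximum gives a single
   power, which commutes with [rep_map M h]. *)
have stI x y (h : hom x y) v : v \in limg (P x) -> rep_map M h v \in limg (P y).
  rewrite /P -(fitting_limg (leq_maxl _ (fitting_index (f y)))).
  rewrite -(fitting_limg (leq_maxr (fitting_index (f x)) _)).
  by move=> /memv_imgP[u _ ->]; rewrite iter_natural // memv_img ?memvf.
have stK x y (h : hom x y) v : v \in lker (P x) -> rep_map M h v \in lker (P y).
  rewrite /P -(fitting_lker (leq_maxl _ (fitting_index (f y)))).
  rewrite -(fitting_lker (leq_maxr (fitting_index (f x)) _)).
  by rewrite !memv_ker -iter_natural // => /eqP ->; rewrite linear0.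
have ne : natural e.
  move=> x y h v; have [a [b [-> aI bK]]] := split x v.
  rewrite !linearD /= (eI _ _ aI) (eK _ _ bK) linear0 addr0.
  by rewrite (eI _ _ (stI _ _ h _ aI)) (eK _ _ (stK _ _ h _ bK)) addr0.
have ee : idempotent_family e by move=> x v; rewrite eI // memv_pi.
have [e0|e1] := indecomposable_idem iM ne ee; [right=> x|left=> x].
  exists (fitting_index (f x)) => v; rewrite -lfun_powE.
  by rewrite -(eI x (lfun_pow _ _ v)) ?e0 // memv_img ?memvf.
apply/eqP; rewrite -subv0; apply/subvP => v; rewrite memv_ker memv0 => fv0.
rewrite -(e1 x v) eK // /P -(fitting_lker (leqnSn _)) memv_ker.
by rewrite -addn1 lfun_powD [lfun_pow _ 1 v]lfun_powE /= (eqP fv0) linear0.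
Qed.

Section LocalEnd.
Variables (k : fieldType) (C : lincat k) (N : rep C).
Hypothesis iN : indecomposable N.
Implicit Types f g : forall x : C, 'End(N x).

(** For natural [f] these are the non-units of the endomorphism ring, since an injective
    endomorphism of a finite-dimensional space is invertible. They turn out to form its radical. *)
Definition noninj f := exists x, lker (f x) <> 0%VS.

Lemma noninj_nilp f : natural f -> noninj f ->
  forall x, exists n, forall v, iter n (f x) v = 0.
Proof.
by move=> nf [x fx]; have [fi|//] := fitting iN nf; case: (fx (fi x)).
Qed.

Lemma not_noninj f : ~ noninj f -> forall x, lker (f x) == 0%VS.
Proof. by move=> nI x; apply/eqP; apply: contrapT => fx; apply: nI; exists x. Qed.

Lemma noninj_compl f g : noninj g -> noninj (fun x => f x \o g x)%VF.
Proof.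
move=> [x gx]; exists x; apply: contra_not gx => fg0.
apply/eqP; rewrite -subv0; apply/subvP => v.
rewrite memv_ker => gv; rewrite -fg0 memv_ker comp_lfunE (eqP gv).
by rewrite linear0.
Qed.

Lemma noninj_compr f g : noninj f -> noninj (fun x => f x \o g x)%VF.
Proof.
have [ng _|/not_noninj gi] := pselect (noninj g); first exact: noninj_compl.
move=> [x fx]; exists x; apply: contra_not fx => fg0.
apply/eqP; rewrite -subv0; apply/subvP => v; rewrite memv_ker => fv.
rewrite -(lker0_lfunVK (gi x) v) memv0.
have : (g x)^-1%VF v \in lker (f x \o g x)%VF.
  by rewrite memv_ker comp_lfunE (lker0_lfunVK (gi x)).
by rewrite fg0 memv0 => /eqP ->; rewrite linear0.
Qed.

Lemma natural_inv f : natural f -> (forall x, lker (f x) == 0%VS) ->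
  natural (fun x => (f x)^-1)%VF.
Proof.
move=> nf fi x y h v; rewrite -{1}(lker0_lfunVK (fi x) v) -nf.
by rewrite (lker0_lfunK (fi y)).
Qed.

Lemma nonzero_point : exists x, exists v : N x, v <> 0.
Proof.
apply: contrapT => nx; apply: iN.1; apply/zero_repP => x v.
by apply: contrapT => v0; apply: nx; exists x, v.
Qed.

Lemma noninj_nonzero f x (v : N x) : natural f -> noninj f -> v <> 0 ->
  f x v <> v.
Proof.
move=> nf nI v0 fv; have [n fn] := noninj_nilp nf nI x; apply: v0.
rewrite -(fn v); elim: n {fn} => //= n <-; exact/esym.
Qed.

(** A non-unit is nilpotent at every object, so it is not injective wherever [N] is nonzero: the
    witness in [noninj] can be prescribed. *)
Lemma noninj_at f x (v : N x) : natural f -> noninj f -> v <> 0 ->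
  lker (f x) <> 0%VS.
Proof.
move=> nf nI v0 /eqP/lker0P fi; have [n fn] := noninj_nilp nf nI x; apply: v0.
have := fn v; elim: n {fn} => //= n IH fv; apply: IH.
by apply: fi; rewrite fv linear0.
Qed.

(** Locality of the endomorphism ring. If [u = f + g] were invertible, a kernel vector [v] of
    [u^-1 g] would satisfy [u^-1 f v = v], against the nilpotency of [u^-1 f]. *)
Lemma noninj_add f g : natural f -> natural g -> noninj f -> noninj g ->
  noninj (fun x => f x + g x).
Proof.
move=> nf ng If Ig; apply: contrapT => /not_noninj ui.
have nu := naturalD nf ng; have nv := natural_inv nu ui.
have Iv := @noninj_compl (fun x => (f x + g x)^-1%VF) f If.
have Iw := @noninj_compl (fun x => (f x + g x)^-1%VF) g Ig.
have [x gx] := Iw; apply: gx; apply/eqP; rewrite -subv0.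
apply/subvP => v; rewrite memv_ker comp_lfunE memv0 => /eqP gv0.
apply/eqP; apply: contrapT => v0.
apply: (noninj_nonzero (natural_comp nv nf) Iv v0); rewrite comp_lfunE.
by rewrite -[RHS](lker0_lfunK (ui x)) add_lfunE linearD /= gv0 addr0.
Qed.

Lemma noninj0 : noninj (fun x => 0).
Proof.
have [x [v v0]] := nonzero_point; exists x => /vspaceP/(_ v).
by rewrite memv_ker zero_lfunE eqxx memv0 => /esym/eqP.
Qed.

Lemma noninj_sum (I : Type) (s : seq I) (f : I -> forall x, 'End(N x)) :
  (forall i, natural (f i)) -> (forall i, noninj (f i)) ->
  noninj (fun x => \sum_(i <- s) f i x).
Proof.
move=> nf If; elim: s => [|i s IH].
  by have [x gx] := noninj0; exists x; rewrite big_nil.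
have [x gx] := noninj_add (nf i) (natural_sum s nf) (If i) IH.
by exists x; rewrite big_cons.
Qed.

Lemma noninjZ a f : noninj f -> noninj (fun x => a *: f x).
Proof.
move=> [x fx]; exists x; apply: contra_not fx => fg0.
apply/eqP; rewrite -subv0; apply/subvP => v.
rewrite memv_ker => gv; rewrite -fg0 memv_ker scale_lfunE (eqP gv).
by rewrite scaler0.
Qed.

Lemma eq_noninj f g : (forall x v, f x v = g x v) -> noninj f -> noninj g.
Proof.
move=> fg [x fx]; exists x; apply: contra_not fx => <-.
by congr lker; apply/lfunP => v; rewrite fg.
Qed.

End LocalEnd.

Import VectorInternalTheory.

(** This is where algebraic closedness enters: it makes the residue field of the endomorphism ring
    equal to [k]. *)
Lemma eigenvector_exists (k : closedFieldType) (V : vectType k) (f : 'End(V)) :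
  (exists v : V, v <> 0) -> exists a (v : V), v <> 0 /\ f v = a *: v.
Proof.
move=> [w w0]; pose A := lin1_mx (v2r \o f \o r2v); have dV : (0 < dim V)%N.
  rewrite lt0n; apply/eqP => d0; apply: w0; apply/eqP.
  by rewrite -memv0; have /eqP <- : {:V}%VS == 0%VS; rewrite ?memvf // -dimv_eq0 dimvf d0.
have /closed_rootP[a ra] : size (char_poly A) != 1%N.
  by rewrite size_char_poly eqSS -lt0n.
have := ra; rewrite -eigenvalue_root_char => /eigenvalueP[u uA u0].
exists a, (r2v u); split.
  by move=> /(congr1 v2r); rewrite r2vK linear0 => /eqP; rewrite (negPf u0).
by apply: v2r_inj; rewrite linearZ /= r2vK -uA mul_rV_lin1.
Qed.

(** * The residue map from the endomorphism ring to the base field *)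

Section Residue.
Variables (k : closedFieldType) (C : lincat k) (N : rep C).
Hypothesis iN : indecomposable N.
Implicit Types f g : forall x : C, 'End(N x).

(** [a] is the class of [f] modulo the radical. As a relation it satisfies the ring laws without any
    choice; values are picked only for the matrices of [multiplicity_le]. *)
Definition residue_rel f (a : k) := noninj (fun x => f x - a *: \1%VF).

(** An eigenvalue at any object where [N] is nonzero will do: [f - a] is not injective there, hence
    a non-unit. *)
Lemma residue_ex f : natural f -> exists a, residue_rel f a.
Proof.
move=> nf; have [x [w w0]] := nonzero_point iN.
have [a [v [v0 fv]]] := eigenvector_exists (f x) (ex_intro _ w w0).
exists a, x => /vspaceP/(_ v); rewrite memv_ker add_lfunE opp_lfunE scale_lfunE.
by rewrite id_lfunE fv subrr eqxx memv0 => /esym/eqP.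
Qed.

Lemma natural_sub1 f a : natural f -> natural (fun x => f x - a *: \1%VF).
Proof. by move=> nf; apply: naturalB nf _; apply/naturalZ/natural1. Qed.

Lemma residue_uniq f a b : natural f ->
  residue_rel f a -> residue_rel f b -> a = b.
Proof.
move=> nf fa fb; apply: contrapT => /eqP; rewrite -subr_eq0 => ab.
have := noninj_add iN (natural_sub1 a nf) (naturalZ (-1) (natural_sub1 b nf))
  fa (noninjZ (-1) fb).
case=> x; apply; apply/eqP; rewrite -subv0; apply/subvP => v.
rewrite memv_ker memv0 !(add_lfunE, opp_lfunE, scale_lfunE) id_lfunE.
rewrite scaleN1r opprB addrC subrKA -scaleNr -scalerDl scaler_eq0.
by rewrite -oppr_eq0 opprB (negPf ab).
Qed.

Lemma residueD f g a b : natural f -> natural g ->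
  residue_rel f a -> residue_rel g b ->
  residue_rel (fun x => f x + g x) (a + b).
Proof.
move=> nf ng fa gb.
have := noninj_add iN (natural_sub1 a nf) (natural_sub1 b ng) fa gb.
apply: eq_noninj => x v; rewrite !(add_lfunE, opp_lfunE, scale_lfunE) id_lfunE.
by rewrite scalerDl opprD addrACA.
Qed.

Lemma residueM f g a b : natural f -> natural g ->
  residue_rel f a -> residue_rel g b ->
  residue_rel (fun x => f x \o g x)%VF (a * b).
Proof.
move=> nf ng fa gb.
have n1 := natural_comp (natural_sub1 a nf) ng.
have n2 := naturalZ a (natural_sub1 b ng).
have := noninj_add iN n1 n2 (noninj_compr g fa) (noninjZ a gb).
apply: eq_noninj => x v; rewrite !(add_lfunE, opp_lfunE, scale_lfunE, comp_lfunE, id_lfunE).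
by rewrite scalerBr scalerA addrA subrK.
Qed.

Lemma residue1 : residue_rel (fun x => \1%VF) 1.
Proof.
apply: eq_noninj (noninj0 iN) => x v.
by rewrite add_lfunE opp_lfunE scale1r subrr zero_lfunE.
Qed.

Lemma residue0 f : noninj f -> residue_rel f 0.
Proof.
apply: eq_noninj => x v.
by rewrite add_lfunE opp_lfunE scale0r zero_lfunE subr0.
Qed.

Lemma residue_sum (I : Type) (s : seq I) (f : I -> forall x, 'End(N x)) a :
  (forall i, natural (f i)) -> (forall i, residue_rel (f i) (a i)) ->
  residue_rel (fun x => \sum_(i <- s) f i x) (\sum_(i <- s) a i).
Proof.
move=> nf fa; elim: s => [|i s IH].
  rewrite big_nil; apply: eq_noninj (residue0 (noninj0 iN)) => x v.
  by rewrite big_nil.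
rewrite big_cons; apply: eq_noninj (residueD (nf i) (natural_sum s nf) (fa i) IH).
by move=> x v; rewrite big_cons.
Qed.

End Residue.

(** * Uniqueness of decompositions *)


Lemma fsbig_uniq_seq (V : zmodType) (J : choiceType) (F : J -> V) (s : seq J) :
  uniq s -> (forall j, F j != 0 -> j \in s) ->
  \sum_(j \in [set: J]) F j = \sum_(j <- s) F j.
Proof.
move=> us Fs; rewrite fsbig_supp; apply: fsbig_fwiden => //.
  by move=> j [_ /eqP Fj]; apply: Fs.
by move=> j [_ nj] /=; apply: contrapT => Fj; apply: nj.
Qed.

Lemma finite_set_bounded (J : choiceType) (A : set J) n :
  (forall s : seq J, uniq s -> (forall j, j \in s -> A j) -> (size s <= n)%N) ->
  finite_set A.
Proof.
move=> bd; apply: contrapT => /(infinite_set_fset n.+1)[B BA].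
by rewrite leqNgt ltnS bd.
Qed.

Section DirectSum.
Variables (k : fieldType) (C : lincat k) (M : rep C) (J : choiceType).
Variables (N : J -> rep C) (i : forall j, rep_hom (N j) M).
Hypothesis ds : is_direct_sum i.

Definition ds_coord x (v : M x) : forall j, N j x := sval (cid (ds v)).

Lemma ds_coordP x (v : M x) :
  finite_set [set j | ds_coord v j != 0] /\
  v = \sum_(j \in [set: J]) i j x (ds_coord v j).
Proof. by rewrite /ds_coord; case: cid => w []. Qed.

Lemma ds_coord_uniq x (v : M x) (w : forall j, N j x) :
  finite_set [set j | w j != 0] -> v = \sum_(j \in [set: J]) i j x (w j) ->
  ds_coord v = w.
Proof.
move=> fw vw; rewrite /ds_coord; case: cid => w' [? /=]; apply.
by split.
Qed.

Lemma ds_coord_uniq_seq x (v : M x) (w : forall j, N j x) (s : seq J) :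
  uniq s -> (forall j, w j != 0 -> j \in s) -> v = \sum_(j <- s) i j x (w j) ->
  ds_coord v = w.
Proof.
move=> us ws vw; apply: ds_coord_uniq.
  by apply: sub_finite_set (finite_seq s) => j /ws.
rewrite vw (fsbig_uniq_seq us) // => j ij; apply: ws.
by apply: contra_neq ij => ->; rewrite linear0.
Qed.

Lemma ds_coord_seq x (v : M x) (s : seq J) :
  uniq s -> (forall j, ds_coord v j != 0 -> j \in s) ->
  v = \sum_(j <- s) i j x (ds_coord v j).
Proof.
move=> us ws; rewrite {1}(ds_coordP v).2 (fsbig_uniq_seq us) // => j ij.
by apply: ws; apply: contra_neq ij => ->; rewrite linear0.
Qed.

Lemma ds_support x (v : M x) : exists s : seq J, uniq s /\
  forall j, ds_coord v j != 0 -> j \in s.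
Proof.
have /finite_seqP[s sE] := (ds_coordP v).1.
exists (undup s); split=> [|j vj]; first exact: undup_uniq.
by rewrite mem_undup; have : [set` s] j by rewrite -sE.
Qed.

Lemma ds_coord_lin x j : linear (fun v : M x => ds_coord v j).
Proof.
move=> a u v; have [s [us su]] := ds_support u; have [t [ut tv]] := ds_support v.
pose r := undup (s ++ t).
suff -> : ds_coord (a *: u + v) = (fun j => a *: ds_coord u j + ds_coord v j) by [].
apply: (@ds_coord_uniq_seq _ _ _ r); first exact: undup_uniq.
  move=> l; apply: contraR; rewrite mem_undup mem_cat negb_or => /andP[ls lt].
  have /eqP -> : ds_coord u l == 0 by apply: contraR ls => /su.
  have /eqP -> : ds_coord v l == 0 by apply: contraR lt => /tv.
  by rewrite scaler0 addr0.
rewrite {1}(@ds_coord_seq _ u r) ?undup_uniq //; last first.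
  by move=> l /su; rewrite mem_undup mem_cat => ->.
rewrite {1}(@ds_coord_seq _ v r) ?undup_uniq //; last first.
  by move=> l /tv; rewrite mem_undup mem_cat => ->; rewrite orbT.
rewrite scaler_sumr -big_split /=; apply: eq_bigr => l _.
by rewrite linearD linearZ.
Qed.

Definition ds_proj j (x : C) : 'Hom(M x, N j x) := linfun (fun v => ds_coord v j).

Lemma ds_projE j x v : ds_proj j x v = ds_coord v j.
Proof.
exact: (lfunE (HB.pack (fun v : M x => ds_coord v j)
  (GRing.isLinear.Build _ _ _ _ _ (@ds_coord_lin x j)) : {linear _ -> _})).
Qed.

Lemma ds_coord_incl j x (u : N j x) :
  ds_coord (i j x u) = dfwith (fun l => 0 : N l x) u.
Proof.
apply: (@ds_coord_uniq_seq _ _ _ [:: j]) => //.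
  by move=> l; rewrite inE; case: dfwithP => [|l' _]; rewrite eqxx.
by rewrite big_seq1 dfwith_in.
Qed.

Lemma ds_proj_incl j x u : ds_proj j x (i j x u) = u.
Proof. by rewrite ds_projE ds_coord_incl dfwith_in. Qed.

Lemma ds_proj_incl0 j l x u : j <> l -> ds_proj l x (i j x u) = 0.
Proof. by move=> /eqP jl; rewrite ds_projE ds_coord_incl dfwith_out. Qed.

Lemma ds_proj_nat j : natural (ds_proj j).
Proof.
move=> x y h v; rewrite !ds_projE.
have [s [us su]] := ds_support v.
suff -> : ds_coord (rep_map M h v) = (fun j => rep_map (N j) h (ds_coord v j)) by [].
apply: (@ds_coord_uniq_seq _ _ _ s us).
  by move=> l vl; apply: su; apply: contra_neq vl => ->; rewrite linear0.
rewrite {1}(ds_coord_seq us su) linear_sum; apply: eq_bigr => l _.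
by rewrite rep_hom_natural.
Qed.

(** One nonzero vector from each summand gives a free family, as the projections separate them. All
    later finiteness of sets of summands comes from this bound at a fixed object. *)
Lemma ds_size x (s : seq J) : uniq s ->
  (forall j, j \in s -> exists u : N j x, u <> 0) -> (size s <= \dim {:M x})%N.
Proof.
move=> us su; pose u j := vpick {:N j x}.
have u0 j : j \in s -> u j != 0.
  move=> /su[v v0]; rewrite vpick0; apply/eqP => N0; apply: v0.
  by apply/eqP; rewrite -memv0 -N0 memvf.
pose X := [tuple of [seq i j x (u j) | j <- in_tuple s]].
have /eqP dX : free X.
  have nX (a : 'I_(size s)) : X`_a = i _ x (u (tnth (in_tuple s) a)).
    by rewrite -tnth_nth tnth_map.
  have /tuple_uniqP tinj : uniq (in_tuple s) by [].
  apply/freeP => c cX b; have bs : tnth (in_tuple s) b \in s := mem_tnth b (in_tuple s).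
  have := congr1 (ds_proj (tnth (in_tuple s) b) x) cX.
  rewrite linear_sum linear0 (bigD1 b) //= big1 => [|a ab].
    rewrite addr0 linearZ /= nX ds_proj_incl => /eqP.
    by rewrite scaler_eq0 (negPf (u0 _ bs)) orbF => /eqP.
  rewrite linearZ /= nX ds_proj_incl0 ?scaler0 // => /tinj /eqP.
  by rewrite (negPf ab).
by rewrite -[size s](size_tuple X) -dX; apply/dimvS/subvf.
Qed.

Lemma ds_finite x : finite_set [set j | exists u : N j x, u <> 0].
Proof.
apply: (@finite_set_bounded _ _ (\dim {:M x})) => s us sN.
by apply: (@ds_size x).
Qed.

Lemma ds_nonzero_seq x : exists s : seq J, uniq s /\
  forall j, j \in s <-> exists u : N j x, u <> 0.
Proof.
have /finite_seqP[s sE] := ds_finite x.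
exists (undup s); split=> [|j]; first exact: undup_uniq.
rewrite mem_undup; have -> : (j \in s : Prop) = [set` s] j by [].
by rewrite -sE.
Qed.

Lemma ds_sum x (s : seq J) (v : M x) : uniq s ->
  (forall j, (exists u : N j x, u <> 0) -> j \in s) ->
  v = \sum_(j <- s) i j x (ds_proj j x v).
Proof.
move=> us sP; rewrite {1}(@ds_coord_seq _ v s) //.
  by apply: eq_bigr => j _; rewrite ds_projE.
by move=> j /eqP vj; apply: sP; exists (ds_coord v j).
Qed.

End DirectSum.

Lemma rep_isoP (k : fieldType) (C : lincat k) (M N : rep C) :
  rep_iso M N <-> exists (f : forall x, 'Hom(M x, N x)) (g : forall x, 'Hom(N x, M x)),
   [/\ natural f, natural g, forall x v, g x (f x v) = v & forall x v, f x (g x v) = v].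
Proof.
split=> [[f [g fg]]|[f [g [nf ng gf fg]]]].
  exists f, g; split=> [||x v|x v]; try exact: rep_hom_natural.
    by have [/lfunP/(_ v) + _] := fg x; rewrite comp_lfunE id_lfunE.
  by have [_ /lfunP/(_ v)] := fg x; rewrite comp_lfunE id_lfunE.
exists (natural_hom nf), (natural_hom ng) => x; split; apply/lfunP => v;
  by rewrite comp_lfunE id_lfunE /= ?gf ?fg.
Qed.

Lemma rep_iso_sym (k : fieldType) (C : lincat k) (M N : rep C) :
  rep_iso M N -> rep_iso N M.
Proof. by move=> [f [g fg]]; exists g, f => x; have [] := fg x. Qed.

Lemma rep_iso_refl (k : fieldType) (C : lincat k) (M : rep C) : rep_iso M M.
Proof.
apply/rep_isoP; exists (fun x => \1%VF), (fun x => \1%VF).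
by split; try exact: natural1; move=> x v; rewrite !id_lfunE.
Qed.

Lemma rep_iso_trans (k : fieldType) (C : lincat k) (L M N : rep C) :
  rep_iso L M -> rep_iso M N -> rep_iso L N.
Proof.
move=> /rep_isoP[f [f' [nf nf' ff' f'f]]] /rep_isoP[g [g' [ng ng' gg' g'g]]].
apply/rep_isoP; exists (fun x => g x \o f x)%VF, (fun x => f' x \o g' x)%VF.
split; try exact: natural_comp.
  by move=> x v; rewrite !comp_lfunE gg' ff'.
by move=> x v; rewrite !comp_lfunE f'f g'g.
Qed.

(* An endomorphism of N0 factoring through N and outside the radical of the
   local ring End N0 exhibits N0 as a summand of N. *)
Lemma factor_noninj (k : fieldType) (C : lincat k) (N0 N : rep C)
    (p : forall x, 'Hom(N x, N0 x)) (q : forall x, 'Hom(N0 x, N x)) :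
  indecomposable N0 -> indecomposable N -> natural p -> natural q ->
  ~ rep_iso N0 N -> noninj (fun x => p x \o q x)%VF.
Proof.
move=> i0 iN np nq; apply: contra_notP => /not_noninj ui.
have nu := natural_comp np nq; have nv := natural_inv nu ui.
(* For [u = p q] invertible, [q u^-1 p] is an idempotent of [N]. It is nonzero because [N0] is, so
   it is the identity, and [u^-1 p] is inverse to [q]. *)
pose e x := (q x \o ((p x \o q x)^-1 \o p x))%VF.
have uK x v : (p x \o q x)^-1%VF (p x (q x v)) = v.
  by rewrite -[RHS](lker0_lfunK (ui x)) comp_lfunE.
have ne : natural e by apply: natural_comp => //; apply: natural_comp.
have ee : idempotent_family e by move=> x v; rewrite !comp_lfunE uK.
have [e0|e1] := indecomposable_idem iN ne ee.
  have [x [v v0]] := nonzero_point i0; exfalso; apply: v0.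
  by rewrite -(uK x v) -(uK x ((p x \o q x)^-1%VF _)); have := e0 x (q x v);
     rewrite !comp_lfunE => ->; rewrite !linear0.
apply/rep_isoP; exists q, (fun x => (p x \o q x)^-1 \o p x)%VF; split=> //.
- exact: natural_comp.
- by move=> x v; rewrite comp_lfunE uK.
- by move=> x v; have := e1 x v; rewrite comp_lfunE.
Qed.

(** * Multiplicity of an indecomposable as the rank of a pairing *)

Section Multiplicity.
Variables (k : closedFieldType) (C : lincat k) (M N0 : rep C).
Hypothesis i0 : indecomposable N0.

(** Including copy [b] of [N0] and projecting to copy [a] gives 1 or 0. Expand the identity of [M]
    between them along [N']: terms outside [s'] lie in the radical by [factor_noninj], the others
    factor through [N0]. Taking residues gives [A *m B = 1%:M] with inner dimension [size s']. *)
Lemma multiplicity_le (J J' : choiceType) (N : J -> rep C) (N' : J' -> rep C)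
    (s : seq J) (s' : seq J') :
  decomposition M N -> decomposition M N' -> uniq s -> uniq s' ->
  (forall j, j \in s -> rep_iso N0 (N j)) ->
  (forall j, j \in s' <-> rep_iso N0 (N' j)) -> (size s <= size s')%N.
Proof.
move=> [_ [i ds]] [iN' [i' ds']] us us' sP s'P.
have ex (a : 'I_(size s)) : exists fg :
      (forall x, 'Hom(N0 x, M x)) * (forall x, 'Hom(M x, N0 x)),
    [/\ natural fg.1, natural fg.2, forall x u, fg.2 x (fg.1 x u) = u &
      exists (f : forall x, 'Hom(N0 x, N (tnth (in_tuple s) a) x))
       (g : forall x, 'Hom(N (tnth (in_tuple s) a) x, N0 x)),
      (forall x v, fg.1 x v = i _ x (f x v)) /\
      (forall x v, fg.2 x v = g x (ds_proj ds _ x v))].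
  have /rep_isoP[f [g [nf ng gf fg]]] := sP _ (mem_tnth a (in_tuple s)).
  exists ((fun x => i _ x \o f x)%VF, (fun x => g x \o ds_proj ds _ x)%VF).
  split=> /=.
  - by apply: natural_comp => //; apply: rep_hom_natural.
  - by apply: natural_comp => //; apply: ds_proj_nat.
  - by move=> x u; rewrite !comp_lfunE ds_proj_incl gf.
  - by exists f, g; split=> x v; rewrite comp_lfunE.
pose F a := sval (cid (ex a)); have FP a := svalP (cid (ex a)).
rewrite -/(F _) in FP.
have n1 a : natural (F a).1 by have [] := FP a.
have n2 a : natural (F a).2 by have [] := FP a.
have Fid a x u : (F a).2 x ((F a).1 x u) = u by have [] := FP a.
have F0 a b x u : a <> b -> (F a).2 x ((F b).1 x u) = 0.
  move=> ab; have [_ _ _ [f [g [_ ->]]]] := FP a.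
  have [_ _ _ [f' [g' [-> _]]]] := FP b.
  have /tuple_uniqP tinj : uniq (in_tuple s) by [].
  by rewrite ds_proj_incl0 ?linear0 // => /tinj /esym.
(* The zero maps outside [s'] are defaults that make [G] total. *)
have exG c : exists fg :
      (forall x, 'Hom(N0 x, N' c x)) * (forall x, 'Hom(N' c x, N0 x)),
    [/\ natural fg.1, natural fg.2 & c \in s' -> forall x u, fg.1 x (fg.2 x u) = u].
  have [cs|_] := boolP (c \in s').
    have /rep_isoP[f [g [nf ng gf fg]]] := (s'P c).1 cs.
    by exists (f, g); split=> // _ x u; rewrite fg.
  by exists ((fun=> 0), (fun=> 0)); split=> //; apply: natural0.
pose G c := sval (cid (exG c)); have GP c := svalP (cid (exG c)).
rewrite -/(G _) in GP.
have m1 c : natural (G c).1 by have [] := GP c.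
have m2 c : natural (G c).2 by have [] := GP c.
have GK c x u : c \in s' -> (G c).1 x ((G c).2 x u) = u.
  by have [_ _ h] := GP c => /h.
pose t c := tnth (in_tuple s') c.
pose f a c x := ((F a).2 x \o (i' c x \o (G c).1 x))%VF.
pose g c b x := ((G c).2 x \o (ds_proj ds' c x \o (F b).1 x))%VF.
have nf a c : natural (f a c).
  by apply: natural_comp => //; apply: natural_comp => //; apply: rep_hom_natural.
have ng c b : natural (g c b).
  by apply: natural_comp => //; apply: natural_comp => //; apply: ds_proj_nat.
pose A := \matrix_(a < size s, c < size s') sval (cid (residue_ex i0 (nf a (t c)))).
pose B := \matrix_(c < size s', b < size s) sval (cid (residue_ex i0 (ng (t c) b))).
have AP a c : residue_rel (f a (t c)) (A a c) by rewrite mxE; case: cid.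
have BP c b : residue_rel (g (t c) b) (B c b) by rewrite mxE; case: cid.
suff AB : A *m B = 1%:M by apply: mulmx1_min AB.
apply/matrixP => a b; rewrite !mxE.
pose fgab x := \sum_c (f a (t c) x \o g (t c) b x)%VF.
have nfg : natural fgab by apply: natural_sum => c; apply: natural_comp.
have r1 : residue_rel fgab (\sum_c A a c * B c b).
  apply: residue_sum => // c; first exact: natural_comp.
  exact: residueM.
have nFF : natural (fun x => (F a).2 x \o (F b).1 x)%VF by apply: natural_comp.
have r2 : residue_rel (fun x => (F a).2 x \o (F b).1 x)%VF (a == b)%:R.
  have [<-|ab] := eqVneq a b.
    apply: eq_noninj (residue1 i0) => x v.
    by rewrite !add_lfunE comp_lfunE Fid id_lfunE.
  apply/residue0/(eq_noninj _ (noninj0 i0)) => x v.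
  by rewrite comp_lfunE F0 ?zero_lfunE //; apply/eqP.
apply: (residue_uniq i0 nFF) r2.
suff r3 : residue_rel (fun x => ((F a).2 x \o (F b).1 x)%VF - fgab x) 0.
  have := residueD i0 (naturalB nFF nfg) nfg r3 r1; rewrite add0r.
  by apply: eq_noninj => x v; rewrite subrK.
(* The expansion along [N'] is finite only at a fixed object. At [x0] it runs over [r], and the
   remainder is a finite sum of non-units [h c]; [noninj_at] locates the failure of injectivity of
   that sum at this same [x0]. *)
apply: residue0; have [x0 [v0 v00]] := nonzero_point i0.
have [r [ur rP]] := ds_nonzero_seq ds' x0.
pose h c : forall x, 'End(N0 x) := if c \in s' then (fun=> 0)
  else fun x => ((F a).2 x \o i' c x \o (ds_proj ds' c x \o (F b).1 x))%VF.
have nh c : natural (h c).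
  rewrite /h; case: ifP => _; first exact: natural0.
  apply: natural_comp; apply: natural_comp => //; first exact: rep_hom_natural.
  exact: ds_proj_nat.
have Ih c : noninj (h c).
  rewrite /h; case: (boolP (c \in s')) => cs; first exact: noninj0.
  apply: factor_noninj => //.
  - by apply: natural_comp => //; apply: rep_hom_natural.
  - by apply: natural_comp => //; apply: ds_proj_nat.
  - by move=> N0c; move: cs; rewrite (s'P c).2.
exists x0; have := noninj_at i0 (natural_sum r nh) (noninj_sum i0 r nh Ih) v00.
apply: contra_not => <-; congr lker; apply/lfunP => v.
have E : (F a).2 x0 ((F b).1 x0 v) =
    \sum_(c <- r) (F a).2 x0 (i' c x0 (ds_proj ds' c x0 ((F b).1 x0 v))).
  rewrite {1}(ds_sum ds' ((F b).1 x0 v) ur) ?linear_sum // => j ?.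
  exact/rP.
rewrite [RHS]add_lfunE opp_lfunE comp_lfunE E /fgab.
rewrite -(big_tnth _ _ s' xpredT (fun c => f a c x0 \o g c b x0)%VF).
rewrite !sum_lfunE; apply/eqP; rewrite eq_sym subr_eq; apply/eqP.
rewrite (bigID (mem s')) /= addrC; congr (_ + _).
  rewrite [RHS](bigID (mem s')) /= [X in _ = X + _]big1 ?add0r.
    by apply: eq_bigr => c cs; rewrite /h (negPf cs) !comp_lfunE.
  by move=> c cs; rewrite /h cs zero_lfunE.
rewrite -big_filter [RHS](bigID (mem r)) /= [X in _ = _ + X]big1 ?addr0.
  rewrite -[RHS]big_filter.
  have pr : perm_eq [seq c <- r | c \in s'] [seq c <- s' | c \in r].
    apply: uniq_perm; rewrite ?filter_uniq // => c.
    by rewrite !mem_filter andbC.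
  rewrite (perm_big _ pr) /=; apply: eq_big_seq => c.
  by rewrite mem_filter !comp_lfunE => /andP[_ /GK ->].
move=> c cr; rewrite !comp_lfunE.
suff -> : ds_proj ds' c x0 ((F b).1 x0 v) = 0 by rewrite !linear0.
by apply: contrapT => w0; move/negP: cr; apply; apply/rP; eexists; exact: w0.
Qed.

End Multiplicity.

Lemma rep_iso_indecomposable (k : fieldType) (C : lincat k) (M N : rep C) :
  rep_iso M N -> indecomposable M -> indecomposable N.
Proof.
move=> MN [M0 iM]; split=> [/zero_repP N0|N1 N2 NN].
  apply: M0; apply/zero_repP => x v; have /rep_isoP[f [g [_ _ gf _]]] := MN.
  by rewrite -(gf x v) (N0 _ (f x v)) linear0.
exact/iM/(rep_iso_trans MN).
Qed.

Lemma rep_iso_nonzero (k : fieldType) (C : lincat k) (M N : rep C) x :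
  rep_iso M N -> (exists v : M x, v <> 0) -> exists v : N x, v <> 0.
Proof.
move=> /rep_isoP[f [g [_ _ gf _]]] [v v0]; exists (f x v).
by apply: contra_not v0 => fv0; rewrite -(gf x v) fv0 linear0.
Qed.

Lemma decomposition_mult (k : fieldType) (C : lincat k) (M N0 : rep C)
    (J : choiceType) (N : J -> rep C) :
  decomposition M N -> indecomposable N0 ->
  exists s : seq J, uniq s /\ forall j, j \in s <-> rep_iso N0 (N j).
Proof.
move=> [iN [i ds]] i0; have [x [v v0]] := nonzero_point i0.
have : finite_set [set j | rep_iso N0 (N j)].
  apply: sub_finite_set (ds_finite ds x) => j /= N0j.
  by apply: rep_iso_nonzero N0j _; exists v.
move=> /finite_seqP[s sE].
exists (undup s); split=> [|j]; first exact: undup_uniq.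
rewrite mem_undup; have -> : (j \in s : Prop) = [set` s] j by [].
by rewrite -sE.
Qed.

Lemma decomposition_unique (k : closedFieldType) (C : lincat k) (M : rep C)
    (J J' : choiceType) (N : J -> rep C) (N' : J' -> rep C) :
  decomposition M N -> decomposition M N' ->
  exists sigma : J -> J', bijective sigma /\
    forall j, rep_iso (N j) (N' (sigma j)).
(* Each isomorphism class has the same finite number of indices in [J] and in [J'], by
   [multiplicity_le] in both directions; [sigma] matches positions in the two lists of a class. *)
Proof.
move=> dN dN'; have iN := dN.1; have iN' := dN'.1.
pose S j := sval (cid (decomposition_mult dN (iN j))).
have SP j : uniq (S j) /\ forall l, l \in S j <-> rep_iso (N j) (N l).
  exact: svalP (cid (decomposition_mult dN (iN j))).
pose S' j := sval (cid (decomposition_mult dN' (iN j))).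
have S'P j : uniq (S' j) /\ forall l, l \in S' j <-> rep_iso (N j) (N' l).
  exact: svalP (cid (decomposition_mult dN' (iN j))).
have sz j : size (S j) = size (S' j).
  have [us sP] := SP j; have [us' s'P] := S'P j.
  by apply/eqP; rewrite eqn_leq; apply/andP; split;
    [apply: (multiplicity_le (iN j) dN dN')
    | apply: (multiplicity_le (iN j) dN' dN)] => // l;
    [move=> /sP | move=> /s'P].
(* A canonical index in the isomorphism class of [N j]. By [rpE] isomorphic summands have equal
   representatives, hence literally the same lists. *)
pose rp j := choose (fun l => `[< rep_iso (N j) (N l) >]) j.
have rpP j : rep_iso (N j) (N (rp j)).
  by apply/asboolP/(chooseP (P := fun l => `[< rep_iso (N j) (N l) >]))/asboolP/rep_iso_refl.
have rpE j l : rep_iso (N j) (N l) -> rp j = rp l.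
  move=> jl; rewrite /rp (@eq_choose _ _ (fun m => `[< rep_iso (N l) (N m) >])).
    by apply: choose_id; apply/asboolP; [apply: rep_iso_sym | apply: rep_iso_refl].
  move=> m; apply/asboolP/asboolP; apply: rep_iso_trans => //.
  exact: rep_iso_sym.
have Sj j : j \in S (rp j) by apply/(SP _).2/rep_iso_sym.
have lt j : (index j (S (rp j)) < size (S' (rp j)))%N by rewrite -sz index_mem.
(* Only supplies the default value of [nth]; by [lt] the position is always in range. *)
have dflt (j : J) : exists d : J', True.
  by case: (S' (rp j)) (lt j) => [//|d ? _]; exists d.
pose sigma j := nth (sval (cid (dflt j))) (S' (rp j)) (index j (S (rp j))).
have sP j : rep_iso (N (rp j)) (N' (sigma j)).
  by apply/(S'P _).2; rewrite mem_nth.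
have si : injective sigma.
  move=> j l E; have jl : rp j = rp l.
    apply: rpE; apply: rep_iso_trans (rpP j) _.
    apply: rep_iso_trans (sP j) _; rewrite E.
    apply: rep_iso_trans (rep_iso_sym (sP l)) _.
    exact: rep_iso_sym.
  move: E; rewrite /sigma jl (set_nth_default (sval (cid (dflt l)))) -?jl //.
  move=> /eqP; rewrite nth_uniq ?lt ?(S'P _).1 //; last by rewrite jl.
  move=> /eqP E; rewrite -(nth_index j (Sj j)) E nth_index //.
  by rewrite jl.
(* The class of [N' j'] has multiplicity at least 1 in [N'], hence also in [N], which provides a
   list in which to read off the position of [j']. *)
have ss j' : exists j, sigma j = j'.
  have [s [us sP']] := decomposition_mult dN (iN' j').
  have : (size [:: j'] <= size s)%N.
    have [s' [us' s'P]] := decomposition_mult dN' (iN' j').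
    apply: (@leq_trans (size s')).
      by rewrite uniq_leq_size // => l; rewrite inE => /eqP ->; apply/s'P/rep_iso_refl.
    by apply: (multiplicity_le (iN' j') dN' dN) => // l /s'P.
  case: s us sP' => [//|j0 s] us sP' _.
  have j0j' : rep_iso (N j0) (N' j') by apply/rep_iso_sym/sP'; rewrite mem_head.
  have j'S : j' \in S' (rp j0).
    by apply/(S'P _).2/(rep_iso_trans _ j0j')/rep_iso_sym.
  pose j := nth j0 (S (rp j0)) (index j' (S' (rp j0))).
  have jS : j \in S (rp j0) by rewrite mem_nth // sz index_mem.
  have jE : rp j = rp j0.
    by apply: rpE; apply: rep_iso_trans (rep_iso_sym (rpP j0)); apply/rep_iso_sym/(SP _).2.
  exists j; rewrite /sigma jE /j index_uniq ?(SP _).1 ?sz ?index_mem //.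
  by rewrite nth_index.
exists sigma; split=> [|j]; last exact: rep_iso_trans (sP j).
exists (fun j' => sval (cid (ss j'))) => j; last exact: svalP (cid (ss j)).
by apply: si; exact: svalP (cid (ss _)).
Qed.

(** * Existence of decompositions *)


Lemma idem_direct_sum (k : fieldType) (C : lincat k) (M : rep C) (J : choiceType)
    (e : J -> forall x, 'End(M x)) (ne : forall j, natural (e j)) :
  (forall j, idempotent_family (e j)) ->
  (forall j l x v, j <> l -> e j x (e l x v) = 0) ->
  (forall x, exists s : seq J, uniq s /\ forall v, v = \sum_(j <- s) e j x v) ->
  is_direct_sum (fun j => natural_hom (@sub_incl_nat _ _ _ _ (limg_stable (ne j)))).
Proof.
move=> ee eo es x v; have [s [us sE]] := es x.
have ev j l (w : sub_rep (limg_stable (ne l)) x) : j <> l -> e j x (vsval w) = 0.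
  by move=> jl; have /memv_imgP[u _ ->] := subvsP w; rewrite eo.
have ev1 j (w : sub_rep (limg_stable (ne j)) x) : e j x (vsval w) = vsval w.
  by have /memv_imgP[u _ ->] := subvsP w; rewrite ee.
have inE j (w : sub_rep (limg_stable (ne j)) x) :
  natural_hom (@sub_incl_nat _ _ _ _ (limg_stable (ne j))) x w = vsval w by apply: sub_inclE.
exists (fun j => Subvs (mem_limg (e j) v)); split.
  have sup j : Subvs (mem_limg (e j) v) != 0 -> j \in s.
    apply: contraR => js; apply/eqP/subvs_inj => /=.
    rewrite (sE v) linear_sum /= big_seq big1 // => l ls.
    by rewrite eo // => jl; rewrite jl ls in js.
  split; first by apply: sub_finite_set (finite_seq s) => j /sup.
  rewrite (fsbig_uniq_seq us) => [|j]; last first.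
    by move=> jn; apply: sup; apply: contra_neq jn => ->; rewrite linear0.
  by rewrite {1}(sE v); apply: eq_bigr => j _; rewrite inE.
move=> w [/finite_seqP[r rE] vw]; apply: functional_extensionality_dep => l.
apply: subvs_inj => /=; rewrite vw.
rewrite (@fsbig_uniq_seq _ _ _ (undup r)) ?undup_uniq //; last first.
  move=> j jn; rewrite mem_undup; have : [set` r] j; last by [].
  rewrite -rE /=; apply: contra_neq jn => ->; exact: linear0.
rewrite linear_sum (eq_bigr (fun j => e l x (vsval (w j)))) => [|j _]; last by rewrite inE.
have [lr|lr] := boolP (l \in undup r).
  rewrite (bigD1_seq l) ?undup_uniq //= big1 ?addr0 ?ev1 // => j /eqP jl.
  by rewrite ev // => lj; apply: jl.
rewrite big_seq big1 => [|j jr]; last first.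
  by rewrite ev // => lj; rewrite lj jr in lr.
have -> : w l = 0; last by rewrite linear0.
apply/eqP; apply: contraR lr => wl; rewrite mem_undup.
by have : [set` r] l; last by []; rewrite -rE.
Qed.

Section Existence.
Variables (k : fieldType) (Q : thread_quiver) (I : ideal (path_cat k Q)).
Variable M : rep (quot_cat I).

(* Indexing by [tobj Q] rather than by the objects of [quot_cat I] keeps this
   type small enough to form sets of it. *)
Definition endo := forall x : tobj Q, 'End(M x).

Definition commuting_idems (B : set endo) :=
  (forall e, B e -> natural (e : forall x : quot_cat I, 'End(M x)) /\
                    idempotent_family (e : forall x : quot_cat I, 'End(M x))) /\
  (forall e f, B e -> B f -> forall x v, e x (f x v) = f x (e x v)).

Lemma max_commuting_idems : exists B : set endo, commuting_idems B /\
  forall e : endo, natural (e : forall x : quot_cat I, 'End(M x)) ->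
    idempotent_family (e : forall x : quot_cat I, 'End(M x)) ->
    (forall f, B f -> forall x v, e x (f x v) = f x (e x v)) -> B e.
(* A union of a chain of commuting families commutes. Maximality is restated in the form used below:
   a natural idempotent that commutes with [B] belongs to [B]. *)
Proof.
have [|B [PB Bmax]] := @Zorn_bigcup endo commuting_idems.
  move=> F FP Ftot; split=> [e [X FX Xe]|e f [X FX Xe] [Y FY Yf]].
    exact: (FP _ FX).1.
  have [XY|YX] := Ftot _ _ FX FY.
    by apply: (FP _ FY).2 => //; apply: XY.
  by apply: (FP _ FX).2 => //; apply: YX.
exists B; split=> // e ne ee eB; apply: contrapT => Be.
apply: (Bmax (B `|` [set e])).
  by split=> [f|/(_ e) Ue]; [left | apply/Be/Ue; right].
split=> [f [/PB.1//|->//]|f g [Bf|->] [Bg|->] x v] //; first exact: PB.2.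
  by rewrite eB.
exact: eB.
Qed.

Section Atoms.
Variable B : set endo.
Hypothesis PB : commuting_idems B.
Hypothesis Bmax : forall e : endo, natural (e : forall x : quot_cat I, 'End(M x)) ->
    idempotent_family (e : forall x : quot_cat I, 'End(M x)) ->
    (forall f, B f -> forall x v, e x (f x v) = f x (e x v)) -> B e.

Let Bn e : B e -> natural (e : forall x : quot_cat I, 'End(M x)).
Proof. by move=> /PB.1[]. Qed.
Let Bi e : B e -> forall x v, e x (e x v) = e x v.
Proof. by move=> /PB.1[]. Qed.
Let Bc := PB.2.

Lemma max_idems_comp e f : B e -> B f -> B (fun x => e x \o f x)%VF.
Proof.
move=> Be Bf; apply: Bmax.
- by apply: natural_comp; apply: Bn.
- by move=> x v; rewrite /= !comp_lfunE (Bc Bf Be) (Bi Bf) (Bi Be).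
- by move=> g Bg x v; rewrite /= !comp_lfunE (Bc Bf Bg) (Bc Be Bg).
Qed.

Lemma max_idems1 : B (fun x => \1%VF).
Proof.
apply: Bmax; first exact: natural1.
  by move=> x v; rewrite !id_lfunE.
by move=> f _ x v; rewrite !id_lfunE.
Qed.

Lemma max_idems_compl e : B e -> B (fun x => \1%VF - e x).
Proof.
move=> Be; apply: Bmax; first by apply: naturalB; [apply: natural1 | apply: Bn].
  by move=> x v; rewrite !(add_lfunE, opp_lfunE, id_lfunE) linearB /= Bi // subrr subr0.
by move=> f Bf x v; rewrite !(add_lfunE, opp_lfunE, id_lfunE) linearB /= Bc.
Qed.

Definition atom (a : endo) := [/\ B a, exists x v, a x v <> 0 &
  forall b, B b -> (forall x v, a x (b x v) = 0) \/ (forall x v, a x (b x v) = a x v)].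

Lemma projection_fixes_limg (V : vectType k) (f g : 'End(V)) :
  (forall v, f (f v) = f v) -> (forall v, f (g v) = g (f v)) ->
  (\dim (limg g) <= \dim (limg (f \o g)%VF))%N -> forall v, f (g v) = g v.
Proof.
move=> ff fg dm; have E : limg (f \o g)%VF = limg g.
  apply/eqP; rewrite eqEdim dm andbT; apply/subvP => _ /memv_imgP[u _ ->].
  by rewrite comp_lfunE fg memv_img ?memvf.
move=> v; have : g v \in limg (f \o g)%VF by rewrite E memv_img ?memvf.
by move=> /memv_imgP[u _ ->]; rewrite comp_lfunE ff.
Qed.

(** Take [e'] below [e], nonzero at [x] and of least rank there. The atom is the infimum of the
    family [F] of idempotents that fix the image of [e'] at [x]; the infimum is attained at each
    object separately, by rank, and lies in [B] by maximality. *)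
Lemma atom_below e x v : B e -> e x v <> 0 ->
  exists a, [/\ atom a, forall y w, e y (a y w) = a y w & exists w, a x w <> 0].
Proof.
move=> Be ev.
pose cand d f := [/\ B f, forall y w, e y (f y w) = f y w, exists w, f x w <> 0 &
                   \dim (limg (f x)) = d].
have exd : exists d, `[< exists f, cand d f >].
  by exists (\dim (limg (e x))); apply/asboolP; exists e; split=> //; [apply: Bi|exists v].
case: (ex_minnP exd) => d /asboolP[e' [Be' ee' [v' e'v'] dE]] dmin.
have {}dmin f : B f -> (forall y w, e y (f y w) = f y w) -> (exists w, f x w <> 0) ->
    (\dim (limg (e' x)) <= \dim (limg (f x)))%N.
  by move=> Bf ef fw; rewrite dE; apply: dmin; apply/asboolP; exists f.
pose F := [set f | B f /\ forall w, f x (e' x w) = e' x w].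
have Fc f g : F f -> F g -> F (fun y => f y \o g y)%VF.
  by move=> [Bf fe] [Bg ge]; split=> [|w]; [apply: max_idems_comp | rewrite comp_lfunE ge fe].
have Fmin y : exists f, F f /\ forall g, F g -> (\dim (limg (f y)) <= \dim (limg (g y)))%N.
  have exm : exists m, `[< exists2 f, F f & \dim (limg (f y)) = m >].
    exists (\dim (limg (e' y))); apply/asboolP; exists e' => //; split=> // w.
    exact: Bi.
  case: (ex_minnP exm) => m /asboolP[f Ff fE] mmin; exists f; split=> // g Fg.
  by rewrite fE; apply: mmin; apply/asboolP; exists g.
pose f y := sval (cid (Fmin y)).
have fF y : F (f y) by rewrite /f; case: cid => ? [].
have fM y g : F g -> (\dim (limg (f y y)) <= \dim (limg (g y)))%N.
  by move=> Fg; rewrite /f; case: cid => ? [_] /=; apply.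
(* A diagonal choice: each object uses its own minimal member of [F]. As [F] is closed under
   composition, every member of [F] fixes the image of [a] everywhere. *)
pose a y := f y y.
have Fa g y w : F g -> g y (a y w) = a y w.
  move=> Fg; apply: projection_fixes_limg => [u|u|]; first exact: Bi Fg.1 _ _.
    exact: Bc Fg.1 (fF y).1 _ _.
  exact: (fM y _ (Fc _ _ Fg (fF y))).
have Ba : B a.
  apply: Bmax => [y z h w|y w|b Bb y w].
  (* Over [y] and [z] alike, [a] agrees with the composite of [f y] and [f z], a single natural
     family; this gives naturality of [a]. *)
  - have Ey u : a y u = f y y (f z y u).
      by rewrite (Bc (fF y).1 (fF z).1) -/(a y) Fa.
    have Ez u : a z u = f y z (f z z u) by rewrite -/(a z) Fa.
    have := Bn (max_idems_comp (fF y).1 (fF z).1) h w; rewrite !comp_lfunE => E.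
    by rewrite [a z _]Ez E -Ey.
  - exact: Bi (fF y).1 _ _.
  - exact: Bc (fF y).1 Bb _ _.
have Fe' : F e' by split=> // w; apply: Bi.
have ax w : a x w = e' x w.
  by rewrite -(Fa e' x w) // (Bc Be' Ba) (fF x).2.
exists a; split; last by exists v'; rewrite ax.
  split=> //; first by exists x, v'; rewrite ax.
  (* Either [b] kills [e'] at [x] and [1 - b] is in [F], or by minimality of the rank of [e'] it
     fixes [e'] there and [b] itself is in [F]. *)
  move=> b Bb; have [be0|] := pselect (forall w, b x (e' x w) = 0); [left|right] => y w.
    have /(Fa _ y w) : F (fun y => \1%VF - b y).
      split=> [|u]; first exact: max_idems_compl.
      by rewrite add_lfunE opp_lfunE id_lfunE be0 subr0.
    rewrite add_lfunE opp_lfunE id_lfunE -[RHS]subr0 => /addrI/oppr_inj.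
    by rewrite (Bc Ba Bb).
  have Fb : F b.
    split=> // u; apply: projection_fixes_limg => [z|z|]; try exact: Bi; try exact: Bc.
    apply: (dmin _ (max_idems_comp Bb Be')) => [z w'|].
      by rewrite comp_lfunE (Bc Bb Be') ee'.
    apply: contrapT => nw; apply: b0 => w'; apply: contrapT => bw; apply: nw.
    by exists w'; rewrite comp_lfunE.
  by rewrite (Bc Ba Bb) Fa.
by move=> y w; rewrite -(Fa e' y w) // ee'.
Qed.


Lemma atom_orthogonal a b : atom a -> atom b -> a <> b ->
  forall x v, a x (b x v) = 0.
Proof.
move=> [Ba _ aP] [Bb _ bP] ab; have [//|ab1] := aP b Bb.
have [ba0|ba1] := bP a Ba; first by move=> x v; rewrite (Bc Ba Bb).
case: ab; apply: functional_extensionality_dep => x; apply/lfunP => v.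
by rewrite -ab1 (Bc Ba Bb).
Qed.

Definition atom_type := {classic {a : endo | atom a}}.
Definition atom_endo (j : atom_type) : endo := sval (j : {a : endo | atom a}).

Lemma atom_endoP j : atom (atom_endo j). Proof. exact: svalP. Qed.

Lemma atom_endo_nat j : natural (atom_endo j : forall x : quot_cat I, 'End(M x)).
Proof. by have [/Bn] := atom_endoP j. Qed.

Lemma atom_endo_idem j :
  idempotent_family (atom_endo j : forall x : quot_cat I, 'End(M x)).
Proof. by have [/Bi] := atom_endoP j. Qed.

Lemma atom_endo_orth (j l : atom_type) x v : j <> l ->
  atom_endo j x (atom_endo l x v) = 0.
Proof.
move=> jl; apply: atom_orthogonal; try exact: atom_endoP.
by move=> E; apply: jl; case: j l E => [a aA] [b bA] /= E; apply: eq_exist.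
Qed.

(** Written as a product so that it visibly lies in [B]; by orthogonality it is 1 minus the sum of
    the atoms. *)
Fixpoint cocover (s : seq atom_type) : endo :=
  if s is a :: s' then fun x => (cocover s' x \o (\1%VF - atom_endo a x))%VF
  else fun x => \1%VF.

Lemma max_idems_cocover s : B (cocover s).
Proof.
elim: s => [|a s IH] /=; first exact: max_idems1.
by apply: max_idems_comp => //; apply: max_idems_compl; have [] := atom_endoP a.
Qed.

Lemma cocoverE s x v : uniq s ->
  cocover s x v = v - \sum_(a <- s) atom_endo a x v.
Proof.
elim: s v => [|a s IH] v /=; first by rewrite big_nil id_lfunE subr0.
move=> /andP[als us]; rewrite comp_lfunE IH // big_cons.
rewrite add_lfunE opp_lfunE id_lfunE opprD addrA; congr (_ - _).
rewrite big_seq [RHS]big_seq; apply: eq_bigr => b bs.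
rewrite linearB /= atom_endo_orth ?subr0 // => ba.
by rewrite -ba bs in als.
Qed.

(** Choose [s] with [cocover s] of least rank at [x]. Were it nonzero, an atom below it, nonzero at
    [x], would be absent from [s], and adding it would lower the rank. *)
Lemma atoms_cover x : exists s : seq atom_type, uniq s /\
  forall v, v = \sum_(a <- s) atom_endo a x v.
Proof.
have exm : exists m, `[< exists2 s, uniq s & \dim (limg (cocover s x)) = m >].
  by exists (\dim (limg (cocover [::] x))); apply/asboolP; exists [::].
case: (ex_minnP exm) => m /asboolP[s us sE] mmin; exists s; split=> // v.
apply/eqP; rewrite -subr_eq0 -cocoverE //; apply/eqP; apply: contrapT => sv.
have [a [aA sa [w aw]]] := atom_below (max_idems_cocover s) sv.
have Ba : B a by case: aA.
pose j : atom_type := exist _ a aA.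
have js : j \notin s.
  apply/negP => js; apply: aw; rewrite -sa cocoverE // (bigD1_seq j) //=.
  rewrite big1 => [|l /eqP lj]; last exact: (@atom_endo_orth l j).
  rewrite addr0 (_ : atom_endo j x (a x w) = a x w) ?subrr //; exact: Bi Ba _ _.
have := mmin (\dim (limg (cocover (j :: s) x))).
have -> : `[< exists2 s0, uniq s0 & \dim (limg (cocover s0 x)) =
     \dim (limg (cocover (j :: s) x)) >] by apply/asboolP; exists (j :: s); rewrite //= js.
move=> /(_ isT); rewrite -sE => dm.
have E : limg (cocover (j :: s) x) = limg (cocover s x).
  apply/eqP; rewrite eqEdim dm andbT; apply/subvP => _ /memv_imgP[u _ ->].
  by rewrite /= comp_lfunE memv_img ?memvf.
have : a x w \in limg (cocover s x) by rewrite -sa memv_img ?memvf.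
rewrite -E => /memv_imgP[u _]; rewrite /= comp_lfunE => au.
have := congr1 (a x) au; rewrite (Bi Ba) (Bc Ba (max_idems_cocover s)).
rewrite add_lfunE opp_lfunE id_lfunE linearB /= (Bi Ba) subrr linear0.
exact: aw.
Qed.

Definition atom_rep j : rep (quot_cat I) := sub_rep (limg_stable (@atom_endo_nat j)).

(** An idempotent of the image of [a], extended by zero, commutes with each [b] in [B], because [b]
    acts as 0 or 1 on that image. By maximality it is in [B], and the atom property makes it
    trivial. *)
Lemma atom_indecomposable j : indecomposable (atom_rep j).
Proof.
have [Ba [x0 [v0 av0]] aP] := atom_endoP j.
set a := atom_endo j in Ba av0 aP.
apply: idem_indecomposable.
  pose u := Subvs (@mem_limg _ (quot_cat I) M (atom_endo j) x0 v0).
  by move=> /zero_repP/(_ x0 u)/(congr1 vsval).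
move=> f nf ff.
pose inc := sub_incl (limg_stable (@atom_endo_nat j)).
pose prj := sub_proj (limg_stable (@atom_endo_nat j)) a.
have incE x u : inc x u = vsval u by apply: sub_inclE.
have prjE x v : vsval (prj x v) = a x v by apply: sub_projE => ? ?; apply: mem_limg.
have ainc x u : a x (vsval (u : atom_rep j x)) = vsval u.
  by have /memv_imgP[v _ ->] := subvsP u; rewrite (Bi Ba).
have prjK x u : prj x (vsval u) = u by apply: subvs_inj; rewrite prjE ainc.
pose g : endo := fun x => (inc x \o (f x \o prj x))%VF.
have gE x v : g x v = vsval (f x (prj x v)) by rewrite !comp_lfunE incE.
have ag x v : a x (g x v) = g x v by rewrite gE ainc.
have ga x v : g x (a x v) = g x v.
  by rewrite !gE; congr (vsval (f x _)); apply: subvs_inj; rewrite !prjE (Bi Ba).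
have Bg : B g.
  apply: Bmax.
  - apply: natural_comp; first exact: sub_incl_nat.
    apply: natural_comp => //; apply: sub_proj_nat; first exact: atom_endo_nat.
    by move=> ? ?; apply: mem_limg.
  - by move=> x v; rewrite !gE prjK ff.
  move=> b Bb x v; rewrite -(ag x v) -(ga x (b x v)) -(Bc Ba Bb).
  have [ab0|ab1] := aP b Bb; first by rewrite !ab0 linear0.
  by rewrite !ab1 ga ag.
have [g0|g1] := aP g Bg; [left|right] => x u; apply: subvs_inj.
  by have := g0 x (vsval u); rewrite ag gE prjK.
by have := g1 x (vsval u); rewrite ag gE prjK ainc.
Qed.

End Atoms.

Lemma decomposition_exists :
  exists (J : choiceType) (N : J -> rep (quot_cat I)), decomposition M N.
Proof.
have [B [PB Bmax]] := max_commuting_idems.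
exists (atom_type B), (@atom_rep B PB); split; first exact: atom_indecomposable.
exists (fun j => natural_hom (@sub_incl_nat _ _ _ _ (limg_stable (@atom_endo_nat _ PB j)))).
apply: idem_direct_sum => [j|j l x v|x]; first exact: atom_endo_idem.
- exact: atom_endo_orth.
- exact: atoms_cover.
Qed.

End Existence.

(** * Linear limits and interval summands *)


Lemma argmin_nat (T : Type) (P : T -> Prop) (m : T -> nat) :
  (exists t, P t) -> exists t, P t /\ forall u, P u -> (m t <= m u)%N.
Proof.
move=> [t0 Pt0]; have exm : exists n, `[< exists2 t, P t & m t = n >].
  by exists (m t0); apply/asboolP; exists t0.
case: (ex_minnP exm) => n /asboolP[t Pt <-] nmin; exists t; split=> // u Pu.
by apply: nmin; apply/asboolP; exists u.
Qed.

Section LinearLimit.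
Variables (k : fieldType) (T : Type) (R : T -> T -> Prop).
Hypothesis Rtot : forall s t, R s t \/ R t s.
Hypothesis Rtrans : forall s t u, R s t -> R t u -> R s u.
Variables (X : T -> vectType k) (Y : vectType k) (y : Y).
Variables (f : forall s t, 'Hom(X s, X t)) (g : forall t, 'Hom(X t, Y)).
Hypothesis f1 : forall t v, f t t v = v.
Hypothesis fM : forall s t u v, R s t -> R t u -> f t u (f s t v) = f s u v.
Hypothesis gf : forall s t v, R s t -> g t (f s t v) = g s v.
Hypothesis y0 : y <> 0.
Hypothesis gy : forall t, exists v, g t v = y.

Let Rrefl t : R t t. Proof. by have [] := Rtot t t. Qed.

(** A subsystem that still meets the fibre over [y] at every index; shrinking cones replaces a
    construction by recursion, which an arbitrary chain does not permit. *)
Definition cone (W : forall t, {vspace (X t)}) :=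
  (forall s t v, R s t -> v \in W s -> f s t v \in W t) /\
  (forall t, exists2 v, v \in W t & g t v = y).

Lemma minimal_cone : exists W, cone W /\
  forall W', cone W' -> (forall t, (W' t <= W t)%VS) -> forall t, W' t = W t.
Proof.
pose S := {W | cone W}.
(* Reversed inclusion, so that [Zorn] yields a minimal cone. A chain is bounded by taking at each
   [t] the member of least dimension at [t]. *)
pose le (W W' : S) := `[< forall t, (sval W' t <= sval W t)%VS >].
have [||||[W cW] Wmin] := @Zorn S le.
- by move=> W; apply/asboolP => t.
- move=> W1 W2 W3 /asboolP le1 /asboolP le2; apply/asboolP => t.
  exact: subv_trans (le2 t) (le1 t).
- move=> [W1 c1] [W2 c2] /asboolP /= le1 /asboolP /= le2; apply: eq_exist.
  apply: functional_extensionality_dep => t; apply/eqP.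
  by rewrite eqEsubv le1 le2.
- move=> A Atot; have [[W0 AW0]|A0] := pselect (exists W, A W); last first.
    have cf : cone (fun=> fullv).
      split=> [*|t]; first exact: memvf.
      by have [v gv] := gy t; exists v => //; apply: memvf.
    by exists (exist _ _ cf) => W AW; case: A0; exists W.
  have mP t := @argmin_nat _ A (fun W => \dim (sval W t)) (ex_intro _ W0 AW0).
  pose m t := sval (cid (mP t)).
  have Am t : A (m t) by rewrite /m; case: cid => ? [].
  have mmin t W : A W -> (sval (m t) t <= sval W t)%VS.
    move=> AW; have := svalP (cid (mP t)); rewrite -/(m t) => -[_ /(_ _ AW) dm].
    have [/asboolP le1|/asboolP//] := Atot _ _ (Am t) AW.
    by have /eqP -> // : sval W t == sval (m t) t; rewrite eqEdim le1.
  have cm : cone (fun t => sval (m t) t).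
    split=> [s t v st vs|t]; last exact: (svalP (m t)).2.
    by apply: (svalP (m t)).1 st _; apply: (subvP (mmin s _ (Am t))).
  by exists (exist _ _ cm) => W AW; apply/asboolP => t; apply: mmin.
exists W; split=> // W' cW' W'W t.
have /(congr1 sval) /= -> // : exist _ _ cW' = exist _ _ cW.
by apply: Wmin; apply/asboolP.
Qed.

(* A minimal cone consists of lines, on each of which [g] pins down one vector. *)
Lemma linear_limit : exists x : forall t, X t,
  (forall t, g t (x t) = y) /\ (forall s t, R s t -> f s t (x s) = x t).
Proof.
have [W [[Wf Wy] Wmin]] := minimal_cone.
(* Replacing each [W u] by the smallest image [f s u @: W s] from an earlier [s] gives a cone again,
   so by minimality the transition maps are surjective. *)
have surj s t v : R s t -> v \in W t -> exists2 w, w \in W s & f s t w = v.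
  have mP u := @argmin_nat _ (fun s => R s u) (fun s => \dim (f s u @: W s)%VS)
     (ex_intro _ u (Rrefl u)).
  pose m u := sval (cid (mP u)).
  have mR u : R (m u) u by rewrite /m; case: cid => ? [].
  have mD u r : R r u -> (\dim (f (m u) u @: W (m u)) <= \dim (f r u @: W r))%N.
    by move=> ru; rewrite /m; case: cid => ? [_] /=; apply.
  have imS r r' u : R r r' -> R r' u -> (f r u @: W r <= f r' u @: W r')%VS.
    move=> rr ru; apply/subvP => _ /memv_imgP[w wW ->].
    by rewrite -(fM _ rr ru) memv_img // Wf.
  have mS u r : R r u -> (f (m u) u @: W (m u) <= f r u @: W r)%VS.
    move=> ru; have [mr|rm] := Rtot (m u) r; first exact: imS.
    have sub := imS _ _ _ rm (mR u).
    suff /eqP <- : (f r u @: W r == f (m u) u @: W (m u))%VS by [].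
    by rewrite eqEdim sub mD.
  pose W' u := (f (m u) u @: W (m u))%VS.
  have W'W u : (W' u <= W u)%VS.
    by apply/subvP => _ /memv_imgP[w wW ->]; apply: Wf.
  have cW' : cone W'.
    split=> [r u w ru|u]; last first.
      have [w wW wy] := Wy (m u); exists (f (m u) u w); first exact: memv_img.
      by rewrite gf.
    have [mr|rm] := Rtot (m u) r.
      move=> /(subvP (mS _ _ mr)) /memv_imgP[z zW ->].
      by rewrite fM // memv_img.
    move=> /(subvP (W'W _)) wW; rewrite -(fM w rm (mR u)) memv_img //.
    exact: Wf.
  move=> st; rewrite -(Wmin _ cW' W'W) => /(subvP (mS _ _ st)) /memv_imgP[w wW ->].
  by exists w.
have line t x : x \in W t -> g t x = y -> W t = <[x]>%VS.
  move=> xW gx.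
  (* Cut [W] down to the line through [x]: its images after [t], its preimages before. [surj]
     ensures that the preimages still reach [y]. *)
  pose W' u := if `[< R t u >] then <[f t u x]>%VS else (W u :&: f u t @^-1: <[x]>)%VS.
  have W'W u : (W' u <= W u)%VS.
    rewrite /W'; case: asboolP => [tu|_]; last exact: capvSl.
    by rewrite -memvE Wf.
  have cW' : cone W'.
    split=> [r u w ru|u]; last first.
      rewrite /W'; case: asboolP => [tu|ntu].
        by exists (f t u x); [apply: memv_line | rewrite gf].
      have ut : R u t by have [] := Rtot t u.
      have [w wW wx] := surj _ _ _ ut xW.
      exists w; last by rewrite -(gf w ut) wx.
      by rewrite memv_cap wW -memv_preim wx memv_line.
    rewrite /W'; case: asboolP => [tr|ntr].
      have tu := Rtrans tr ru; rewrite asboolT // => /vlineP[c ->].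
      by rewrite linearZ /= fM // memvZ ?memv_line.
    have rt : R r t by have [] := Rtot t r.
    rewrite memv_cap -memv_preim => /andP[wW /vlineP[c wc]].
    case: asboolP => [tu|ntu].
      by rewrite -(fM w rt tu) wc linearZ /= memvZ ?memv_line.
    have ut : R u t by have [] := Rtot t u.
    by rewrite memv_cap Wf // -memv_preim fM // wc memvZ ?memv_line.
  by rewrite -(Wmin _ cW' W'W) /W' asboolT // f1.
exists (fun t => sval (cid2 (Wy t))); split=> [t|s t st].
  by case: cid2.
case: cid2 => xs /= xsW xsy; case: cid2 => xt /= xtW xty.
have : f s t xs \in W t by exact: Wf.
rewrite (line _ _ xtW xty) => /vlineP[c fc].
(* The scalar [c] is 1 since both vectors map to the nonzero vector [y]. *)
have := gf xs st; rewrite fc linearZ /= xsy xty => /eqP.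
rewrite -subr_eq0 -[X in _ - X]scale1r -scalerBl scaler_eq0 => /orP[|/eqP//].
by rewrite subr_eq0 => /eqP ->; rewrite scale1r.
Qed.

End LinearLimit.

Lemma separating_functional (k : fieldType) (V : vectType k) (W : {vspace V}) v :
  v \notin W -> exists phi : 'Hom(V, k^o), phi v = 1 /\ forall w, w \in W -> phi w = 0.
Proof.
move=> vW; pose p := daddv_pi (W^C)%VS W.
have cap : (W^C :&: W = 0)%VS by rewrite capvC capv_compl.
have pW w : w \in W -> p w = 0.
  move=> wW; have := daddv_pi_add cap (w := w).
  rewrite addvC addv_complf memvf => /(_ isT).
  by rewrite [X in _ + X]daddv_pi_id // 1?capvC // -[RHS]add0r => /addIr.
have pv : p v != 0.
  apply: contraNneq vW => pv0; have := daddv_pi_add cap (w := v).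
  rewrite addvC addv_complf memvf => /(_ isT).
  by rewrite -/p pv0 add0r => <-; apply: memv_pi.
have [i ci] : exists i, coord (vbasis fullv) i (p v) != 0.
  apply: contrapT => nc; move/eqP: pv; apply.
  rewrite (coord_vbasis (memvf (p v))) big1 // => i _.
  have [->|ci] := eqVneq (coord (vbasis fullv) i (p v)) 0; first by rewrite scale0r.
  by case: nc; exists i.
pose phi : 'Hom(V, k^o) := linfun (fun w => (coord (vbasis fullv) i (p v))^-1 *
  coord (vbasis fullv) i (p w) : k^o).
have phiE w : phi w = (coord (vbasis fullv) i (p v))^-1 * coord (vbasis fullv) i (p w).
  have lin : linear (fun w => (coord (vbasis fullv) i (p v))^-1 *
     coord (vbasis fullv) i (p w) : k^o).
    by move=> a u u'; rewrite !linearP /= mulrDr mulrCA.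
  exact: (lfunE (HB.pack (fun w : V => _)
     (GRing.isLinear.Build _ _ _ _ _ lin) : {linear _ -> k^o})).
exists phi; split=> [|w wW]; first by rewrite phiE mulVf.
by rewrite phiE (pW w wW) linear0 mulr0.
Qed.

(** * The elder rule: splitting off an interval inside a thread *)

Section ElderRule.
Variables (k : fieldType) (d : Order.disp_t) (T : orderType d).
Variables (V : T -> vectType k) (A B : vectType k).
Variables (eta : forall p q, 'Hom(V p, V q)).
Variables (inn : forall p, 'Hom(A, V p)) (out : forall p, 'Hom(V p, B)).
Hypothesis eta1 : forall p v, eta p p v = v.
Hypothesis etaM : forall p q r v, (p <= q)%O -> (q <= r)%O ->
  eta q r (eta p q v) = eta p r v.
Hypothesis eta_inn : forall p q a, (p <= q)%O -> eta p q (inn p a) = inn q a.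
Hypothesis out_eta : forall p q v, (p <= q)%O -> out q (eta p q v) = out p v.
Variables (p0 : T) (v0 : V p0).
Hypotheses (out0 : out p0 v0 = 0) (inn0 : v0 \notin limg (inn p0)).

(* [v] dies as early as possible among the vectors killed by [out p0] and outside the
   image of [inn p0]; [phi] kills every vector that is older than [v]. *)
Lemma elder_vector : exists (v : V p0) (phi : 'Hom(V p0, k^o)),
  [/\ out p0 v = 0, phi v = 1, forall a, phi (inn p0 a) = 0,
      forall p, (p <= p0)%O -> v \in limg (eta p p0) \/ forall u, phi (eta p p0 u) = 0
    & forall q, (p0 <= q)%O -> eta p0 q v = 0 \/ forall u, eta p0 q u = 0 -> phi u = 0].
Proof.
pose I := limg (inn p0).
(* The kernels form a chain, and [U] is the smallest one not inside [I]. Hence each later map either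
   kills the vectors of [U] or has its kernel inside [I]. *)
pose US U := (U = lker (out p0) \/ exists2 q, (p0 <= q)%O & U = lker (eta p0 q)) /\
   ~~ (U <= I)%VS.
have [|U [[UU UI] Umin]] := @argmin_nat _ US (fun U => \dim U).
  exists (lker (out p0)); split; first by left.
  by apply/subvPn; exists v0 => //; rewrite memv_ker out0.
have Ucmp q : (p0 <= q)%O -> (U <= lker (eta p0 q))%VS \/ (lker (eta p0 q) <= U)%VS.
  move=> pq; case: UU => [->|[q' pq' ->]].
    right; apply/subvP => u; rewrite !memv_ker -(out_eta u pq) => /eqP ->.
    by rewrite linear0.
  have [qq'|q'q] := orP (le_total q q'); [right|left]; apply/subvP => u; rewrite !memv_ker.
    by rewrite -(etaM u pq qq') => /eqP ->; rewrite linear0.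
  by rewrite -(etaM u pq' q'q) => /eqP ->; rewrite linear0.
have [v vU vI] := subvPn UI.
have ker q : (p0 <= q)%O -> eta p0 q v = 0 \/ (lker (eta p0 q) <= I)%VS.
  move=> pq; have [qI|qI] := boolP (lker (eta p0 q) <= I)%VS; [by right|left].
  apply/eqP; rewrite -memv_ker; have [Uq|qU] := Ucmp q pq; first exact: (subvP Uq).
  have dm := Umin _ (conj (or_intror (ex_intro2 _ _ q pq erefl)) qI).
  by have /eqP -> : lker (eta p0 q) == U; rewrite // eqEdim qU.
have ov : out p0 v = 0.
  apply/eqP; rewrite -memv_ker; case: UU vU => [->//|[q pq ->]].
  by rewrite !memv_ker -(out_eta v pq) => /eqP ->; rewrite linear0.
(* Dually, [W] is the largest member of the chain of images that misses [v], found by minimising the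
   codimension. Every image contains [v] or lies in [W], which [phi] will annihilate. *)
pose WS W := (W = I \/ exists2 p, (p <= p0)%O & W = limg (eta p p0)) /\ v \notin W.
have [|W [[WW vW] Wmax]] := @argmin_nat _ WS (fun W => \dim {:V p0} - \dim W)%N.
  by exists I; split=> //; left.
have I_im p : (p <= p0)%O -> (I <= limg (eta p p0))%VS.
  move=> pp; apply/subvP => _ /memv_imgP[a _ ->].
  by rewrite -(eta_inn a pp) memv_img ?memvf.
have IW : (I <= W)%VS by case: WW => [->//|[p pp ->]]; apply: I_im.
have Wcmp p : (p <= p0)%O -> (W <= limg (eta p p0))%VS \/ (limg (eta p p0) <= W)%VS.
  move=> pp; case: WW => [->|[p' pp' ->]]; first by left; apply: I_im.
  have [qq'|q'q] := orP (le_total p p'); [right|left];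
    apply/subvP => _ /memv_imgP[u _ ->].
    by rewrite -(etaM u qq' pp') memv_img ?memvf.
  by rewrite -(etaM u q'q pp) memv_img ?memvf.
have im p : (p <= p0)%O -> v \in limg (eta p p0) \/ (limg (eta p p0) <= W)%VS.
  move=> pp; have [vp|vp] := boolP (v \in limg (eta p p0)); [by left|right].
  have [Wp|//] := Wcmp p pp.
  have dm := Wmax _ (conj (or_intror (ex_intro2 _ _ p pp erefl)) vp).
  suff /eqP -> : W == limg (eta p p0) by [].
  rewrite eqEdim Wp /=; move: dm; rewrite leq_sub2lE // dimvS //; exact: subvf.
have [phi [phiv phiW]] := separating_functional vW.
exists v, phi; split=> // [a|p pp|q pq].
- by apply: phiW; apply: (subvP IW); rewrite memv_img ?memvf.
- have [vp|pW] := im p pp; [by left|right=> u].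
  by apply: phiW; apply: (subvP pW); rewrite memv_img ?memvf.
- have [vq|qI] := ker q pq; [by left|right=> u /eqP uq].
  by apply: phiW; apply: (subvP IW); apply: (subvP qI); rewrite memv_ker.
Qed.

(** Extend [v] to compatible vectors below [p0] while it lies in the image, and [phi] to compatible
    functionals above [p0] while [v] survives; elsewhere the product is zero. The rank-one maps
    [u |-> fu(u) vec] form the projection onto an interval summand. *)
Lemma elder_idempotent : exists e : forall p, 'End(V p),
  [/\ forall p q u, (p <= q)%O -> e q (eta p q u) = eta p q (e p u),
      forall p u, e p (e p u) = e p u,
      forall p a, e p (inn p a) = 0,
      forall p u, out p (e p u) = 0 &
      exists p u, e p u <> 0].
Proof.
have [v [phi [outv phiv phii phid phiu]]] := elder_vector.
have v_neq0 : v <> 0.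
  by move=> v0E; have := phiv; rewrite v0E linear0 => /esym/eqP; rewrite oner_eq0.
have phi_neq0 : phi <> 0.
  by move=> p0E; have := phiv; rewrite p0E zero_lfunE => /esym/eqP; rewrite oner_eq0.
pose Td := {p : T | (p <= p0)%O && (v \in limg (eta p p0))}.
have [x [xp xx]] : exists x : forall t : Td, V (sval t),
   (forall t, eta (sval t) p0 (x t) = v) /\
   (forall s t : Td, (sval s <= sval t)%O -> eta (sval s) (sval t) (x s) = x t).
  apply: (@linear_limit _ Td (fun s t => (sval s <= sval t)%O) _ _ _ _ v
    (fun s t => eta (sval s) (sval t)) (fun t => eta (sval t) p0)) => //.
  - by move=> s t; apply/orP/le_total.
  - by move=> s t u; apply: le_trans.
  - by move=> s t u w; apply: etaM.
  - by move=> s [t /= /andP[tp _]] w st; apply: etaM.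
  - by move=> [t /= /andP[_ /memv_imgP[w _ ->]]]; exists w.
pose Tu := {q : T | (p0 <= q)%O && (eta p0 q v != 0)}.
have lcompE (q r : T) (W : vectType k) (h : 'Hom(V r, V q)) (ps : 'Hom(V q, W)) :
    linfun (fun ps : 'Hom(V q, W) => (ps \o h)%VF) ps = (ps \o h)%VF.
  have lin : linear (fun ps : 'Hom(V q, W) => (ps \o h)%VF).
    by move=> a u w; rewrite comp_lfunDl comp_lfunZl.
  exact: (lfunE (HB.pack (fun ps : 'Hom(V q, W) => _)
     (GRing.isLinear.Build _ _ _ _ _ lin) : {linear _ -> 'Hom(V r, W)})).
have [f [fp ff]] : exists f : forall t : Tu, 'Hom(V (sval t), k^o),
   (forall t, (f t \o eta p0 (sval t))%VF = phi) /\
   (forall s t : Tu, (sval t <= sval s)%O -> (f s \o eta (sval t) (sval s))%VF = f t).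
  (* The same limit lemma, applied to dual spaces with the order reversed: the transition maps are
     precompositions with [eta]. *)
  pose pre s t := linfun (fun ps : 'Hom(V s, k^o) => (ps \o eta t s)%VF).
  suff [f [fp ff]] : exists f : forall t : Tu, 'Hom(V (sval t), k^o),
     (forall t, pre (sval t) p0 (f t) = phi) /\
     (forall s t : Tu, (sval t <= sval s)%O -> pre (sval s) (sval t) (f s) = f t).
    exists f; split=> [t|s t ts]; first by rewrite -[RHS](fp t) /pre lcompE.
    by rewrite -(ff s t ts) /pre lcompE.
  apply: (@linear_limit _ Tu (fun s t => (sval t <= sval s)%O) _ _ _ _ phi
    (fun s t => pre (sval s) (sval t)) (fun t => pre (sval t) p0)) => //.
  - by move=> s t; apply/orP/le_total.
  - by move=> s t u st tu; apply: le_trans tu st.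
  - by move=> t w; rewrite /pre lcompE; apply/lfunP => u; rewrite comp_lfunE eta1.
  - move=> s t u w st tu; rewrite /pre !lcompE; apply/lfunP => z.
    by rewrite !comp_lfunE etaM.
  - move=> s [t /= /andP[tp _]] w st; rewrite /pre !lcompE; apply/lfunP => z.
    by rewrite !comp_lfunE etaM.
  - move=> [q /= /andP[pq /eqP vq]]; exists (phi \o (eta p0 q)^-1)%VF.
    rewrite /pre lcompE; apply/lfunP => u; rewrite !comp_lfunE.
    have [//|kq] := phiu q pq.
    apply/eqP; rewrite -subr_eq0 -linearB; apply/eqP/kq.
    by rewrite linearB /= limg_lfunVK ?memv_img ?memvf // subrr.
have dec (b : bool) : b \/ ~~ b by case: b; [left|right].
(* The values of [x] need a membership proof as argument, so the vector is specified by clauses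
   rather than by a dependent conditional. *)
have vecP p : exists w : V p, [/\ forall H, w = x (exist _ p H),
     (p <= p0)%O -> v \notin limg (eta p p0) -> w = 0 &
     ~~ (p <= p0)%O -> w = eta p0 p v].
  have [pp|pp] := dec (p <= p0)%O; last first.
    exists (eta p0 p v); split=> [H|H|//]; exfalso; last by rewrite H in pp.
    by have /andP[pp' _] := H; rewrite pp' in pp.
  have [vp|vp] := dec (v \in limg (eta p p0)).
    have H0 : (p <= p0)%O && (v \in limg (eta p p0)) by rewrite pp vp.
    exists (x (exist _ p H0)); split=> [H|_ vp'|pp'].
    - by rewrite (bool_irrelevance H H0).
    - by rewrite vp in vp'.
    - by rewrite pp in pp'.
  exists 0; split=> [H|//|pp']; last by rewrite pp in pp'.
  by exfalso; have /andP[_ vp'] := H; rewrite vp' in vp.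
have funP p : exists h : 'Hom(V p, k^o), [/\ forall H, h = f (exist _ p H),
     ~~ (p <= p0)%O -> eta p0 p v = 0 -> h = 0 &
     (p <= p0)%O -> h = (phi \o eta p p0)%VF].
  have [pp|pp] := dec (p <= p0)%O.
    exists (phi \o eta p p0)%VF; split=> [H|pp'|//]; last by rewrite pp in pp'.
    have /andP[pq _] := H; have E : p = p0 by apply/eqP; rewrite eq_le pp pq.
    subst p; rewrite -(fp (exist _ p0 H)) /=; apply/lfunP => u.
    by rewrite !comp_lfunE !eta1.
  have pq : (p0 <= p)%O by apply: ltW; rewrite ltNge.
  have [vp|vp] := dec (eta p0 p v == 0).
    exists 0; split=> [H|//|pp']; last by rewrite pp' in pp.
    by exfalso; have /andP[_] := H; rewrite vp.
  have H0 : (p0 <= p)%O && (eta p0 p v != 0) by rewrite pq vp.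
  exists (f (exist _ p H0)); split=> [H|_ /eqP vp'|pp'].
  - by rewrite (bool_irrelevance H H0).
  - by rewrite vp' in vp.
  - by rewrite pp' in pp.
pose vec p := sval (cid (vecP p)); pose fu p := sval (cid (funP p)).
have vecH p H : vec p = x (exist _ p H) by rewrite /vec; case: cid => ? [].
have vec0 p : (p <= p0)%O -> v \notin limg (eta p p0) -> vec p = 0.
  by rewrite /vec; case: cid => ? [].
have vecU p : ~~ (p <= p0)%O -> vec p = eta p0 p v by rewrite /vec; case: cid => ? [].
have fuH p H : fu p = f (exist _ p H) by rewrite /fu; case: cid => ? [].
have fu0 p : ~~ (p <= p0)%O -> eta p0 p v = 0 -> fu p = 0.
  by rewrite /fu; case: cid => ? [].
have fuD p : (p <= p0)%O -> fu p = (phi \o eta p p0)%VF by rewrite /fu; case: cid => ? [].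
have ge p : ~~ (p <= p0)%O -> (p0 <= p)%O by move=> pp; apply: ltW; rewrite ltNge.
have vecD p : (p <= p0)%O -> v \in limg (eta p p0) -> eta p p0 (vec p) = v.
  move=> pp vp; have H : (p <= p0)%O && (v \in limg (eta p p0)) by rewrite pp vp.
  by rewrite (vecH p H); apply: (xp (exist _ p H)).
have fuU p u : (p0 <= p)%O -> eta p0 p v != 0 -> fu p (eta p0 p u) = phi u.
  move=> pq vp; have H : (p0 <= p)%O && (eta p0 p v != 0) by rewrite pq vp.
  by rewrite (fuH p H) -(fp (exist _ p H)) comp_lfunE.
have vfu p : vec p = 0 \/ fu p (vec p) = 1.
  have [pp|pp] := boolP (p <= p0)%O.
    have [vp|vp] := boolP (v \in limg (eta p p0)); last by left; apply: vec0.
    by right; rewrite fuD // comp_lfunE vecD.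
  rewrite vecU //; have [vp|vp] := eqVneq (eta p0 p v) 0; [by left|right].
  by rewrite fuU // ge.
have scE p (h : 'Hom(V p, k^o)) (w : V p) u :
    linfun (fun u => (h u : k) *: w) u = (h u : k) *: w.
  have lin : linear (fun u => (h u : k) *: w).
    by move=> a u' u''; rewrite linearD linearZ /= scalerDl scalerA.
  exact: (lfunE (HB.pack (fun u : V p => _)
     (GRing.isLinear.Build _ _ _ _ _ lin) : {linear _ -> _})).
pose e p : 'End(V p) := linfun (fun u => (fu p u : k) *: vec p).
have eE p u : e p u = (fu p u : k) *: vec p by apply: scE.
have dead p : (p <= p0)%O -> vec p = 0 \/ v \in limg (eta p p0).
  move=> pp; have [vp|vp] := boolP (v \in limg (eta p p0)); [by right|left].
  exact: vec0.
exists e; split=> [p q u pq|p u|p a|p u|].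
(* The cases are [q <= p0], [p <= p0 < q] and [p0 < p]. Where [v] has no preimage below [p0], [phid]
   kills the functional; where [v] has died above [p0], both sides are zero. *)
- rewrite !eE linearZ /=; have [qp|qp] := boolP (q <= p0)%O.
    have pp := le_trans pq qp.
    rewrite !fuD // !comp_lfunE etaM //.
    have [vp|vp] := boolP (v \in limg (eta p p0)); last first.
      by have [vp'|->] := phid p pp; [rewrite vp' in vp | rewrite !scale0r].
    have vq : v \in limg (eta q p0).
      case/memv_imgP: vp => w _ ->.
      by rewrite -(etaM w pq qp) memv_img ?memvf.
    have Hp : (p <= p0)%O && (v \in limg (eta p p0)) by rewrite pp vp.
    have Hq : (q <= p0)%O && (v \in limg (eta q p0)) by rewrite qp vq.
    rewrite (vecH p Hp) (vecH q Hq).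
    by congr (_ *: _); have := xx (exist _ p Hp) (exist _ q Hq) pq => /= ->.
  have [pp|pp] := boolP (p <= p0)%O.
    rewrite (fuD p) // vecU // comp_lfunE.
    have pq0 := ge q qp.
    have [vq|vq] := eqVneq (eta p0 q v) 0.
      rewrite vq scaler0; have [->|vp] := dead p pp; first by rewrite linear0 scaler0.
      by rewrite -(etaM _ pp pq0) vecD // vq scaler0.
    rewrite -(etaM u pp pq0) fuU //.
    have [vp|vp] := boolP (v \in limg (eta p p0)); last first.
      by have [vp'|->] := phid p pp; [rewrite vp' in vp | rewrite !scale0r].
    by rewrite -(etaM _ pp pq0) vecD.
  rewrite !vecU // etaM ?ge //.
  have [->|vq] := eqVneq (eta p0 q v) 0; first by rewrite !scaler0.
  have vp : eta p0 p v != 0.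
    by apply: contraNneq vq => vp; rewrite -(etaM v (ge p pp) pq) vp linear0.
  have Hp : (p0 <= p)%O && (eta p0 p v != 0) by rewrite ge.
  have Hq : (p0 <= q)%O && (eta p0 q v != 0) by rewrite ge.
  rewrite (fuH p Hp) (fuH q Hq); congr (_ *: _).
  by rewrite -(ff (exist _ q Hq) (exist _ p Hp) pq) comp_lfunE.
- rewrite !eE linearZ /=; have [->|->] := vfu p; first by rewrite !scaler0.
  by rewrite [_ *: 1]mulr1.
- rewrite eE; have [pp|pp] := boolP (p <= p0)%O.
    by rewrite fuD // comp_lfunE eta_inn // phii scale0r.
  have [vp|vp] := eqVneq (eta p0 p v) 0; first by rewrite fu0 // zero_lfunE scale0r.
  by rewrite -(eta_inn a (ge p pp)) fuU ?ge // phii scale0r.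
- rewrite eE linearZ /=; have [pp|pp] := boolP (p <= p0)%O.
    have [->|vp] := dead p pp; first by rewrite linear0 scaler0.
    by rewrite -(out_eta (vec p) pp) vecD // outv scaler0.
  by rewrite vecU // out_eta ?ge // outv scaler0.
- exists p0, v; have vp : v \in limg (eta p0 p0) by rewrite -(eta1 v) memv_img ?memvf.
  rewrite eE fuD // comp_lfunE eta1 phiv scale1r.
  by rewrite -(eta1 (vec p0)) vecD.
Qed.

End ElderRule.

(** * Restriction to a thread *)


(** A vector killed by [f] dies in [B], hence comes from [A], where equal ranks force
    [lker i = lker j]. Dually [limg o = limg o'], so any [w] agrees with some [f u] up to [lker o'],
    which lies in the image of [f i = j]. *)
Lemma bijective_of_ranks (k : fieldType) (A B V W : vectType k)
    (i : 'Hom(A, V)) (j : 'Hom(A, W)) (o : 'Hom(V, B)) (o' : 'Hom(W, B))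
    (f : 'Hom(V, W)) :
  (forall a, f (i a) = j a) -> (forall v, o' (f v) = o v) ->
  (lker o <= limg i)%VS -> (lker o' <= limg j)%VS ->
  \dim (limg i) = \dim (limg j) -> \dim (limg o) = \dim (limg o') ->
  lker f == 0%VS /\ limg f = fullv.
Proof.
move=> fi of' oi oj dij doo; split.
  rewrite -subv0; apply/subvP => v; rewrite memv_ker memv0 => /eqP fv.
  have /(subvP oi)/memv_imgP[a _ va] : v \in lker o by rewrite memv_ker -of' fv linear0.
  have kij : lker i = lker j.
    apply/eqP; rewrite eqEdim; apply/andP; split.
      by apply/subvP => b; rewrite !memv_ker -fi => /eqP ->; rewrite linear0.
    have := limg_ker_dim i fullv; rewrite -(limg_ker_dim j fullv) !capfv dij.
    by move/addIn ->.
  by rewrite va -memv_ker kij memv_ker -fi -va fv.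
apply/eqP; rewrite eqEsubv subvf; apply/subvP => w _.
have oo : (limg o <= limg o')%VS.
  by apply/subvP => _ /memv_imgP[v _ ->]; rewrite -of' memv_img ?memvf.
have : o' w \in limg o.
  by have /eqP -> : limg o == limg o'; rewrite ?eqEdim ?oo ?doo ?memv_img ?memvf /=.
move=> /memv_imgP[u _ wu].
have /(subvP oj)/memv_imgP[a _ wa] : w - f u \in lker o'.
  by rewrite memv_ker linearB /= of' wu subrr.
by rewrite -(subrK (f u) w) wa -fi -linearD memv_img ?memvf.
Qed.

Section PathReps.
Variables (k : fieldType) (Q : thread_quiver) (I : ideal (path_cat k Q)).
Local Notation C := (path_cat k Q).
Implicit Type S : rep (quot_cat I).

Definition cmap S (x y : tobj Q) (f : path_hom k x y) : 'Hom(S x, S y) :=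
  rep_map S (fmap (quot_fun I) (f : @hom k C x y)).

Lemma cmapM S (x y z : tobj Q) (g : path_hom k y z) (f : path_hom k x y) v :
  cmap S (path_comp g f) v = cmap S g (cmap S f v).
Proof.
rewrite /cmap -rep_mapM -(fmapM (quot_fun I) (g : @hom k C y z) f).
by [].
Qed.

Lemma cmap_lin S (x y : tobj Q) : linear (@cmap S x y).
Proof. by move=> a f g; rewrite /cmap fmap_lin rep_map_lin. Qed.

Lemma cmap1 S (x : tobj Q) v : cmap S (pl k (plike_id x)) v = v.
Proof.
have := @rep_map1 k (quot_cat I) S x v.
by rewrite -(fmap1 (quot_fun I) x).
Qed.

Lemma cmap0 S (x y : tobj Q) : cmap S (0 : path_hom k x y) = 0.
Proof.
have := cmap_lin S (-1) (0 : path_hom k x y) 0.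
by rewrite scaler0 addr0 scaleN1r addNr.
Qed.

Lemma cmap_qpi S (x y : tobj Q) (f g : path_hom k x y) :
  qpi (I x y) f = qpi (I x y) g -> cmap S f = cmap S g.
Proof. by rewrite /cmap /= => ->. Qed.

Lemma cmap_ideal S (x y : tobj Q) (f : path_hom k x y) :
  f \in I x y -> cmap S f = 0.
Proof.
by move=> fI; rewrite -(cmap0 S x y); apply/cmap_qpi/qpi_eq; rewrite subr0.
Qed.

Definition plmap S (x y : tobj Q) (f : plike x y) := cmap S (pl k f).

Lemma plmapM S (x y z : tobj Q) (f : plike x y) (g : plike y z) v :
  plmap S (plike_mul f g) v = plmap S g (plmap S f v).
Proof. by rewrite /plmap -path_compU cmapM. Qed.

(** Path-like elements span the morphism spaces, so linearity reduces naturality to them. *)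
Lemma natural_plmap S S' (e : forall x : quot_cat I, 'Hom(S x, S' x)) :
  (forall x y (f : plike x y) v, e y (plmap S f v) = plmap S' f (e x v)) -> natural e.
Proof.
move=> ne x y h v.
have E (f : path_hom k x y) : (e y \o cmap S f = cmap S' f \o e x)%VF.
  move: f; apply: malg_lin_ext => [a f g|a f g|t].
  - by rewrite cmap_lin comp_lfunDr -comp_lfunZr.
  - by rewrite cmap_lin comp_lfunDl -comp_lfunZl.
  - by apply/lfunP => w; rewrite !comp_lfunE; apply: ne.
have /lfunP/(_ v) := E (qrepr h); rewrite !comp_lfunE.
have -> : cmap S (qrepr h) = rep_map S h by rewrite /cmap /= qreprK.
by have -> : cmap S' (qrepr h) = rep_map S' h by rewrite /cmap /= qreprK.
Qed.

Section Thread.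
Variable S : rep (quot_cat I).

Definition thr_in (a : arrow Q) (p : thread a) : 'Hom(S (Vtx (src a)), S (Thr a p)) :=
  plmap S (@PLong Q (Vtx (src a)) (Thr a p) (PNil (src a))).
Definition thr_out (a : arrow Q) (p : thread a) : 'Hom(S (Thr a p), S (Vtx (tgt a))) :=
  plmap S (@PLong Q (Thr a p) (Vtx (tgt a)) (PNil (tgt a))).
(** Total in [p] and [q], with default 0 when [p <= q] fails, as the elder rule takes a map for
    every pair. *)
Definition thr_eta (a : arrow Q) (p q : thread a) : 'Hom(S (Thr a p), S (Thr a q)) :=
  if (p <= q)%O =P true is ReflectT pq then plmap S (PShort pq) else 0.

Lemma thr_etaE (a : arrow Q) (p q : thread a) (pq : (p <= q)%O) :
  thr_eta p q = plmap S (PShort pq).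
Proof.
rewrite /thr_eta; case: eqP => // pq'.
by rewrite (bool_irrelevance pq' pq).
Qed.

Lemma thr_eta1 (a : arrow Q) (p : thread a) v : thr_eta p p v = v.
Proof. by rewrite (thr_etaE (lexx p)); apply: cmap1. Qed.

Lemma thr_etaM (a : arrow Q) (p q r : thread a) v : (p <= q)%O -> (q <= r)%O ->
  thr_eta q r (thr_eta p q v) = thr_eta p r v.
Proof.
move=> pq qr; rewrite (thr_etaE pq) (thr_etaE qr) (thr_etaE (le_trans pq qr)).
by rewrite -plmapM.
Qed.

Lemma thr_eta_in (a : arrow Q) (p q : thread a) v : (p <= q)%O ->
  thr_eta p q (thr_in p v) = thr_in q v.
Proof. by move=> pq; rewrite (thr_etaE pq) -plmapM. Qed.

Lemma thr_out_eta (a : arrow Q) (p q : thread a) v : (p <= q)%O ->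
  thr_out q (thr_eta p q v) = thr_out p v.
Proof. by move=> pq; rewrite (thr_etaE pq) -plmapM. Qed.

Lemma plong_out (a : arrow Q) (p : thread a) y (w : qpath (tgt a) (entry_vtx y)) v :
  plmap S (@PLong Q (Thr a p) y w) v =
  plmap S (@PLong Q (Vtx (tgt a)) y w) (thr_out p v).
Proof. by rewrite -plmapM. Qed.

Lemma plong_in (a : arrow Q) (p : thread a) x (w : qpath (exit_vtx x) (src a)) v :
  plmap S (@PLong Q x (Thr a p) w) v =
  thr_in p (plmap S (@PLong Q x (Vtx (src a)) w) v).
Proof. by rewrite -plmapM /= pcatp0. Qed.

(* Every morphism entering or leaving the thread passes through its source or target,
   so an endomorphism of the thread that vanishes on [thr_in] and is killed by
   [thr_out] extends by zero to an endomorphism of S. *)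
Lemma thread_kernel_in_image (a : arrow Q) (p : thread a) :
  indecomposable S -> ~ noise S -> (lker (thr_out p) <= limg (thr_in p))%VS.
Proof.
move=> iS nS; apply: contrapT => /negP/subvPn[v0 v0K v0I].
(* Idempotents are chosen on all threads at once, possibly zero, so that [E] can be defined without
   comparing a thread's arrow with [a]. *)
have ex (b : arrow Q) : exists e : forall q : thread b, 'End(S (Thr b q)),
  [/\ forall q r u, (q <= r)%O -> e r (thr_eta q r u) = thr_eta q r (e q u),
      forall q u, e q (e q u) = e q u,
      forall q c, e q (thr_in q c) = 0,
      forall q u, thr_out q (e q u) = 0 &
      (exists q, ~~ (lker (@thr_out b q) <= limg (thr_in q))%VS) ->
      exists q u, e q u <> 0].
  have [[q /subvPn[v vK vI]]|nb] :=
      pselect (exists q, ~~ (lker (@thr_out b q) <= limg (thr_in q))%VS).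
    have vK' : thr_out q v = 0 by apply/eqP; rewrite -memv_ker.
    have [e [? ? ? ? ?]] := @elder_idempotent k _ (thread b) (fun q => S (Thr b q)) _ _
      (@thr_eta b) (@thr_in b) (@thr_out b) (@thr_eta1 b) (@thr_etaM b) (@thr_eta_in b)
      (@thr_out_eta b) q v vK' vI.
    by exists e; split.
  by exists (fun=> 0); split=> // *; rewrite ?zero_lfunE ?linear0.
pose e b := sval (cid (ex b)).
have eP b := svalP (cid (ex b)).
pose E (x : tobj Q) : 'End(S x) := if x is Thr b q then e b q else 0.
have nE : natural (E : forall x : quot_cat I, 'End(S x)).
  apply: natural_plmap => x y f v; case: f v => {x y} [b q r qr|x y w] v.
    by have [h _ _ _ _] := eP b; rewrite /= -(thr_etaE qr); apply: h.
  transitivity (0 : S y).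
    case: y w => [u|b q] w; first by rewrite /= zero_lfunE.
    by have [_ _ h _ _] := eP b; rewrite plong_in; apply: h.
  case: x w v => [u|b q] w v; first by rewrite /= zero_lfunE linear0.
  by have [_ _ _ h _] := eP b; rewrite plong_out [thr_out _ _]h linear0.
have EE : idempotent_family (E : forall x : quot_cat I, 'End(S x)).
  move=> [u|b q] v; first by rewrite /= !zero_lfunE.
  by have [_ h _ _ _] := eP b; apply: h.
(* [E] is nonzero on the thread of [a], so it would have to be the identity; as it vanishes at
   vertices, [S] would be noise. *)
have [E0|E1] := indecomposable_idem iS nE EE.
  have [_ _ _ _ [|q [u eu]]] := eP a; last by apply: eu; exact: (E0 (Thr a q) u).
  by exists p; apply/subvPn; exists v0.
apply: nS; apply/seteqP; split=> // x [xS [u _ ux]]; move: xS.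
rewrite -ux /supp /= => /eqP; apply.
apply/vspaceP => v; rewrite -(E1 (Vtx u) v) /= zero_lfunE.
by rewrite !mem0v.
Qed.

Definition thr_key (a : arrow Q) (p : thread a) :=
  (\dim (limg (thr_in p)), \dim (limg (thr_out p))).

Lemma thr_key_in (a : arrow Q) (p q : thread a) : (p <= q)%O ->
  ((thr_key q).1 <= (thr_key p).1)%N.
Proof.
move=> pq /=; have -> : limg (thr_in q) = (thr_eta p q @: limg (thr_in p))%VS.
  rewrite -limg_comp; congr (lfun_img _ fullv); apply/lfunP => v.
  by rewrite comp_lfunE thr_eta_in.
by rewrite -(limg_ker_dim (thr_eta p q)) leq_addl.
Qed.

Lemma thr_key_out (a : arrow Q) (p q : thread a) : (p <= q)%O ->
  ((thr_key p).2 <= (thr_key q).2)%N.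
Proof.
move=> pq /=; apply/dimvS/subvP => _ /memv_imgP[v _ ->].
by rewrite -(thr_out_eta v pq) memv_img ?memvf.
Qed.

Lemma thr_eta_bij (a : arrow Q) (p q : thread a) :
  indecomposable S -> ~ noise S -> (p <= q)%O -> thr_key p = thr_key q ->
  lker (thr_eta p q) == 0%VS /\ limg (thr_eta p q) = fullv.
Proof.
move=> iS nS pq [k1 k2].
apply: (@bijective_of_ranks _ _ _ _ _ (thr_in p) (thr_in q) (thr_out p) (thr_out q)) => //.
- by move=> v; apply: thr_eta_in.
- by move=> v; apply: thr_out_eta.
- exact: thread_kernel_in_image.
- exact: thread_kernel_in_image.
Qed.

End Thread.
End PathReps.

(** * Collapsing the threads *)


Lemma existT_inj (T : Type) (P : T -> Type) x (a b : P x) :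
  existT P x a = existT P x b -> a = b.
Proof.
move=> E; have := projT2_eq E.
by rewrite (Prop_irrelevance (projT1_eq E) erefl).
Qed.

Section Collapse.
Variables (k : fieldType) (Q : thread_quiver).
Local Notation C := (path_cat k Q).
Variable sigma : forall a : arrow Q, thread a -> thread a.
Hypothesis sigma_le : forall a (p q : thread a),
  (p <= q)%O -> (sigma p <= sigma q)%O.
Hypothesis sigma_idem : forall a (p : thread a), sigma (sigma p) = sigma p.
Hypothesis sigma_fin : forall a, finite_set (range (@sigma a)).

(** [sigma] encodes a partition and a sample together: the cells in a thread are its fibres,
    intervals by monotonicity, and the sample points are its fixed points. *)
Definition collapse (x : tobj Q) : tobj Q :=
  match x with Vtx v => Vtx v | Thr a p => Thr a (sigma p) end.

Lemma collapse_idem x : collapse (collapse x) = collapse x.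
Proof. by case: x => //= a p; rewrite sigma_idem. Qed.

Lemma Thr_inj (a : arrow Q) : injective (Thr a).
Proof.
move=> p q E; apply: (@existT_inj _ (fun b => thread b)).
exact: (congr1 (fun x => match x with
   Vtx _ => existT (fun b => thread b) a p
 | Thr b r => existT (fun b => thread b) b r end) E).
Qed.

Definition collapse_cell (x : tobj Q) := [set y : tobj Q | collapse y = collapse x].

Lemma collapse_partition :
  partition (range collapse_cell) (fun X => X) [set: tobj Q].
Proof.
split.
- apply/seteqP; split=> [//|x _]; exists (collapse_cell x) => //.
- move=> _ _ [x _ <-] [y _ <-] [z [/= zx zy]].
  by rewrite /collapse_cell -zx -zy.
- by move=> _ [x _ <-]; exists x.
Qed.

Lemma collapse_cell_vtx v : range collapse_cell [set Vtx v].
Proof.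
exists (Vtx v) => //; apply/seteqP; split=> [[u|a p] //= [->]//|_ ->//].
Qed.

Lemma collapse_cell_thr a : exists F : set (set (thread a)),
    [/\ finite_set F, \bigcup_(J in F) J = [set: thread a] &
        forall J, F J -> thr_interval J /\
          range collapse_cell [set Thr a p | p in J]].
Proof.
exists [set [set q | sigma q = c] | c in range (@sigma a)]; split.
- exact: finite_image.
- apply/seteqP; split=> [//|p _]; exists [set q | sigma q = sigma p] => //.
  by exists (sigma p) => //; exists p.
- move=> _ [_ [p _ <-] <-]; split.
    split; first by exists p.
    move=> x y z /= xp yp xz zy; apply/eqP; rewrite eq_le.
    by rewrite -{1}yp -xp !sigma_le ?ltW //.
  exists (Thr a p) => //; apply/seteqP; split.
    move=> y /=; case: y => [u //|b q] /= E; case: (E) => ba; subst b.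
    by move=> _; exists q => //; apply: Thr_inj.
  by move=> _ [q /= qp <-] /=; rewrite /collapse_cell /= qp.
Qed.

Definition collapse_vp : valid_partition Q :=
  ValidPartition collapse_partition collapse_cell_vtx collapse_cell_thr.

Lemma same_cellE x y : same_cell collapse_vp x y <-> collapse x = collapse y.
Proof.
split=> [[_ [[z _ <-]]] /= xz yz|xy]; first by rewrite xz yz.
by exists (collapse_cell y); split=> //; exists y.
Qed.

(** In the [PLong] case the path is unchanged; the matches on [x] and [y] only let the types of its
    endpoints reduce. *)
Definition collapse_plike x y (f : plike x y) : plike (collapse x) (collapse y) :=
  match f in plike x y return plike (collapse x) (collapse y) with
  | PShort a p q pq => PShort (sigma_le pq)
  | PLong x y w =>
      match x, y return qpath (exit_vtx x) (entry_vtx y) ->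
        plike (collapse x) (collapse y) with
      | Vtx u, Vtx v => fun w => @PLong Q (Vtx u) (Vtx v) w
      | Vtx u, Thr a p => fun w => @PLong Q (Vtx u) (Thr a (sigma p)) w
      | Thr a p, Vtx v => fun w => @PLong Q (Thr a (sigma p)) (Vtx v) w
      | Thr a p, Thr b q => fun w => @PLong Q (Thr a (sigma p)) (Thr b (sigma q)) w
      end w
  end.

Lemma collapse_plike1 x : collapse_plike (plike_id x) = plike_id (collapse x).
Proof. by case: x => //= a p; congr PShort; apply: bool_irrelevance. Qed.

Lemma collapse_plikeM x y z (f : plike x y) (g : plike y z) :
  collapse_plike (plike_mul f g) = plike_mul (collapse_plike f) (collapse_plike g).
Proof.
case: f g => [a p q pq|{}x {}y u] g.
  move: z g; apply: plike_ThrP => [r qr|z w] /=.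
    by congr PShort; apply: bool_irrelevance.
  by case: z w.
case: g u => [a p q pq|{}y {}z w] u /=; first by case: x u.
by case: x y z u w => [?|? ?] [?|? ?] [?|? ?].
Qed.

Definition collapse_map x y (f : path_hom k x y) :
    path_hom k (collapse x) (collapse y) :=
  mlift (fun t : {classic plike x y} => pl k (collapse_plike t)) f.

Lemma collapse_map_lin x y : linear (@collapse_map x y).
Proof. exact: mlift_lin. Qed.

Lemma collapse_mapU x y (t : plike x y) :
  collapse_map (pl k t) = pl k (collapse_plike t).
Proof. exact: mliftU. Qed.

Lemma collapse_mapM x y z (g : path_hom k y z) (f : path_hom k x y) :
  collapse_map (path_comp g f) = path_comp (collapse_map g) (collapse_map f).
Proof.
move: g; apply: malg_lin_ext => [a g g'|a g g'|t].
- by rewrite path_comp_linl collapse_map_lin.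
- by rewrite collapse_map_lin path_comp_linl.
move: f; apply: malg_lin_ext => [a f f'|a f f'|u].
- by rewrite path_comp_linr collapse_map_lin.
- by rewrite collapse_map_lin path_comp_linr.
by rewrite path_compU !collapse_mapU path_compU collapse_plikeM.
Qed.

Lemma collapse_map1 (x : tobj Q) :
  collapse_map (pl k (plike_id x)) = pl k (plike_id (collapse x)).
Proof. by rewrite collapse_mapU collapse_plike1. Qed.

(* Equality of tagged morphisms is equality up to the propositional equations
   [collapse x1 = collapse x2] between their endpoints. *)
Definition tagged_hom x y (f : path_hom k x y) :=
  existT (fun xy : tobj Q * tobj Q => path_hom k xy.1 xy.2 : Type) (x, y) f.

Lemma tagged_short_l (a : arrow Q) (p q : thread a) (pq : (p <= q)%O) x
    (g : path_hom k x (Thr a p)) :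
  p = q -> tagged_hom (path_comp (pl k (PShort pq)) g) = tagged_hom g.
Proof.
move=> E; subst q; rewrite (bool_irrelevance pq (lexx p)).
by rewrite -[RHS](congr1 (@tagged_hom _ _) (comp1m (g : @hom k C x (Thr a p)))).
Qed.

Lemma tagged_short_r (a : arrow Q) (p q : thread a) (pq : (p <= q)%O) y
    (g : path_hom k (Thr a q) y) :
  p = q -> tagged_hom (path_comp g (pl k (PShort pq))) = tagged_hom g.
Proof.
move=> E; subst q; rewrite (bool_irrelevance pq (lexx p)).
by rewrite -[RHS](congr1 (@tagged_hom _ _) (compm1 (g : @hom k C (Thr a p) y))).
Qed.

Lemma tagged_collapse_l (y w : C) (h : @hom k C y w) :
  is_eta collapse_vp h -> forall x (g : path_hom k x (collapse y)),
  tagged_hom (path_comp (collapse_map h) g) = tagged_hom g.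
Proof.
case=> [v|a p q pq /same_cellE/Thr_inj E] x g.
  rewrite [collapse_map _]collapse_map1.
  by rewrite -[RHS](congr1 (@tagged_hom _ _) (comp1m (g : @hom k C x (Vtx v)))).
by rewrite collapse_mapU /= tagged_short_l.
Qed.

Lemma tagged_collapse_r (z x : C) (h : @hom k C z x) :
  is_eta collapse_vp h -> forall y (g : path_hom k (collapse x) y),
  tagged_hom (path_comp g (collapse_map h)) = tagged_hom g.
Proof.
case=> [v|a p q pq /same_cellE/Thr_inj E] y g.
  rewrite [collapse_map _]collapse_map1.
  by rewrite -[RHS](congr1 (@tagged_hom _ _) (compm1 (g : @hom k C (Vtx v) y))).
by rewrite collapse_mapU /= tagged_short_r.
Qed.

(** The maps [eta] inside a cell collapse to identities, so the equation that witnesses equivalence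
    becomes an equality of collapses. *)
Lemma pequiv_tagged (x1 y1 x2 y2 : C) (f1 : @hom k C x1 y1)
    (f2 : @hom k C x2 y2) :
  pequiv collapse_vp f1 f2 ->
  tagged_hom (collapse_map f1) = tagged_hom (collapse_map f2).
Proof.
move=> [_ _ [z [w [u1 [u2 [v1 [v2 [eu1 eu2 ev1 ev2 E]]]]]]]].
have := congr1 (fun f => tagged_hom (@collapse_map z w f)) E.
rewrite /= !collapse_mapM.
by rewrite (tagged_collapse_l ev1) (tagged_collapse_l ev2) (tagged_collapse_r eu1)
   (tagged_collapse_r eu2).
Qed.

(** [p] and [sigma p] may come in either order; their minimum and maximum stay in the same cell and
    supply the outer objects of an equivalence. *)
Definition lower_pt (x : tobj Q) : tobj Q :=
  match x with Vtx v => Vtx v | Thr a p => Thr a (Order.min p (sigma p)) end.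
Definition upper_pt (x : tobj Q) : tobj Q :=
  match x with Vtx v => Vtx v | Thr a p => Thr a (Order.max p (sigma p)) end.

Lemma min_le_l (a : arrow Q) (p : thread a) : (Order.min p (sigma p) <= p)%O.
Proof. by rewrite ge_min lexx. Qed.
Lemma min_le_r (a : arrow Q) (p : thread a) : (Order.min p (sigma p) <= sigma p)%O.
Proof. by rewrite ge_min lexx orbT. Qed.
Lemma max_ge_l (a : arrow Q) (p : thread a) : (p <= Order.max p (sigma p))%O.
Proof. by rewrite le_max lexx. Qed.
Lemma max_ge_r (a : arrow Q) (p : thread a) : (sigma p <= Order.max p (sigma p))%O.
Proof. by rewrite le_max lexx orbT. Qed.

Definition lower_in x : plike (lower_pt x) x :=
  match x with Vtx v => plike_id (Vtx v) | Thr a p => PShort (min_le_l p) end.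
Definition lower_out x : plike (lower_pt x) (collapse x) :=
  match x with Vtx v => plike_id (Vtx v) | Thr a p => PShort (min_le_r p) end.
Definition upper_in x : plike x (upper_pt x) :=
  match x with Vtx v => plike_id (Vtx v) | Thr a p => PShort (max_ge_l p) end.
Definition upper_out x : plike (collapse x) (upper_pt x) :=
  match x with Vtx v => plike_id (Vtx v) | Thr a p => PShort (max_ge_r p) end.

Lemma lower_upper x :
  plike_mul (lower_in x) (upper_in x) = plike_mul (lower_out x) (upper_out x).
Proof. by case: x => //= a p; congr PShort; apply: bool_irrelevance. Qed.

Lemma collapse_square x y (f : path_hom k x y) :
  path_comp (pl k (upper_in y)) (path_comp f (pl k (lower_in x))) =
  path_comp (pl k (upper_out y)) (path_comp (collapse_map f) (pl k (lower_out x))).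
Proof.
move: f; apply: malg_lin_ext => [a f f'|a f f'|t].
- by rewrite path_comp_linl path_comp_linr.
- by rewrite collapse_map_lin path_comp_linl path_comp_linr.
rewrite -/(pl k _) collapse_mapU !path_compU; congr (pl k _).
case: t => {x y} [a p q pq|x y w] /=.
  by congr PShort; apply: bool_irrelevance.
by case: x y w => [?|? ?] [?|? ?] w //=; rewrite !pcatp0.
Qed.

Lemma sigma_min (a : arrow Q) (p : thread a) : sigma (Order.min p (sigma p)) = sigma p.
Proof. by rewrite minEle; case: ifP. Qed.
Lemma sigma_max (a : arrow Q) (p : thread a) : sigma (Order.max p (sigma p)) = sigma p.
Proof. by rewrite maxEle; case: ifP. Qed.

Lemma lower_in_eta x :
  is_eta collapse_vp (pl k (lower_in x) : @hom k C (lower_pt x) x).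
Proof.
case: x => [v|a p]; first exact: EtaVtx.
by apply: EtaThr; apply/same_cellE; rewrite /= sigma_min.
Qed.
Lemma lower_out_eta x :
  is_eta collapse_vp (pl k (lower_out x) : @hom k C (lower_pt x) (collapse x)).
Proof.
case: x => [v|a p]; first exact: EtaVtx.
by apply: EtaThr; apply/same_cellE; rewrite /= sigma_min sigma_idem.
Qed.
Lemma upper_in_eta x :
  is_eta collapse_vp (pl k (upper_in x) : @hom k C x (upper_pt x)).
Proof.
case: x => [v|a p]; first exact: EtaVtx.
by apply: EtaThr; apply/same_cellE; rewrite /= sigma_max.
Qed.
Lemma upper_out_eta x :
  is_eta collapse_vp (pl k (upper_out x) : @hom k C (collapse x) (upper_pt x)).
Proof.
case: x => [v|a p]; first exact: EtaVtx.
by apply: EtaThr; apply/same_cellE; rewrite /= sigma_max sigma_idem.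
Qed.

(** Existence of a representative between sample points; its uniqueness follows from [pequiv_tagged]
    and [tagged_collapse_fix]. *)
Lemma pequiv_collapse x y (f : path_hom k x y) :
  pequiv collapse_vp (f : @hom k C x y)
    (collapse_map f : @hom k C (collapse x) (collapse y)).
Proof.
split; try by apply/same_cellE; rewrite collapse_idem.
exists (lower_pt x), (upper_pt y), (pl k (lower_in x)), (pl k (lower_out x)),
  (pl k (upper_in y)), (pl k (upper_out y)).
split; try exact: collapse_square.
- exact: lower_in_eta.
- exact: lower_out_eta.
- exact: upper_in_eta.
- exact: upper_out_eta.
Qed.

Lemma pequiv_sym (x1 y1 x2 y2 : C) (f1 : @hom k C x1 y1)
    (f2 : @hom k C x2 y2) :
  pequiv collapse_vp f1 f2 -> pequiv collapse_vp f2 f1.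
Proof.
move=> [/same_cellE xx /same_cellE yy [z [w [u1 [u2 [v1 [v2 [eu1 eu2 ev1 ev2 E]]]]]]]].
by split; [apply/same_cellE | apply/same_cellE | exists z, w, u2, u1, v2, v1; split].
Qed.

Lemma tagged_collapse_fix x y (f : path_hom k x y) :
  collapse x = x -> collapse y = y -> tagged_hom (collapse_map f) = tagged_hom f.
Proof.
move=> cx cy.
(* The endpoints agree only propositionally, so the collapse is transported back before linear
   extension from path-like elements can apply. *)
pose cast : path_hom k (collapse x) (collapse y) -> path_hom k x y :=
  fun g => eq_rect _ (fun y => path_hom k x y)
     (eq_rect _ (fun x => path_hom k x (collapse y)) g _ cx) _ cy.
have castT g : tagged_hom (cast g) = tagged_hom g.
  rewrite /cast; move: g; clear cast.
  move: (collapse_map f) => _; move: (collapse x) (collapse y) cx cy => x' y' cx cy.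
  by subst x' y'.
have cast_lin : linear cast.
  rewrite /cast; clear cast castT.
  move: (collapse_map f) => _; move: (collapse x) (collapse y) cx cy => x' y' cx cy.
  by subst x' y'.
suff E : cast (collapse_map f) = f by rewrite -castT E.
move: f; apply: malg_lin_ext => [a f g|//|t].
  by rewrite collapse_map_lin cast_lin.
apply: (@existT_inj _ (fun xy : tobj Q * tobj Q => path_hom k xy.1 xy.2 : Type) (x, y)).
rewrite -/(tagged_hom _) castT -/(pl k _) collapse_mapU.
case: t cx cy {cast castT cast_lin} => {x y} [a p q pq /Thr_inj cp /Thr_inj cq|x y w].
  rewrite /=; move: (sigma_le pq); rewrite cp cq => pq'.
  by rewrite (bool_irrelevance pq' pq).
case: x w => [u|a p]; case: y => [v|b q] //= w.
- by move=> _ /Thr_inj ->.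
- by move=> /Thr_inj -> _.
- by move=> /Thr_inj -> /Thr_inj ->.
Qed.

End Collapse.

(** * Induction from a subthreading *)


Section ZeroIdeal.
Variables (k : fieldType) (D : lincat k).

Definition zero_pred (x y : D) : pred (hom x y) := fun f => f == 0.

Lemma zero_submod_closed (x y : D) : submod_closed (@zero_pred x y).
Proof.
split=> [|a f g]; first exact: eqxx.
by move=> /eqP -> /eqP ->; apply/eqP; rewrite scaler0 addr0.
Qed.

Definition zero_submod (x y : D) : submodClosed (hom x y) :=
  HB.pack (@zero_pred x y)
    (GRing.isSubmodClosed.Build k (hom x y) (@zero_pred x y)
      (@zero_submod_closed x y)).

Lemma comp0l (x y z : D) (f : hom x y) : comp (0 : hom y z) f = 0.
Proof.
have := comp_linl f (-1) (0 : hom y z) 0.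
by rewrite /= scaler0 addr0 scaleN1r addNr.
Qed.

Lemma comp0r (x y z : D) (g : hom y z) : comp g (0 : hom x y) = 0.
Proof.
have := comp_linr g (-1) (0 : hom x y) 0.
by rewrite /= scaler0 addr0 scaleN1r addNr.
Qed.

Definition zero_ideal : ideal D.
Proof.
refine (@Ideal k D zero_submod _ _) => x y z g f /eqP ->; apply/eqP.
  exact: comp0r.
exact: comp0l.
Defined.

End ZeroIdeal.

Section Preimage.
Variables (k : fieldType) (C D : lincat k) (F : lfunctor C D) (J : ideal D).

Definition preimage_pred (x y : C) : pred (hom x y) :=
  fun f => fmap F f \in J (F x) (F y).

Lemma preimage_closed x y : submod_closed (@preimage_pred x y).
Proof.
split=> [|a f g fJ gJ]; rewrite /in_mem /= /preimage_pred.
  have := fmap_lin F (-1) (0 : hom x y) 0.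
  by rewrite scaler0 addr0 scaleN1r addNr => ->; apply: rpred0.
by rewrite fmap_lin; apply: rpredD => //; apply: rpredZ.
Qed.

Definition preimage_submod x y : submodClosed (hom x y) :=
  HB.pack (@preimage_pred x y)
    (GRing.isSubmodClosed.Build k (hom x y) (@preimage_pred x y)
      (@preimage_closed x y)).

Definition preimage_ideal : ideal C.
Proof.
refine (@Ideal k C preimage_submod _ _) => x y z g f;
  rewrite /in_mem /= /preimage_pred fmapM => h.
  exact: id_compl.
exact: id_compr.
Defined.

(** The preimage of an ideal is an ideal, so generators suffice. With the zero ideal of [vect_cat]
    this shows that a representation kills a generated ideal. *)
Lemma gen_ideal_preimage (S : forall x y : C, set (hom x y)) :
  (forall x y (f : hom x y), S x y f -> fmap F f \in J (F x) (F y)) ->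
  forall x y (f : hom x y), f \in gen_ideal S x y -> fmap F f \in J (F x) (F y).
Proof. by move=> SJ x y f /asboolP/(_ preimage_ideal); apply. Qed.

End Preimage.

Lemma rep_iso_bij (k : fieldType) (C : lincat k) (M N : rep C)
    (f : forall x, 'Hom(M x, N x)) (g : forall x, 'Hom(N x, M x)) :
  natural f -> (forall x v, g x (f x v) = v) -> (forall x v, f x (g x v) = v) ->
  rep_iso M N.
Proof.
move=> nf gf fg; apply/rep_isoP; exists f, g; split=> // x y h v.
by rewrite -{1}(fg x v) -nf gf.
Qed.

Section Reduction.
Variables (k : fieldType) (Q : thread_quiver) (I : ideal (path_cat k Q)).
Local Notation C := (path_cat k Q).
Variable sigma : forall a : arrow Q, thread a -> thread a.
Hypothesis sigma_le : forall a (p q : thread a),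
  (p <= q)%O -> (sigma p <= sigma q)%O.
Hypothesis sigma_idem : forall a (p : thread a), sigma (sigma p) = sigma p.
Hypothesis sigma_fin : forall a, finite_set (range (@sigma a)).

Local Notation P := (collapse_vp sigma_le sigma_fin).
Local Notation J := (completion P I).
Local Notation cl := (collapse sigma).
Local Notation cmp := (collapse_map sigma_le).

Definition collapse_fun : lfunctor C C.
Proof.
refine (@LFunctor k C C cl (fun x y (f : hom x y) => cmp f) _ _ _).
- exact: collapse_map_lin.
- exact: collapse_map1.
- by move=> x y z g f; apply: collapse_mapM.
Defined.

(** If [f] is equivalent to [g] in [I], its collapse equals that of [g] up to endpoints, and the
    latter is equivalent to [g], hence a generator. *)
Lemma collapse_completion (x y : C) (f : hom x y) :
  f \in J x y -> cmp f \in J (cl x) (cl y).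
Proof.
apply: (@gen_ideal_preimage k C C collapse_fun J) => {}x {}y {}f [x' [y' [g [gI fg]]]].
have cg : cmp g \in J (cl x') (cl y').
  apply: gen_ideal_sub; exists x', y', g; split=> //.
  by apply/pequiv_sym/pequiv_collapse.
pose M (t : {xy : tobj Q * tobj Q & path_hom k xy.1 xy.2 : Type}) :=
  projT2 t \in J (projT1 t).1 (projT1 t).2.
rewrite -[_ \in _]/(M (tagged_hom (cmp f))) (pequiv_tagged fg).
exact: cg.
Qed.

Definition collapse_sample : set (tobj Q) := range cl.

Lemma collapse_is_sample : is_sample P collapse_sample.
Proof.
move=> _ [x _ <-]; exists (cl x); split.
  by split; [rewrite /collapse_cell /= collapse_idem | exists x].
by move=> y' [/= yx [y _ yE]]; rewrite -yx -yE collapse_idem.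
Qed.

Definition collapse_obj (x : tobj Q) : full_subcat (C := quot_cat J) collapse_sample :=
  @SubObj k (quot_cat J) collapse_sample (cl x) (imageP cl (Logic.I : [set: tobj Q] x)).


Lemma collapse_qpi (x y : C) (f : hom x y) :
  qpi (J (cl x) (cl y)) (cmp (qrepr (qpi (J x y) f))) = qpi (J (cl x) (cl y)) (cmp f).
Proof.
apply/qpi_eq; have := collapse_map_lin sigma_le (-1) f (qrepr (qpi (J x y) f)).
rewrite !scaleN1r => E; rewrite addrC -E addrC.
by apply: collapse_completion; apply/qpi_eq; rewrite qreprK.
Qed.

Definition collapse_red :
  lfunctor (quot_cat J) (full_subcat (C := quot_cat J) collapse_sample).
Proof.
refine (@LFunctor k (quot_cat J) (full_subcat (C := quot_cat J) collapse_sample)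
  collapse_obj
  (fun x y (f : qhom J x y) => qpi (J (cl x) (cl y)) (cmp (qrepr f))) _ _ _).
- move=> x y a f g; rewrite -[f]qreprK -[g]qreprK -qpi_lin !collapse_qpi.
  by rewrite collapse_map_lin qpi_lin.
- move=> x; rewrite [LHS](@collapse_qpi x x (@idm k C x)).
  by rewrite [cmp _]collapse_map1.
- move=> x y z g f; rewrite -[g]qreprK -[f]qreprK /=.
  by rewrite qcompE !collapse_qpi [cmp _]collapse_mapM -qcompE.
Defined.

(** A morphism [f'] between sample points is its own collapse, so equivalence to [f] forces
    [f' = cmp f] already in the path category. *)
Lemma collapse_is_reduction : is_reduction collapse_red.
Proof.
split=> [x|x y f h]; first by apply/same_cellE; rewrite /= collapse_idem.
split=> [<-|[f' [<- ff']]].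
  exists (cmp f); split; last exact: pequiv_collapse.
  exact/esym/collapse_qpi.
rewrite [LHS](@collapse_qpi x y f) /=.
suff -> : f' = cmp f by [].
have E := pequiv_tagged ff'.
rewrite [RHS]tagged_collapse_fix ?collapse_idem // in E.
exact/esym/(@existT_inj _ _ _ _ _ E).
Qed.

Section Induced.
Variable S : rep (quot_cat I).
Hypothesis eta_bij : forall a (p q : thread a), (p <= q)%O -> sigma p = sigma q ->
  lker (thr_eta S p q) == 0%VS /\ limg (thr_eta S p q) = fullv.

Lemma is_eta_bij (x y : C) (u : hom x y) : is_eta P u ->
  lker (cmap S u) == 0%VS /\ limg (cmap S u) = fullv.
Proof.
case=> [v|a p q pq /same_cellE/Thr_inj E].
  have -> : cmap S (idm (Vtx v : C)) = \1%VF.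
    by apply/lfunP => w; rewrite id_lfunE; apply: cmap1.
  by rewrite lim1g; split=> //; apply/lker0P => w w'; rewrite !id_lfunE.
by have := eta_bij pq E; rewrite !(thr_etaE S pq).
Qed.

(** In [v1 f u1 = v2 g u2] with [g] in [I] the right side acts as zero; [u1] acts surjectively and
    [v1] injectively, so [f] acts as zero. *)
Lemma cmap_completion (x y : C) (f : hom x y) : f \in J x y -> cmap S f = 0.
Proof.
move=> fJ; apply/eqP.
apply: (@gen_ideal_preimage k C (vect_cat k) (fcomp S (quot_fun I)) (zero_ideal _)) fJ.
move=> {}x {}y {}f [x' [y' [g [gI [_ _]]]]].
move=> [z [w [u1 [u2 [v1 [v2 [eu1 eu2 ev1 ev2 E]]]]]]].
apply/eqP; rewrite -[LHS]/(cmap S f); apply/lfunP => v.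
have : v \in limg (cmap S u1) by rewrite (is_eta_bij eu1).2 memvf.
move=> /memv_imgP[t _ ->]; apply: (lker0P (is_eta_bij ev1).1).
rewrite zero_lfunE linear0.
have := congr1 (fun h => cmap S (h : path_hom k z w) t) E.
by rewrite /= !cmapM (cmap_ideal S gI) zero_lfunE linear0.
Qed.

Lemma cmap_qrepr (x y : C) (f : hom x y) : cmap S (qrepr (qpi (J x y) f)) = cmap S f.
Proof.
have /cmap_completion : qrepr (qpi (J x y) f) - f \in J x y.
  by apply/qpi_eq; rewrite qreprK.
have := @cmap_lin k Q I S x y (-1) f (qrepr (qpi (J x y) f)).
rewrite !scaleN1r [- f + _]addrC => -> /eqP.
by rewrite addrC subr_eq0 => /eqP.
Qed.

Definition compl_rep : rep (quot_cat J).
Proof.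
refine (@LFunctor k (quot_cat J) (vect_cat k) (fun x => S x)
  (fun x y (f : qhom J x y) => cmap S (qrepr f)) _ _ _).
- move=> x y a f g; rewrite -[f]qreprK -[g]qreprK -qpi_lin !cmap_qrepr.
  exact: cmap_lin.
- move=> x; apply/lfunP => v.
  by rewrite [cmap _ _]cmap_qrepr [LHS]cmap1 id_lfunE.
- move=> x y z g f; apply/lfunP => v; rewrite -[g]qreprK -[f]qreprK /= qcompE.
  by rewrite comp_lfunE !cmap_qrepr; apply: cmapM.
Defined.

Definition sample_rep : rep (full_subcat (C := quot_cat J) collapse_sample).
Proof.
refine (@LFunctor k (full_subcat (C := quot_cat J) collapse_sample) (vect_cat k)
  (fun x => S (so_val x)) (fun x y f => rep_map compl_rep f) _ _ _).
- by move=> x y a f g; exact: (@rep_map_lin _ _ compl_rep (so_val x) (so_val y) a f g).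
- move=> x; apply/lfunP => v.
  by rewrite [LHS](@rep_map1 _ _ compl_rep (so_val x) v) id_lfunE.
- move=> x y z g f; apply/lfunP => v; rewrite comp_lfunE.
  exact: (@rep_mapM _ _ compl_rep _ _ _ g f v).
Defined.

Lemma Ind_plmap x y (t : plike x y) :
  plmap (Ind collapse_red sample_rep) t = plmap S (collapse_plike sigma_le t).
Proof.
rewrite /plmap -collapse_mapU.
transitivity (cmap S (qrepr (qpi (J (cl x) (cl y)) (cmp (pl k t)))));
  last exact: cmap_qrepr.
rewrite -[LHS]/(cmap S (qrepr (qpi (J (cl x) (cl y))
  (cmp (qrepr (qpi (J x y) (qrepr (qpi (I x y) (pl k t))))))))).
congr (cmap S (qrepr _)).
rewrite (@quot_quotE k C I J (@sub_completion k Q P I) x y (pl k t)).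
exact: collapse_qpi.
Qed.

(** A point and its sample point are compared through [lower_pt], by inverting [lower_in] and
    applying [lower_out]. Naturality is checked after the injective map of [upper_out], where it
    becomes [collapse_square]. *)
Lemma rep_iso_Ind : rep_iso S (Ind collapse_red sample_rep).
Proof.
pose li x := plmap S (lower_in sigma x); pose lo x := plmap S (lower_out sigma x).
pose ui x := plmap S (upper_in sigma x); pose uo x := plmap S (upper_out sigma x).
have [bli blo] : (forall x, lker (li x) == 0%VS /\ limg (li x) = fullv) /\
    (forall x, lker (lo x) == 0%VS /\ limg (lo x) = fullv).
  by split=> x; apply: is_eta_bij; [apply: lower_in_eta | apply: lower_out_eta].
have buo x : lker (uo x) == 0%VS.
  by case: (is_eta_bij (upper_out_eta k sigma_le sigma_idem sigma_fin x)).
have liK x v : li x ((li x)^-1%VF v) = v by rewrite limg_lfunVK // (bli x).2 memvf.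
have loK x v : lo x ((lo x)^-1%VF v) = v by rewrite limg_lfunVK // (blo x).2 memvf.
have Kli x v : (li x)^-1%VF (li x v) = v by rewrite lker0_lfunK // (bli x).1.
have Klo x v : (lo x)^-1%VF (lo x v) = v by rewrite lker0_lfunK // (blo x).1.
pose th (x : quot_cat I) : 'Hom(S x, Ind collapse_red sample_rep x) :=
  (lo x \o (li x)^-1)%VF.
pose ht (x : quot_cat I) : 'Hom(Ind collapse_red sample_rep x, S x) :=
  (li x \o (lo x)^-1)%VF.
apply: (@rep_iso_bij _ _ _ _ th ht) => [|x v|x v]; last 2 first.
- by rewrite !comp_lfunE Klo liK.
- by rewrite !comp_lfunE Kli loK.
apply: natural_plmap => x y f v; rewrite Ind_plmap; apply: (lker0P (buo y)).
have uoth w : uo y (th y w) = ui y w.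
  by rewrite -{2}(liK y w) comp_lfunE -!plmapM lower_upper.
rewrite [LHS]uoth -{1}(liK x v) comp_lfunE.
have := congr1 (fun h => cmap S h ((li x)^-1%VF v)) (collapse_square sigma_le (pl k f)).
by rewrite collapse_mapU !cmapM.
Qed.

(** An idempotent of [sample_rep] pulls back to one of the induced representation, which is
    isomorphic to [S]; triviality descends since every sample object is some [collapse_obj x]. *)
Lemma sample_rep_indecomposable : indecomposable S -> indecomposable sample_rep.
Proof.
move=> iS; have iInd := rep_iso_indecomposable rep_iso_Ind iS.
have samp (y : full_subcat (C := quot_cat J) collapse_sample) :
    exists x, y = collapse_obj x.
  case: y => y [x xT xy]; exists x; subst y; rewrite /collapse_obj.
  by congr SubObj; apply: Prop_irrelevance.
apply: idem_indecomposable.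
  move=> /zero_repP N0; apply: iInd.1; apply/zero_repP => x v.
  exact: (N0 (collapse_obj x) v).
move=> e ne ee.
pose e' (x : quot_cat I) : 'End(Ind collapse_red sample_rep x) := e (collapse_obj x).
have ne' : natural e'.
  move=> x y h v; exact: (ne (collapse_obj x) (collapse_obj y)
     (fmap collapse_red (fmap (quot_quot (@sub_completion k Q P I)) h)) v).
have ee' : idempotent_family e' by move=> x v; apply: ee.
have [e0|e1] := indecomposable_idem iInd ne' ee'; [left|right] => y v.
  by have [x xy] := samp y; subst y; apply: (e0 x v).
by have [x xy] := samp y; subst y; apply: (e1 x v).
Qed.

End Induced.

End Reduction.

(** [sigma] sends a point to one chosen point with the same key. If it reversed [p <= q], the
    opposite inequalities would make the keys equal, hence the images too. *)
Lemma monotone_retraction d (T : orderType d) (key : T -> nat * nat) m :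
  (forall p q, (p <= q)%O -> ((key q).1 <= (key p).1)%N /\ ((key p).2 <= (key q).2)%N) ->
  (forall p, (key p).1 <= m /\ (key p).2 <= m)%N ->
  exists sigma : T -> T, [/\ forall p q, (p <= q)%O -> (sigma p <= sigma q)%O,
    forall p, sigma (sigma p) = sigma p, finite_set (range sigma) &
    forall p q, sigma p = sigma q -> key p = key q].
Proof.
move=> mono bd.
(* The choice is made per key value rather than per point, so that points with equal keys share a
   representative. *)
have ex c : exists o : option T, (forall p, o = Some p -> key p = c) /\
    (o = None -> forall p, key p <> c).
  have [[p pc]|np] := pselect (exists p, key p = c).
    by exists (Some p); split=> // _ [<-].
  by exists None; split=> // _ p pc; apply: np; exists p.
pose o c := sval (cid (ex c)); have oP c := svalP (cid (ex c)).
pose sigma p := odflt p (o (key p)).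
have sP p : o (key p) = Some (sigma p).
  rewrite /sigma; case E : (o (key p)) => [q //|].
  by case: ((oP (key p)).2 E p erefl).
have key_s p : key (sigma p) = key p := (oP (key p)).1 _ (sP p).
have sE p q : key p = key q -> sigma p = sigma q.
  by move=> E; have := sP p; rewrite E sP => -[].
exists sigma; split=> [p q pq|p||p q E].
- have [//|qp] := orP (le_total (sigma p) (sigma q)).
  suff -> : sigma p = sigma q by [].
  apply: sE; have [a1 a2] := mono _ _ pq; have [b1 b2] := mono _ _ qp.
  rewrite !key_s in b1 b2; rewrite [key p]surjective_pairing [key q]surjective_pairing.
  by congr (_, _); apply/eqP; rewrite eqn_leq ?a1 ?b1 ?a2 ?b2.
- by apply: sE; rewrite key_s.
- pose s := [seq (i, j) | i <- iota 0 m.+1, j <- iota 0 m.+1].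
  apply: (sub_finite_set _ (finite_seq (pmap o s))) => _ [p _ <-].
  suff : sigma p \in pmap o s by [].
  rewrite mem_pmap -sP map_f // [key p]surjective_pairing.
  by have [b1 b2] := bd p; apply: allpairs_f; rewrite mem_iota ltnS.
- by rewrite -key_s E key_s.
Qed.


(** * Noise, noise-free summands and induction *)

Section Noise.
Variables (k : fieldType) (Q : thread_quiver) (I : ideal (path_cat k Q)).
Implicit Types M N S : rep (quot_cat I).

Lemma indecomposable_induced S :
  indecomposable S -> ~ noise S -> induced_from_subthreading S.
Proof.
move=> iS nS.
have ex (a : arrow Q) : exists sigma : thread a -> thread a,
   [/\ forall p q, (p <= q)%O -> (sigma p <= sigma q)%O,
    forall p, sigma (sigma p) = sigma p, finite_set (range sigma) &
    forall p q, sigma p = sigma q -> thr_key S p = thr_key S q].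
  (* The sum of the dimensions at source and target is one bound for both ranks. *)
  apply: (@monotone_retraction _ _ _
    (\dim {:S (Vtx (src a))} + \dim {:S (Vtx (tgt a))})).
    by move=> p q pq; split; [apply: thr_key_in | apply: thr_key_out].
  move=> p; split; last first.
    by apply: leq_trans (leq_addl _ _); apply/dimvS/subvf.
  apply: leq_trans (leq_addr _ _).
  by rewrite -(limg_ker_dim (thr_in S p) fullv) leq_addl.
pose sigma a := sval (cid (ex a)); have sP a := svalP (cid (ex a)).
have sle a (p q : thread a) : (p <= q)%O -> (sigma a p <= sigma a q)%O.
  by have [h _ _ _] := sP a; apply: h.
have sidem a (p : thread a) : sigma a (sigma a p) = sigma a p.
  by have [_ h _ _] := sP a; apply: h.
have sfin a : finite_set (range (sigma a)) by have [_ _ h _] := sP a.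
have bij a (p q : thread a) : (p <= q)%O -> sigma a p = sigma a q ->
  lker (thr_eta S p q) == 0%VS /\ limg (thr_eta S p q) = fullv.
  by move=> pq E; apply: thr_eta_bij => //; have [_ _ _ h] := sP a; apply: h.
exists (collapse_vp sle sfin), (collapse_sample sigma).
split; first exact: collapse_is_sample.
exists (collapse_red I sle sidem sfin), (sample_rep sle sfin bij).
split; first exact: collapse_is_reduction.
- exact: sample_rep_indecomposable.
- exact: rep_iso_Ind.
Qed.

Lemma noiseP M : noise M <-> forall v (u : M (Vtx v)), u = 0.
Proof.
split=> [nM v u|M0].
  have [M0|Mv] := eqVneq ({: M (Vtx v)}%VS) 0%VS.
    by apply/eqP; rewrite -memv0 -M0 memvf.
  by have : (supp M `&` range Vtx) (Vtx v) by []; rewrite nM.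
apply/seteqP; split=> // x [xM [v _ vx]]; move: xM; rewrite -vx /supp /= => /eqP; apply.
by apply/vspaceP => u; rewrite (M0 v u) !mem0v.
Qed.

Lemma indecomposable_noise_free S : indecomposable S -> ~ noise S -> noise_free S.
Proof.
move=> [_ iS] nS N [N' SN] /noiseP nN; have [//|/zero_repP N'0] := iS _ _ SN.
case: nS; apply/noiseP => v u; have /rep_isoP[f [g [_ _ gf _]]] := SN.
rewrite -(gf _ u); case: (f _ u) => a b.
by rewrite (nN v a) (N'0 _ b) -[(0, 0)]/(0 : (N (Vtx v) * N' (Vtx v))%type) linear0.
Qed.

Lemma noise_free_vertex S : indecomposable S -> noise_free S ->
  exists v (u : S (Vtx v)), u <> 0.
Proof.
move=> iS nfS; apply: contrapT => nv.
have S0 v (u : S (Vtx v)) : u = 0.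
  by apply: contrapT => u0; apply: nv; exists v, u.
have n1 : natural (fun x => \1%VF : 'End(S x)) by apply: natural1.
have ee : idempotent_family (fun x => \1%VF : 'End(S x)).
  by move=> x v; rewrite !id_lfunE.
(* [S] is exhibited as a summand of itself, as the image of the identity, so that noise-freeness
   applies to it. *)
have : zero_rep (sub_rep (limg_stable n1)).
  apply: nfS; first by exists (sub_rep (lker_stable n1)); apply: idem_split.
  by apply/noiseP => v u; apply: subvs_inj; rewrite (S0 v (vsval u)).
move=> /zero_repP z; apply: iS.1; apply/zero_repP => x v.
have vI : v \in limg (\1%VF : 'End(S x)) by rewrite lim1g memvf.
by have /(congr1 vsval) := z x (Subvs vI).
Qed.

End Noise.

Theorem theorem1 (k : closedFieldType) (Q : thread_quiver)
    (I : ideal (path_cat k Q)) (M : rep (quot_cat I)) :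
  ((exists (J : choiceType) (N : J -> rep (quot_cat I)), decomposition M N) /\
   (forall (J J' : choiceType) (N : J -> rep (quot_cat I))
      (N' : J' -> rep (quot_cat I)),
      decomposition M N -> decomposition M N' ->
      exists sigma : J -> J', bijective sigma /\
        forall j, rep_iso (N j) (N' (sigma j)))) /\
  (forall S : rep (quot_cat I), indecomposable S -> direct_summand S M ->
     noise S \/ (noise_free S /\ induced_from_subthreading S)) /\
  (finite_set [set: vertex Q] -> finite_set [set: arrow Q] ->
   forall (J : choiceType) (N : J -> rep (quot_cat I)), decomposition M N ->
     finite_set [set j | noise_free (N j)]).
Proof.
split; last split.
- split=> [|J J' N N' dN dN']; first exact: decomposition_exists.
  exact: decomposition_unique dN dN'.
- move=> S iS _; have [nS|nS] := pselect (noise S); [by left|right].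
  by split; [apply: indecomposable_noise_free | apply: indecomposable_induced].
- move=> fV _ J N [iN [i ds]].
  (* A noise-free summand is nonzero at some vertex, and each vertex sees only finitely many
     summands. *)
  have fU : finite_set (\bigcup_(v in [set: vertex Q])
      [set j | exists u : N j (Vtx v), u <> 0]).
    by apply: bigcup_finite => // v _; apply: (ds_finite ds).
  apply: sub_finite_set fU => j /= nf.
  by have [v [u u0]] := noise_free_vertex (iN j) nf; exists v => //; exists u.
Qed.
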